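(* Let $\{X_t,t\in\mathbb R\}$ be a measurable $S\alpha S$ process with stationary increments generated by a dissipative flow. Then there exist a Borel space $W$, a $\sigma$-finite measure $Q$ on $W$, a function $g\in L^\alpha(W\times\mathbb R,Q\otimes\lambda)$, where $\lambda$ is Lebesgue measure, and an independently scattered $S\alpha S$ random measure $N$ on $W\times\mathbb R$ with control measure $Q\otimes\lambda$, such that $$\{X_t-X_0,\ t\in\mathbb R\}\stackrel{d}{=}\left\{\int_W\int_{\mathbb R}\left[g(x,t+u)-g(x,u)+\int_0^tg(x,s+u)\,ds\right]N(dx,du),\ t\in\mathbb R\right\}.$$
   Context: $0<\alpha<2$. A real process is $S\alpha S$ if all its finite linear combinations are symmetric $\alpha$-stable (complex case: finite complex linear combinations are rotationally invariant $\alpha$-stable). An independently scattered $S\alpha S$ random measure $M$ with control measure $\mu$ satisfies $E\exp\{i\theta M(A)\}=\exp\{-|\theta|^\alpha\mu(A)\}$ (complex case: $E\exp\{i\,\mathrm{Re}(\overline{\theta M(A)})\}=\exp\{-|\theta|^\alpha\mu(A)\}$) for $\mu(A)<\infty$. A spectral representation of $X$ is a family $\{f_t\}\subseteq L^\alpha(S,\mathcal B,\mu)$, with $(S,\mathcal B)$ standard Borel and $\mu$ $\sigma$-finite, such that $\{X_t\}\stackrel{d}{=}\{\int_Sf_t\,dM\}$. Stationary increments: $\{X_{t+h}-X_{s+h}\}_{t,s}\stackrel{d}{=}\{X_t-X_s\}_{t,s}$ for every $h$. A measurable flow on $S$: maps $\varphi_t$ with $(t,s)\mapsto\varphi_t(s)$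 measurable, $\varphi_{t_1+t_2}=\varphi_{t_1}\circ\varphi_{t_2}$, $\varphi_0=\mathrm{id}$; it is nonsingular if $\mu(\varphi_t^{-1}(A))=0\iff\mu(A)=0$, and then $\rho_t=d(\mu\circ\varphi_t)/d\mu$. A cocycle is a measurable $a_t(s)$ with values in $\{-1,1\}$ (in $\{|z|=1\}$ in the complex case) such that $a_{t_1+t_2}(s)=a_{t_2}(s)a_{t_1}(\varphi_{t_2}(s))$ $\mu$-a.e. The measurable stationary-increment $S\alpha S$ process $X$ is generated by the measurable nonsingular flow $\{\varphi_t\}$ on $(S,\mathcal B,\mu)$ if it has a spectral representation $\{f_t\}\subseteq L^\alpha(S,\mathcal B,\mu)$ such that, for some cocycle $\{a_t\}$ and some $g_0\in L^\alpha(S,\mathcal B,\mu)$, for every $t$, $\mu$-a.e., $$f_t-f_0=a_t\rho_t^{1/\alpha}g_0\circ\varphi_t-g_0+\int_0^ta_u\rho_u^{1/\alpha}g_0\circ\varphi_u\,du,$$ and $S$ is (mod $\mu$) the union of the supports of $f_t-f_0$, $t\in\mathbb R$, equivalently of $g_0\circ\varphi_t$, $t\in\mathbb R$. The integrals with respect to $du$ here, and $ds$ in the claim, are Riemann integrals of $L^\alpha$-valued curves (limits of Riemann sums in $L^\alpha$), with $\int_0^t=-\int_t^0$ for $t<0$. In this situation the dissipative part of the flow (in the Hopf decomposition) is $\{s\in S:\int_{\mathbb R}|g_0(\varphi_t(s))|^\alpha\rho_t(s)\,\lambda(dt)<\infty\}$ mod $\mu$; the flow is dissipative if this set is all of $S$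 mod $\mu$. *)

(* Defs.v *)
From HB Require Import structures.
From mathcomp Require Import all_boot all_order all_algebra.
From mathcomp Require Import complex.
From mathcomp Require Import all_classical all_reals all_analysis.

Set Implicit Arguments.
Unset Strict Implicit.
Unset Printing Implicit Defensive.

Import Order.TTheory GRing.Theory Num.Theory.
Import numFieldNormedType.Exports.

Local Open Scope classical_set_scope.
Local Open Scope ring_scope.

(** The real and the complex theory are treated at once: [RealScalar] processes and
    kernels take values in [R], [ComplexScalar] ones in [R[i]]. *)
Inductive scalar_kind := RealScalar | ComplexScalar.

Definition scalarType (R : realType) (k : scalar_kind) : numFieldType :=
  match k with RealScalar => R | ComplexScalar => R[i] end.

Section scalars.
Variables (R : realType) (k : scalar_kind).

Definition re : scalarType R k -> R :=
  match k return scalarType R k -> R with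
  | RealScalar => fun x : R => x
  | ComplexScalar => fun z : R[i] => complex.Re z
  end.

Definition im : scalarType R k -> R :=
  match k return scalarType R k -> R with
  | RealScalar => fun=> 0
  | ComplexScalar => fun z : R[i] => complex.Im z
  end.

Definition modulus (z : scalarType R k) : R := Num.sqrt (re z ^+ 2 + im z ^+ 2).

Definition ofR : R -> scalarType R k :=
  match k return R -> scalarType R k with
  | RealScalar => fun x : R => x
  | ComplexScalar => fun x : R => (real_complex R x : R[i])
  end.

(** Scalars carry no measurable structure in the library; they are given the
    Borel structure of [R * R] through [coords]. *)
Definition plane := (measurableTypeR R * measurableTypeR R)%type.

Definition coords (z : scalarType R k) : plane := (re z, im z).

Definition scalar_measurable d (T : measurableType d) (f : T -> scalarType R k) :=
  measurable_fun [set: T] (fun x => coords (f x)).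

End scalars.

Arguments ofR {R} k.

(** Isomorphic, through [f], to a Borel subset [D] of a Polish space [E]. *)
Definition standard_borel (R : realType) d (S : measurableType d) : Prop :=
  exists (E : completePseudoMetricType R) (D : set E) (f : S -> E),
    [/\ hausdorff_space E,
        (exists C : set E, countable C /\ dense C),
        <<s @open E >> D,
        injective f /\ range f = D
      & forall A : set S, measurable A <-> <<s @open E >> (f @` A)].

Section processes.
Variables (R : realType) (k : scalar_kind) (alpha : R).
Context d (T : measurableType d) (P : probability T R).
Notation K := (scalarType R k).

(** [E exp (i Re (theta Y))]; conjugating [theta * Y] does not change it. *)
Definition charfun (Y : T -> K) (theta : K) : R[i] :=
  Complex (fine 'E_P[(fun w => cos (re (theta * Y w)))])
          (fine 'E_P[(fun w => sin (re (theta * Y w)))]).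

(** Symmetric (real case) or rotationally invariant (complex case)
    [alpha]-stable random variable, with [c] the [alpha]-th power of the scale
    parameter. *)
Definition SaS_variable (Y : T -> K) : Prop :=
  scalar_measurable Y /\
  exists c : R, 0 <= c /\
    forall theta : K,
      charfun Y theta =
      real_complex R (expR (- (c * modulus theta `^ alpha))).

Definition SaS_process (I : Type) (X : I -> T -> K) : Prop :=
  forall (n : nat) (c : 'I_n -> K) (t : 'I_n -> I),
    SaS_variable (fun w => \sum_(i < n) c i * X (t i) w).

Definition measurable_process (X : R -> T -> K) : Prop :=
  scalar_measurable (fun p : measurableTypeR R * T => X p.1 p.2).

Definition cvg_in_probability (Y : nat -> T -> K) (Z : T -> K) : Prop :=
  forall e : R, 0 < e ->
    (fun n => P [set w | e <= modulus (Y n w - Z w)]) @ \oo --> 0%E.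

Definition mutually_independent n (Y : 'I_n -> T -> K) : Prop :=
  forall (J : {set 'I_n}) (B : 'I_n -> set (plane R)),
    (forall i, measurable (B i)) ->
    P (\big[setI/setT]_(i in J) [set w | B i (coords (Y i w))]) =
    (\prod_(i in J) P [set w | B i (coords (Y i w))])%E.

End processes.

(** Equality of all finite-dimensional distributions. *)
Definition eq_fdd (R : realType) (k : scalar_kind) (I : Type)
    d (T : measurableType d) (P : probability T R) (X : I -> T -> scalarType R k)
    d' (T' : measurableType d') (P' : probability T' R)
    (X' : I -> T' -> scalarType R k) : Prop :=
  forall (n : nat) (t : 'I_n -> I) (B : set (n.-tuple (plane R))),
    measurable B ->
    P [set w | B [tuple coords (X (t i) w) | i < n]] =
    P' [set w | B [tuple coords (X' (t i) w) | i < n]].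

Definition stationary_increments (R : realType) (k : scalar_kind)
    d (T : measurableType d) (P : probability T R)
    (X : R -> T -> scalarType R k) : Prop :=
  forall h : R,
    eq_fdd P (fun (p : R * R) w => X (p.1 + h) w - X (p.2 + h) w)
           P (fun (p : R * R) w => X p.1 w - X p.2 w).

Section Lalpha.
Variables (R : realType) (k : scalar_kind) (alpha : R).
Context d (S : measurableType d) (mu : {measure set S -> \bar R}).
Notation K := (scalarType R k).

Definition in_Lalpha (f : S -> K) : Prop :=
  scalar_measurable f /\
  (\int[mu]_s (modulus (f s) `^ alpha)%:E < +oo)%E.

(** The [alpha]-th power of the [L^alpha] (quasi-)norm of [f - g], which
    metrizes [L^alpha] for [alpha < 1] and gives the same topology as the norm
    for [1 <= alpha]. *)
Definition Lalpha_dist (f g : S -> K) : \bar R :=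
  (\int[mu]_s (modulus (f s - g s) `^ alpha)%:E)%E.

(** The partition [a :: x] of [[a, b]] is tagged by [xi]. *)
Definition riemann_sum (c : R -> S -> K) (a : R) (x : seq R) (xi : nat -> R)
    (s : S) : K :=
  \sum_(i < size x) ofR k (nth 0 x i - nth 0 (a :: x) i) * c (xi i) s.

Definition is_riemann_integral (a b : R) (c : R -> S -> K) (J : S -> K) :
    Prop :=
  in_Lalpha J /\
  forall e : R, 0 < e -> exists2 delta : R, 0 < delta &
    forall (x : seq R) (xi : nat -> R),
      itv_partition a b x ->
      (forall i, (i < size x)%N ->
         nth 0 (a :: x) i <= xi i <= nth 0 x i /\
         nth 0 x i - nth 0 (a :: x) i < delta) ->
      (Lalpha_dist (riemann_sum c a x xi) J < e%:E)%E.

Definition is_oriented_integral (t : R) (c : R -> S -> K) (J : S -> K) : Prop :=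
  if 0 <= t then is_riemann_integral 0 t c J
  else is_riemann_integral t 0 c (fun s => - J s).

(** [S] is, mod [mu], the smallest measurable set containing mod [mu] the
    support of every [F t]: this is the union mod [mu] of an uncountable
    family of supports, each of which is only defined up to a null set. *)
Definition full_support (F : R -> S -> K) : Prop :=
  forall B : set S, measurable B ->
    (forall t, {ae mu, forall s, F t s != 0 -> B s}) ->
    mu (~` B) = 0%E.

End Lalpha.

Section random_measures.
Variables (R : realType) (k : scalar_kind) (alpha : R).
Context d (S : measurableType d) (mu : {measure set S -> \bar R}).
Context d' (T : measurableType d') (P : probability T R).
Notation K := (scalarType R k).

Definition finite_set_of (A : set S) : Prop :=
  measurable A /\ (mu A < +oo)%E.

(** Only the values [M A] with [finite_set_of A] matter. *)
Definition SaS_random_measure (M : set S -> T -> K) : Prop :=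
  [/\ (forall A, finite_set_of A -> scalar_measurable (M A)),
      (forall A, finite_set_of A -> forall theta : K,
         charfun P (M A) theta =
         real_complex R (expR (- (modulus theta `^ alpha * fine (mu A))))),
      (forall n (A : 'I_n -> set S),
         (forall i, finite_set_of (A i)) -> trivIset [set: 'I_n] A ->
         mutually_independent P (fun i => M (A i)))
    & (forall A : nat -> set S,
         (forall n, finite_set_of (A n)) -> trivIset [set: nat] A ->
         finite_set_of (\bigcup_n A n) ->
         {ae P, forall w,
           (fun n => modulus (\sum_(i < n) M (A i) w - M (\bigcup_n A n) w))
             @ \oo --> (0 : R)})].

(** [Y] is a version of the integral of [f] with respect to [M]: the limit in
    probability of the integrals of simple functions converging to [f] in
    [L^alpha]. *)
Definition is_stochastic_integral (M : set S -> T -> K) (f : S -> K)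
    (Y : T -> K) : Prop :=
  [/\ in_Lalpha alpha mu f,
      scalar_measurable Y
    & exists (m : nat -> nat) (c : nat -> nat -> K) (A : nat -> nat -> set S),
      [/\ (forall n i, finite_set_of (A n i)),
          (fun n => Lalpha_dist alpha mu
             (fun s => \sum_(i < m n) c n i * \1_(A n i) s) f)
            @ \oo --> 0%E
        & cvg_in_probability P
            (fun n w => \sum_(i < m n) c n i * M (A n i) w) Y]].

End random_measures.

Definition spectral_representation (R : realType) (k : scalar_kind) (alpha : R)
    d (T : measurableType d) (P : probability T R) (X : R -> T -> scalarType R k)
    dS (S : measurableType dS) (mu : {sigma_finite_measure set S -> \bar R})
    (f : R -> S -> scalarType R k) : Prop :=
  [/\ standard_borel R S,
      (forall t, in_Lalpha alpha mu (f t))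
    & exists d' (T' : measurableType d') (P' : probability T' R)
        (M : set S -> T' -> scalarType R k) (Y : R -> T' -> scalarType R k),
      [/\ SaS_random_measure alpha mu P' M,
          (forall t, is_stochastic_integral alpha mu P' M (f t) (Y t))
        & eq_fdd P X P' Y]].

Section flows.
Variables (R : realType) (k : scalar_kind) (alpha : R).
Context dS (S : measurableType dS) (mu : {sigma_finite_measure set S -> \bar R}).
Notation K := (scalarType R k).

Definition measurable_flow (phi : R -> S -> S) : Prop :=
  [/\ measurable_fun [set: measurableTypeR R * S] (fun p => phi p.1 p.2),
      (forall t1 t2 s, phi (t1 + t2) s = phi t1 (phi t2 s))
    & (forall s, phi 0 s = s)].

Definition nonsingular (phi : R -> S -> S) : Prop :=
  forall t (A : set S), measurable A ->
    mu (phi t @^-1` A) = 0%E <-> mu A = 0%E.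

(** [rho t] is the Radon-Nikodym derivative of [A |-> mu (phi t @` A)], in a
    finite, nonnegative and jointly measurable version. *)
Definition flow_density (phi : R -> S -> S) (rho : R -> S -> R) : Prop :=
  [/\ measurable_fun [set: measurableTypeR R * S]
        (fun p => rho p.1 p.2 : measurableTypeR R),
      (forall t s, 0 <= rho t s)
    & (forall t (A : set S), measurable A ->
         mu (phi t @` A) = (\int[mu]_(s in A) (rho t s)%:E)%E)].

Definition cocycle (phi : R -> S -> S) (a : R -> S -> K) : Prop :=
  [/\ scalar_measurable (fun p : measurableTypeR R * S => a p.1 p.2),
      (forall t s, modulus (a t s) = 1)
    & (forall t1 t2,
         {ae mu, forall s, a (t1 + t2) s = a t2 s * a t1 (phi t2 s)})].

Definition transported (phi : R -> S -> S) (rho : R -> S -> R)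
    (a : R -> S -> K) (g0 : S -> K) (t : R) (s : S) : K :=
  a t s * ofR k (rho t s `^ alpha^-1) * g0 (phi t s).

(** [X] is generated by the flow [phi], where [rho] is the density of [phi] and
    [g0] the kernel appearing in the representation. *)
Definition generated_by_flow d (T : measurableType d) (P : probability T R)
    (X : R -> T -> K) (phi : R -> S -> S) (rho : R -> S -> R) (g0 : S -> K) :
    Prop :=
  [/\ measurable_flow phi,
      nonsingular phi,
      flow_density phi rho,
      in_Lalpha alpha mu g0
    & exists (f : R -> S -> K) (a : R -> S -> K) (J : R -> S -> K),
      [/\ spectral_representation alpha P X mu f,
          cocycle phi a,
          (forall t, is_oriented_integral alpha mu t
                       (transported phi rho a g0) (J t)),
          (forall t, {ae mu, forall s,
             f t s - f 0 s = transported phi rho a g0 t s - g0 s + J t s})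
        & full_support mu (fun t s => f t s - f 0 s)]].

(** For a flow generating a process with kernel [g0], the points at which this
    integral is finite form, mod [mu], the dissipative part of the Hopf
    decomposition; that set depends, mod [mu], neither on [g0] nor on the version
    [rho] of the density. *)
Definition dissipative (phi : R -> S -> S) (rho : R -> S -> R) (g0 : S -> K) :
    Prop :=
  {ae mu, forall s,
    (\int[@lebesgue_measure R]_t
       (modulus (g0 (phi t s)) `^ alpha * rho t s)%:E < +oo)%E}.

End flows.

(* Main.v *)
(** The orbit mass [I(s)], the integral of [|g0(phi_t s)|^alpha rho_t(s)] over [t],
    is finite almost everywhere because the flow is dissipative and positive
    because of the full support, and the measure [I mu] is invariant under the
    flow.  Almost every orbit carries the finite positive measure
    [(|g0|^alpha / I)(phi_u s) du]; minus its median is a function [tau] with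
    [tau (phi_v s) = tau s + v], so that [s |-> (phi_{-tau s} s, tau s)] conjugates
    the flow to the translation of the second coordinate of [S * R] and maps [I mu]
    to a product [Q * lambda].  The cocycle is the coboundary of [b s = a_{r - tau s} s]
    for almost every [r].  With [c = b I^(1/alpha)] and [g = g0 / c] read in the new
    coordinates, [F |-> c F] is an isometry of [L^alpha (Q * lambda)] into
    [L^alpha mu] sending the translates of [g] to the transported kernels
    [a_t rho_t^(1/alpha) g0 (phi_t)], and it preserves Riemann integrals.

    The random measure [N] is carried back through this isometry: [N A] is the
    integral of the image of [\1_A] with respect to [M].  Its independent
    scattering is read off characteristic functions, a bounded functional of
    functions on the plane being determined by its values at the functions
    [cos (p x + q y + b)]; its almost sure sigma-additivity follows from Levy's
    maximal inequality. *)

Require Import Defs.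
From HB Require Import structures.
From mathcomp Require Import all_boot all_order all_algebra.
From mathcomp Require Import complex.
From mathcomp Require Import all_classical all_reals all_analysis.
From mathcomp Require Import measurable_realfun ring lra.

Set Implicit Arguments.
Unset Strict Implicit.
Unset Printing Implicit Defensive.

Import Order.TTheory GRing.Theory Num.Theory.
Import numFieldNormedType.Exports.

Local Open Scope classical_set_scope.
Local Open Scope ring_scope.

(** * Bounded functionals and trigonometric moments *)

(** The cocycle relation, the density identities and the formula for the kernels hold up to null
    sets that depend on the time, and an uncountable union of these need not be null. An identity
    wanted along a whole orbit therefore comes either from Fubini, for almost every time, or from an
    object that is invariant everywhere. This is why [|g0|^alpha] is divided by the orbit mass
    before it is spread along an orbit: the quotient involves no density in the integral, so its
    orbit integral is exactly constant on orbits, and the median of the measure it defines moves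
    exactly with the flow.

    The space [W] can then be [S] itself, [Q] being the image of the finite measure [|g0|^alpha mu]
    under the projection to the cross-section. The random measure [N] lives on the probability space
    of [M], so that equality in law reduces to an identity between integrals.

    [L^alpha] need not be normed. A comparison of [|x|^alpha] with [|y|^alpha], with constants
    [(1 + a)^2] and [(1 + 1/a)^2] that use [alpha < 2], replaces the triangle inequality
    throughout. *)

Section bounded_functionals.
Context (R : realType) d (U : measurableType d).

Definition bounded_measurable (f : U -> R) :=
  measurable_fun [set: U] f /\ exists C : R, forall x, `|f x| <= C.

Lemma bounded_measurable_cst (a : R) : bounded_measurable (fun=> a).
Proof. by split; [exact: measurable_cst|exists `|a|]. Qed.

Lemma bounded_measurableD f g :
  bounded_measurable f -> bounded_measurable g ->
  bounded_measurable (fun x => f x + g x).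
Proof.
move=> [mf [C fC]] [mg [D gD]]; split; first exact: measurable_funD.
by exists (C + D) => x; rewrite (le_trans (ler_normD _ _))// lerD.
Qed.

Lemma bounded_measurableM f g :
  bounded_measurable f -> bounded_measurable g ->
  bounded_measurable (fun x => f x * g x).
Proof.
move=> [mf [C fC]] [mg [D gD]]; split; first exact: measurable_funM.
by exists (C * D) => x; rewrite normrM ler_pM.
Qed.

Lemma bounded_measurableZ a f :
  bounded_measurable f -> bounded_measurable (fun x => a * f x).
Proof. exact/bounded_measurableM/bounded_measurable_cst. Qed.

Lemma bounded_measurableB f g :
  bounded_measurable f -> bounded_measurable g ->
  bounded_measurable (fun x => f x - g x).
Proof.
move=> bf bg; have := bounded_measurableD bf (bounded_measurableZ (-1) bg).
by under eq_fun do rewrite mulN1r.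
Qed.

Lemma bounded_measurable_sum (I : Type) (r : seq I) (F : I -> U -> R) :
  (forall i, bounded_measurable (F i)) ->
  bounded_measurable (fun x => \sum_(i <- r) F i x).
Proof.
move=> bF; elim: r => [|i r IHr].
  by under eq_fun do rewrite big_nil; exact: bounded_measurable_cst.
by under eq_fun do rewrite big_cons; exact: bounded_measurableD.
Qed.

Lemma bounded_measurable_prod (I : Type) (r : seq I) (Q : pred I)
    (F : I -> U -> R) :
  (forall i, bounded_measurable (F i)) ->
  bounded_measurable (fun x => \prod_(i <- r | Q i) F i x).
Proof.
move=> bF; elim: r => [|i r IHr].
  by under eq_fun do rewrite big_nil; exact: bounded_measurable_cst.
under eq_fun do rewrite big_cons; case: (Q i) => //.
exact: bounded_measurableM.
Qed.

Lemma bounded_measurable_indic (B : set U) :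
  measurable B -> bounded_measurable (\1_B).
Proof.
move=> mB; split; first exact: measurable_indic.
by exists 1 => x; rewrite indicE; case: (_ \in _); rewrite ?normr1 ?normr0.
Qed.

Lemma bounded_measurable_cos (l : U -> R) :
  measurable_fun [set: U] l -> bounded_measurable (fun x => cos (l x)).
Proof.
move=> ml; split; last by exists 1 => x; exact: cos_max.
apply: measurableT_comp ml; apply: continuous_measurable_fun.
exact: continuous_cos.
Qed.

Lemma bounded_measurable_sin (l : U -> R) :
  measurable_fun [set: U] l -> bounded_measurable (fun x => sin (l x)).
Proof.
move=> ml; split; last by exists 1 => x; exact: sin_max.
apply: measurableT_comp ml; apply: continuous_measurable_fun.
exact: continuous_sin.
Qed.

(** Stands for a finite signed measure. Differences of expectations, and differences between a joint
    expectation and a product of expectations with all but one factor frozen, have both properties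
    at once. *)
Record bounded_functional (L : (U -> R) -> R) : Prop := BoundedFunctional {
  functional_linear : forall a f g, bounded_measurable f ->
    bounded_measurable g -> L (fun x => a * f x + g x) = a * L f + L g ;
  functional_cvg : forall (f_ : nat -> U -> R) f C,
    (forall n, measurable_fun [set: U] (f_ n)) ->
    (forall n x, `|f_ n x| <= C) ->
    (forall x, f_ n x @[n --> \oo] --> f x) ->
    L (f_ n) @[n --> \oo] --> L f }.

Lemma functional0 L : bounded_functional L -> L (fun=> 0) = 0.
Proof.
move=> bL; have b0 := bounded_measurable_cst 0.
have := functional_linear bL 1 b0 b0.
by rewrite mulr0 addr0 mul1r => /eqP; rewrite -subr_eq subrr => /eqP.
Qed.

Lemma functionalZ L a f : bounded_functional L -> bounded_measurable f ->
  L (fun x => a * f x) = a * L f.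
Proof.
move=> bL bf; have := functional_linear bL a bf (bounded_measurable_cst 0).
by under eq_fun do rewrite addr0; rewrite functional0// addr0.
Qed.

Lemma functionalD L f g : bounded_functional L -> bounded_measurable f ->
  bounded_measurable g -> L (fun x => f x + g x) = L f + L g.
Proof.
move=> bL bf bg; have := functional_linear bL 1 bf bg.
by under eq_fun do rewrite mul1r; rewrite mul1r.
Qed.

Lemma functional_sum L (I : Type) (r : seq I) (F : I -> U -> R) :
  bounded_functional L -> (forall i, bounded_measurable (F i)) ->
  L (fun x => \sum_(i <- r) F i x) = \sum_(i <- r) L (F i).
Proof.
move=> bL bF; elim: r => [|i r IHr].
  by under eq_fun do rewrite big_nil; rewrite functional0// big_nil.
under eq_fun do rewrite big_cons.
by rewrite functionalD// ?IHr ?big_cons//; exact: bounded_measurable_sum.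
Qed.

Lemma functional_eq0_cvg L (f_ : nat -> U -> R) f C :
  bounded_functional L ->
  (forall n, measurable_fun [set: U] (f_ n)) ->
  (forall n x, `|f_ n x| <= C) ->
  (forall x, f_ n x @[n --> \oo] --> f x) ->
  (forall n, L (f_ n) = 0) -> L f = 0.
Proof.
move=> bL mf fC ff L0; apply: (@cvg_unique _ _ (L (f_ n) @[n --> \oo])).
- exact: Rhausdorff.
- exact: (functional_cvg bL mf fC ff).
- by rewrite (_ : (fun n => L (f_ n)) = fun=> 0); [exact: cvg_cst|exact/funext].
Qed.

Lemma bounded_functional_sub L1 L2 c :
  bounded_functional L1 -> bounded_functional L2 ->
  bounded_functional (fun f => L1 f - c * L2 f).
Proof.
move=> b1 b2; split=> [a f g bf bg|f_ f C mf fC ff].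
  rewrite (functional_linear b1)// (functional_linear b2)//; ring.
apply: cvgB; first exact: (functional_cvg b1 mf fC ff).
by apply: cvgMr; exact: (functional_cvg b2 mf fC ff).
Qed.

Lemma bounded_functionalZ L c : bounded_functional L ->
  bounded_functional (fun f => c * L f).
Proof.
move=> bL; split=> [a f g bf bg|f_ f C mf fC ff].
  rewrite (functional_linear bL)//; ring.
by apply: cvgMr; exact: (functional_cvg bL mf fC ff).
Qed.

End bounded_functionals.

Lemma indic_pred (R : pzRingType) (U : Type) (p : pred U) (x : U) :
  \1_[set y | p y] x = (p x)%:R :> R.
Proof.
rewrite indicE; congr (nat_of_bool _)%:R.
by apply/idP/idP => [/set_mem//|px]; apply: mem_set.
Qed.

(** * Layer approximation of nonnegative functions *)

Section layers.
Context {R : realType}.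

(** [x] rounded down to a multiple of [1 / (n+1)] and capped at [n+1], the value that [(n+1)^2]
    levels reach (for [x >= 0]). Written with indicators of rays, it becomes a simple function on
    level sets when composed with a function. *)
Definition layer (n : nat) (x : R) : R :=
  \sum_(i < n.+1 ^ 2) n.+1%:R^-1 * \1_[set y : R | i.+1%:R / n.+1%:R <= y] x.

Lemma sum_ltn_ord N m : (\sum_(i < N) (i < m)%N = minn N m)%N.
Proof.
elim: N => [|N IHN]; first by rewrite big_ord0 min0n.
rewrite big_ord_recr/= IHN; case: ltnP => [Nm|mN].
  by rewrite addn1; apply/esym/minn_idPl.
by rewrite addn0; apply/esym/minn_idPr/leqW.
Qed.

Lemma layerE n x : 0 <= x ->
  layer n x = (minn (n.+1 ^ 2) (Num.truncn (n.+1%:R * x)))%:R / n.+1%:R.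
Proof.
move=> x0; rewrite /layer -mulr_sumr mulrC; congr (_ / _).
rewrite -sum_ltn_ord natr_sum; apply: eq_bigr => i _.
rewrite (indic_pred _ (fun y => i.+1%:R / n.+1%:R <= y)).
by rewrite truncn_gt_nat mulrC -ler_pdivrMl// mulrC.
Qed.

Lemma layer_ge0 n x : 0 <= layer n x.
Proof. by apply: sumr_ge0 => i _; rewrite mulr_ge0// indicE ler0n. Qed.

Lemma layer_le n x : 0 <= x -> layer n x <= x.
Proof.
move=> x0; rewrite layerE// ler_pdivrMr// [leRHS]mulrC.
rewrite (@le_trans _ _ (Num.truncn (n.+1%:R * x))%:R)//.
  by rewrite ler_nat geq_minr.
by rewrite truncn_le mulr_ge0.
Qed.

Lemma layer_dist n x : 0 <= x <= n.+1%:R -> x - layer n x <= n.+1%:R^-1.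
Proof.
move=> /andP[x0 xn]; have nx0 : 0 <= n.+1%:R * x by rewrite mulr_ge0.
rewrite layerE// (minn_idPr _); last first.
  rewrite -(ler_nat R) (@le_trans _ _ (n.+1%:R * x))//.
    by rewrite truncn_le.
  by rewrite natrX expr2 ler_pM2l.
have /andP[_ /ltW] := truncn_itv nx0.
rewrite -[leRHS]natr1 -lerBlDr -(@ler_pM2r _ n.+1%:R^-1) ?invr_gt0//.
have -> : (n.+1%:R * x - 1) / n.+1%:R = x - n.+1%:R^-1.
  by rewrite mulrBl mul1r mulrAC mulfV ?mul1r// pnatr_eq0.
by rewrite lerBlDr lerBlDl.
Qed.

Lemma cvg_layer x : 0 <= x -> layer n x @[n --> \oo] --> x.
Proof.
move=> x0; rewrite -[x in _ --> x]subr0.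
under eq_fun do rewrite -(subKr x (layer _ _)).
apply: cvgB; first exact: cvg_cst.
apply: (@squeeze_cvgr _ _ _ _ (fun=> 0) (fun n => n.+1%:R^-1)).
- near=> n; rewrite subr_ge0 layer_le//= layer_dist// x0/=.
  rewrite (le_trans _ (_ : n%:R <= _))//; first by near: n; exact: nbhs_infty_ger.
  by rewrite ler_nat.
- exact: cvg_cst.
- exact: cvg_harmonic.
Unshelve. all: by end_near. Qed.

End layers.

Section functional_indic.
Context (R : realType) d (U : measurableType d).

(** The bound [C] is added to make [f] nonnegative. Then [f + C] is the bounded limit of its layers,
    which are combinations of indicators, and the constant [C] is a multiple of the indicator of the
    whole space. *)
Lemma functional_eq0 (L : (U -> R) -> R) :
  bounded_functional L -> (forall B, measurable B -> L (\1_B) = 0) ->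
  forall f, bounded_measurable f -> L f = 0.
Proof.
move=> bL L0 f [mf [C fC]].
have mlev c : measurable [set x | c <= f x + C].
  rewrite [X in measurable X](_ : _ = (fun x => f x + C) @^-1` `[c, +oo[).
    by rewrite -[X in measurable X]setTI; exact: measurable_funD.
  by apply/seteqP; split => x /=; rewrite in_itv/= andbT.
have fC0 x : 0 <= f x + C by have := fC x; rewrite ler_norml; lra.
have bI n (i : 'I_(n.+1 ^ 2)) : bounded_measurable
    (fun x => n.+1%:R^-1 * \1_[set y : R | i.+1%:R / n.+1%:R <= y] (f x + C) : R).
  apply: bounded_measurableZ.
  rewrite (_ : (fun x => _) = \1_[set x | i.+1%:R / n.+1%:R <= f x + C])//.
  exact: bounded_measurable_indic.
have : L (fun x => f x + C) = 0.
  apply: (@functional_eq0_cvg _ _ _ L (fun n x => layer n (f x + C)) _ (C + C)) => //.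
  - move=> n; rewrite /layer.
    exact: (bounded_measurable_sum (index_enum _) (bI n)).1.
  - move=> n x; rewrite ger0_norm ?layer_ge0// (le_trans (layer_le _ _))//.
    by have := fC x; rewrite ler_norml; lra.
  - by move=> x; exact: cvg_layer.
  - move=> n; rewrite functional_sum// big1// => i _.
    rewrite functionalZ//.
      rewrite (_ : (fun x => _) = \1_[set x | i.+1%:R / n.+1%:R <= f x + C])//.
      by rewrite L0 ?mulr0.
    rewrite (_ : (fun x => _) = \1_[set x | i.+1%:R / n.+1%:R <= f x + C])//.
    exact: bounded_measurable_indic.
have bf : bounded_measurable f by split => //; exists C.
rewrite functionalD//; last exact: bounded_measurable_cst.
have -> : (fun=> C) = (fun x : U => C * \1_[set: U] x).
  by apply/funext => x; rewrite indicT mulr1.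
rewrite functionalZ ?L0 ?mulr0 ?addr0//.
exact: bounded_measurable_indic.
Qed.

End functional_indic.

(** * Indicators as limits of polynomials and of signs of sines *)

Section trigonometric_approximation.
Context {R : realType}.

Lemma bernoulli_inequality (x : R) n : -1 <= x -> 1 + n%:R * x <= (1 + x) ^+ n.
Proof.
move=> x1; elim: n => [|n IHn]; first by rewrite mul0r addr0.
rewrite exprSr (le_trans _ (ler_wpM2r _ IHn)) ?[0 <= _]lerBlDl//; last by lra.
rewrite -natr1; have : 0 <= n%:R * x ^+ 2 by rewrite mulr_ge0// sqr_ge0.
by rewrite expr2; lra.
Qed.

(** With [w = (1 + z) / 2] one has [w ^+ 2 - z = (1 - z)^2 / 4 >= 0], so [z ^+ n] is at most the
    product of two copies of [w ^+ n]: one absorbs the factor [n] through Bernoulli's inequality for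
    [w^-1], the other tends to 0. *)
Lemma cvg_natM_expr (z : R) : 0 <= z < 1 -> n%:R * z ^+ n @[n --> \oo] --> 0.
Proof.
move=> /andP[z0 z1]; pose w := (1 + z) / 2.
have w0 : 0 < w by rewrite /w; lra.
have w1 : w < 1 by rewrite /w; lra.
have zw : z <= w ^+ 2 by rewrite /w; have := sqr_ge0 (1 - z); nra.
pose h := w^-1 - 1.
have h0 : 0 < h by rewrite subr_gt0 invf_gt1.
apply: (@squeeze_cvgr _ _ _ _ (fun=> 0) (fun n => h^-1 * w ^+ n)).
- near=> n; rewrite mulr_ge0 ?exprn_ge0//=.
  apply: (@le_trans _ _ (n%:R * (w ^+ 2) ^+ n)).
    by rewrite ler_wpM2l// lerXn2r// ?nnegrE// exprn_ge0// ltW.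
  rewrite -exprM mulnC exprM expr2 mulrA ler_wpM2r ?exprn_ge0 ?(ltW w0)//.
  rewrite -[leRHS]mulr1 ler_pdivlMl// mulrA.
  apply: (@le_trans _ _ ((1 + n%:R * h) * w ^+ n)).
    by rewrite ler_wpM2r ?exprn_ge0 ?(ltW w0)// mulrC lerDr.
  have := @bernoulli_inequality h n; rewrite [X in X ^+ n](_ : _ = w^-1); last first.
    by rewrite /h addrC subrK.
  move=> B.
  rewrite -[leRHS](@mulVf _ (w ^+ n)) ?gt_eqF ?exprn_gt0// -exprVn.
  by rewrite ler_wpM2r ?exprn_ge0 ?(ltW w0)// B// (le_trans _ (ltW h0))// oppr_le0.
- exact: cvg_cst.
- rewrite -[x in _ --> x](mulr0 h^-1); apply: cvgMr.
  by apply: cvg_expr; rewrite ger0_norm// ltW.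
Unshelve. all: by end_near. Qed.

(* Polynomials in [y] converging on [[0, 1]] to the indicator of [[1/2, 1]]. *)
Definition step (n : nat) (y : R) : R := 1 - (1 - y ^+ n) ^+ (n * 2 ^ n).

Lemma step_itv n y : 0 <= y <= 1 -> 0 <= step n y <= 1.
Proof.
move=> /andP[y0 y1].
have yn : 0 <= 1 - y ^+ n <= 1 by rewrite subr_ge0 exprn_ile1//= gerBl exprn_ge0.
rewrite /step subr_ge0 gerBl exprn_ge0 ?exprn_ile1//; by case/andP: yn.
Qed.

(** Bernoulli's inequality on both sides of the threshold, with [N = n 2^n]. For [y >= 1/2] and
    [x = 2^-n], [(1 - y^n)^N <= (1 - x)^N <= 1 / (1 + x)^N <= 1 / (n+1)]. For [y < 1/2],
    [1 - (1 - y^n)^N <= N y^n = n (2 y)^n]. The factor [n] in the exponent is what gives the limit 1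
    at [y = 1/2] itself. *)
Lemma cvg_step y : 0 <= y <= 1 ->
  step n y @[n --> \oo] --> ((2^-1 <= y)%R%:R : R).
Proof.
move=> /andP[y0 y1].
have yn n : 0 <= y ^+ n <= 1 by rewrite exprn_ge0// exprn_ile1.
have [hy|hy] := leP 2^-1 y.
  rewrite -[x in _ --> x]subr0; apply: cvgB; first exact: cvg_cst.
  apply: (@squeeze_cvgr _ _ _ _ (fun=> 0) (fun n => n.+1%:R^-1)).
  - near=> n; have /andP[yn0 yn1] := yn n.
    rewrite exprn_ge0 ?subr_ge0//=.
    pose x := 2^-1 ^+ n : R.
    have x0 : 0 < x by rewrite exprn_gt0// invr_gt0.
    have x1 : x <= 1 by rewrite exprn_ile1// invf_le1 ?ler1n.
    rewrite -[leRHS]mul1r ler_pdivlMr//.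
    apply: (@le_trans _ _ ((1 - x) ^+ (n * 2 ^ n) * (1 + x) ^+ (n * 2 ^ n))).
      apply: ler_pM; rewrite ?exprn_ge0 ?subr_ge0//.
        by rewrite lerXn2r ?nnegrE ?subr_ge0// lerB// lerXn2r// nnegrE; lra.
      rewrite (le_trans _ (@bernoulli_inequality x _ _))//; last by lra.
      rewrite natrM natrX -mulrA /x -exprMn mulfV ?pnatr_eq0// expr1n mulr1.
      by rewrite -natr1 addrC.
    rewrite -exprMn exprn_ile1//; nra.
  - exact: cvg_cst.
  - exact: cvg_harmonic.
apply: (@squeeze_cvgr _ _ _ _ (fun=> 0) (fun n => n%:R * (2 * y) ^+ n)).
- near=> n; have /andP[-> _]/= := step_itv n (introT andP (conj y0 y1)).
  have := @bernoulli_inequality (- y ^+ n) (n * 2 ^ n).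
  rewrite lerN2 => /(_ (andP (yn n)).2) B.
  rewrite /step lerBlDl -lerBlDr (le_trans _ B)//.
  by rewrite exprMn natrM natrX mulrN mulrA.
- exact: cvg_cst.
- by apply: cvg_natM_expr; lra.
Unshelve. all: by end_near. Qed.

(** Once [|y| < (n+1) pi], the sine of [y / (n+1)] has the sign of [y]: dilating the period turns a
    periodic condition into a half-line. *)
Lemma cvg_sin_sign (y : R) :
  ((0 <= sin (n.+1%:R^-1 * y))%R%:R : R) @[n --> \oo] --> ((0 <= y)%R%:R : R).
Proof.
have small : \forall n \near \oo, `|n.+1%:R^-1 * y| < pi.
  near=> n; rewrite normrM ger0_norm ?invr_ge0// mulrC ltr_pdivrMr//.
  rewrite mulrC -ltr_pdivrMr ?pi_gt0// (@lt_trans _ _ n%:R) ?ltr_nat//.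
  by near: n; exact: nbhs_infty_gtr.
apply: cvg_near_cst; near=> n.
have np : `|n.+1%:R^-1 * y| < pi by near: n.
congr (nat_of_bool _)%:R; have [y0|y0] := leP 0 y.
  apply: sin_ge0_pi; rewrite mulr_ge0//=.
  by rewrite (le_trans (ler_norm _))// ltW.
apply/negbTE; rewrite -ltNge -oppr_gt0 -sinN -mulrN.
rewrite sin_gt0_pi// mulr_gt0 ?invr_gt0 ?oppr_gt0//=.
by rewrite (le_lt_trans (ler_norm _))// mulrN normrN.
Unshelve. all: by end_near. Qed.

End trigonometric_approximation.

(** * Functionals vanishing on the cosines of a space of forms *)

Section trigonometric_functionals.
Context (R : realType) d (U : measurableType d) (L : (U -> R) -> R).
Variable forms : set (U -> R).
Hypothesis bL : bounded_functional L.
Hypothesis forms_measurable : forall l, forms l -> measurable_fun [set: U] l.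
Hypothesis forms0 : forms (fun=> 0).
Hypothesis formsD : forall a l l', forms l -> forms l' ->
  forms (fun x => a * l x + l' x).
Hypothesis L_cos : forall l b, forms l -> L (fun x => cos (l x + b)) = 0.

(* Annihilation passes to products with cosines of forms, hence with polynomials
   in them, hence with indicators of half-spaces, which generate the events. *)
Let annihilated (g : U -> R) := bounded_measurable g /\
  forall l b, forms l -> L (fun x => g x * cos (l x + b)) = 0.

Let bcos l b : forms l -> bounded_measurable (fun x : U => cos (l x + b)).
Proof.
move=> fl; apply: bounded_measurable_cos.
by apply: measurable_funD => //; exact: forms_measurable.
Qed.

Let annihilated1 : annihilated (fun=> 1).
Proof.
split; first exact: bounded_measurable_cst.
by move=> l b fl; under eq_fun do rewrite mul1r; exact: L_cos.
Qed.

Let annihilatedD a f g : annihilated f -> annihilated g ->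
  annihilated (fun x => a * f x + g x).
Proof.
move=> [bf f0] [bg g0]; split.
  by apply: bounded_measurableD => //; exact: bounded_measurableZ.
move=> l b fl; under eq_fun do rewrite mulrDl -mulrA.
rewrite (functional_linear bL); last 2 first.
- by apply: bounded_measurableM => //; exact: bcos.
- by apply: bounded_measurableM => //; exact: bcos.
by rewrite f0// g0// mulr0 addr0.
Qed.

Let annihilatedB f g : annihilated f -> annihilated g ->
  annihilated (fun x => g x - f x).
Proof.
move=> af ag; have := annihilatedD (-1) af ag.
by under eq_fun do rewrite mulN1r addrC.
Qed.

(** A product of two cosines is half the sum of the cosines of the sum and of the difference of
    their arguments, and the forms are closed under both operations. *)
Let annihilated_cos g l b : annihilated g -> forms l ->
  annihilated (fun x => g x * cos (l x + b)).
Proof.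
move=> [bg g0] fl; split; first by apply: bounded_measurableM => //; exact: bcos.
move=> l' b' fl'.
rewrite (_ : (fun x => _) = fun x =>
    2^-1 * (g x * cos ((1 * l x + l' x) + (b + b'))) +
    2^-1 * (g x * cos ((-1 * l' x + l x) + (b - b')))); last first.
  apply/funext => x.
  have -> : 1 * l x + l' x + (b + b') = (l x + b) + (l' x + b') by ring.
  have -> : -1 * l' x + l x + (b - b') = (l x + b) - (l' x + b') by ring.
  by rewrite cosB (cosD (l x + b)); field.
rewrite (functional_linear bL); last 2 first.
- by apply: bounded_measurableM => //; apply: bcos; exact: formsD.
- by apply/bounded_measurableZ/bounded_measurableM => //; apply: bcos; exact: formsD.
rewrite functionalZ//; last first.
  by apply: bounded_measurableM => //; apply: bcos; exact: formsD.
by rewrite !g0 ?mulr0 ?addr0//; exact: formsD.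
Qed.

Let annihilated_cvg (f_ : nat -> U -> R) (f : U -> R) (C : R) :
  (forall n, annihilated (f_ n)) -> (forall n x, `|f_ n x| <= C) ->
  (forall x, f_ n x @[n --> \oo] --> f x) -> annihilated f.
Proof.
move=> af fC ff; split; last first.
  move=> l b fl.
  apply: (@functional_eq0_cvg _ _ _ _ (fun n x => f_ n x * cos (l x + b)) _ C) => //.
  - by move=> n; apply: measurable_funM; [exact: (af n).1.1|exact: (bcos b fl).1].
  - move=> n x; rewrite normrM -[C]mulr1 ler_pM//; exact: cos_max.
  - by move=> x; apply: cvgMl; exact: ff.
  - by move=> n; exact: (af n).2.
split.
  apply: (measurable_fun_cvg (h := f_)) => [n|x _]; last exact: ff.
  exact: (af n).1.1.
exists C => x; rewrite ler_norml; apply/andP; split.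
- apply: (@cvgr_to_ge _ _ _ _ _ _ _ (ff x)); apply: nearW => n.
  by have := fC n x; rewrite ler_norml => /andP[].
- apply: (@cvgr_to_le _ _ _ _ _ _ _ (ff x)); apply: nearW => n.
  by have := fC n x; rewrite ler_norml => /andP[].
Qed.

(** Events whose indicator may be inserted as a factor. Two indicators can be inserted in turn, so
    these events are stable under intersection and form a sigma-algebra; the generators do not have
    to be a pi-system. *)
Let multiplier (B : set U) := measurable B /\
  forall g, annihilated g -> annihilated (fun x => g x * \1_B x).

Let multiplier_cvg (B_ : nat -> set U) B : (forall n, multiplier (B_ n)) ->
  measurable B ->
  (forall x, (\1_(B_ n) x : R) @[n --> \oo] --> (\1_B x : R)) -> multiplier B.
Proof.
move=> mB mulB BB; split => // g ag; have [[_ [C gC]] _] := ag.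
apply: (@annihilated_cvg (fun n x => g x * \1_(B_ n) x) _ C).
- by move=> n; exact: (mB n).2.
- move=> n x; rewrite normrM -[C]mulr1 ler_pM// indicE.
  by case: (_ \in _); rewrite ?normr1 ?normr0.
- by move=> x; apply: cvgMr; exact: BB.
Qed.

(** [(1 + sin) / 2] is affine in the cosine of a form with shifted phase, and the polynomials
    [step n] in it converge boundedly to the indicator of [sin >= 0]. *)
Let multiplier_sin l b : forms l -> multiplier [set x | 0 <= sin (l x + b)].
Proof.
move=> fl.
pose y x := 2^-1 * (1 + cos (l x + (b - pi / 2))).
have yE x : y x = 2^-1 * (1 + sin (l x + b)) by rewrite /y addrA cosBpihalf.
have y01 x : 0 <= y x <= 1.
  by rewrite yE; have := sin_le1 (l x + b); have := sin_geN1 (l x + b); lra.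
split.
  have -> : [set x | 0 <= sin (l x + b)] = (fun x => sin (l x + b)) @^-1` `[0, +oo[.
    by apply/seteqP; split => x /=; rewrite in_itv/= andbT.
  rewrite -[X in measurable X]setTI; apply: (bounded_measurable_sin _).1 => //.
  by apply: measurable_funD => //; exact: forms_measurable.
have ay g : annihilated g -> annihilated (fun x => g x * y x).
  move=> ag; have a2 := annihilated_cos (b - pi / 2) ag fl.
  (* [a2] enters with the coefficients [1/2 - 1] and [1], which add up to [1/2]. *)
  have := annihilatedD 2^-1 ag (annihilatedD (2^-1 - 1) a2 a2).
  by congr annihilated; apply/funext => x; rewrite /y; field.
have ayn n g : annihilated g -> annihilated (fun x => g x * y x ^+ n).
  elim: n g => [|n IHn] g ag; first by under eq_fun do rewrite mulr1.
  by under eq_fun do rewrite exprS mulrA; apply: IHn; exact: ay.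
have aynm n m g : annihilated g -> annihilated (fun x => g x * (1 - y x ^+ n) ^+ m).
  elim: m g => [|m IHm] g ag; first by under eq_fun do rewrite mulr1.
  under eq_fun do rewrite exprS mulrA; apply: IHm.
  by under eq_fun do rewrite mulrBr mulr1; apply: annihilatedB => //; exact: ayn.
move=> g ag; have [[_ [C gC]] _] := ag.
apply: (@annihilated_cvg (fun n x => g x * step n (y x)) _ C).
- move=> n; rewrite /step; under eq_fun do rewrite mulrBr mulr1.
  by apply: annihilatedB => //; exact: aynm.
- move=> n x; have /andP[s0 s1] := step_itv n (y01 x).
  by rewrite normrM -[C]mulr1 ler_pM// ger0_norm.
- move=> x; apply: cvgMr.
  rewrite (indic_pred _ (fun x => 0 <= sin (l x + b))).
  have -> : (0 <= sin (l x + b)) = (2^-1 <= y x).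
    by rewrite yE; apply/idP/idP; lra.
  exact: cvg_step.
Qed.

Let multiplier_ray l a : forms l -> multiplier [set x | a <= l x].
Proof.
move=> fl; pose B n := [set x | 0 <= sin (n.+1%:R^-1 * (l x - a))].
apply: (@multiplier_cvg B).
- move=> n; have -> : B n = [set x | 0 <= sin ((n.+1%:R^-1 * l x + 0) + - (n.+1%:R^-1 * a))].
    by apply/seteqP; split => x; rewrite /B/= addr0 mulrBr.
  by apply: multiplier_sin; exact: formsD.
- have -> : [set x | a <= l x] = l @^-1` `[a, +oo[.
    by apply/seteqP; split => x /=; rewrite in_itv/= andbT.
  by rewrite -[X in measurable X]setTI; exact: forms_measurable.
- move=> x; rewrite (indic_pred _ (fun x => a <= l x)) -subr_ge0.
  under eq_fun do rewrite (indic_pred _ (fun x => 0 <= sin (_ * (l x - a)))).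
  exact: cvg_sin_sign.
Qed.

Let multiplier_sigma_algebra : sigma_algebra [set: U] multiplier.
Proof.
have mulC B : multiplier B -> multiplier (~` B).
  move=> [mB aB]; split; first exact: measurableC.
  move=> g ag; have := annihilatedB (aB g ag) ag; congr annihilated.
  apply/funext => x; rewrite !indicE in_setC.
  by case: (x \in B); rewrite !(mulr1, mulr0, subrr, subr0).
have mulT : multiplier setT.
  split => // g ag; congr annihilated: (ag); apply/funext => x.
  by rewrite indicT mulr1.
have mulI A B : multiplier A -> multiplier B -> multiplier (A `&` B).
  move=> [mA aA] [mB aB]; split; first exact: measurableI.
  move=> g ag; congr annihilated: (aB _ (aA _ ag)).
  by apply/funext => x; rewrite indicI /= mulrA.
split => [|A /mulC|F mF]; rewrite ?setTD//; first by rewrite -setCT; exact: mulC.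
(* The complement of the union is the pointwise limit of the finite intersections [G n], which are
   multipliers by stability under intersection. *)
pose G n := \big[setI/setT]_(i < n) ~` F i.
have mG n : multiplier (G n).
  rewrite /G; elim: n => [|n IHn]; first by rewrite big_ord0.
  by rewrite big_ord_recr/=; apply: mulI => //; exact: mulC.
rewrite -[X in multiplier X]setCK; apply: mulC.
rewrite setC_bigcup; apply: (@multiplier_cvg G) => //.
  by apply: bigcapT_measurable => n; exact: measurableC (mF n).1.
move=> x; apply: cvg_near_cst.
have GE n : G n x <-> forall i, (i < n)%N -> ~ F i x.
  rewrite /G -(bigcap_mkord n (fun i => ~` F i)); split => [h i /= ilt|h i /= ilt]; exact: h.
have [FN|/existsNP[i /contrapT Fi]] := pselect (forall i, ~ F i x).
  apply: nearW => n; rewrite !indicE !mem_set//; first by move=> i _; exact: FN.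
  by apply/GE => i _; exact: FN.
near=> n; rewrite !indicE !memNset//; first by move=> /(_ i I).
move=> /GE /(_ i); apply => //; near: n; exact: nbhs_infty_gt.
Unshelve. all: by end_near. Qed.

(** The constant 1 is annihilated, hence so is the indicator of a multiplier; the zero form with
    phase 0 tests it against [cos 0 = 1]. *)
Lemma functional_indic_eq0 (B : set U) :
  <<s [set A | exists l a, forms l /\ A = [set x | a <= l x]] >> B ->
  L (\1_B) = 0.
Proof.
move=> sB; have [mB aB] : multiplier B.
  apply: smallest_sub sB; first exact: multiplier_sigma_algebra.
  by move=> _ [l [a [fl ->]]]; exact: multiplier_ray.
have [_ /(_ _ 0 forms0)] := aB _ annihilated1; congr (L _ = 0).
by apply/funext => x; rewrite addr0 cos0 mulr1 mul1r.
Qed.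

End trigonometric_functionals.

(** * Real and complex scalars *)

Section scalar_theory.
Context {R : realType} {k : scalar_kind}.
Notation K := (scalarType R k).
Implicit Types x y z : K.

Lemma reD x y : re (x + y) = re x + re y.
Proof. by case: k x y => [//|[a b] [c e]]. Qed.

Lemma imD x y : im (x + y) = im x + im y.
Proof. by case: k x y => [x y|[a b] [c e]//]; rewrite /= addr0. Qed.

Lemma reN x : re (- x) = - re x.
Proof. by case: k x => [//|[a b]]. Qed.

Lemma imN x : im (- x) = - im x.
Proof. by case: k x => [x|[a b]//]; rewrite /= oppr0. Qed.

Lemma reM x y : re (x * y) = re x * re y - im x * im y.
Proof. by case: k x y => [x y|[a b] [c e]//]; rewrite /= mulr0 subr0. Qed.

Lemma imM x y : im (x * y) = re x * im y + im x * re y.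
Proof. by case: k x y => [x y|[a b] [c e]//]; rewrite /= mulr0 mul0r addr0. Qed.

Lemma re_ofR (a : R) : re (ofR k a) = a. Proof. by case: k. Qed.

Lemma im_ofR (a : R) : im (ofR k a) = 0. Proof. by case: k. Qed.

Lemma scalar_eqP x y : re x = re y -> im x = im y -> x = y.
Proof. by case: k x y => [//|[a b] [c e]] /= -> ->. Qed.

Lemma re0 : re (0 : K) = 0. Proof. by case: k. Qed.
Lemma im0 : im (0 : K) = 0. Proof. by case: k. Qed.
Lemma re1 : re (1 : K) = 1. Proof. by case: k. Qed.
Lemma im1 : im (1 : K) = 0. Proof. by case: k. Qed.

Lemma re_sum (I : Type) (r : seq I) (F : I -> K) :
  re (\sum_(i <- r) F i) = \sum_(i <- r) re (F i).
Proof. by apply: (big_morph _ reD re0). Qed.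

Lemma ofRD (a b : R) : ofR k (a + b) = ofR k a + ofR k b.
Proof. by apply: scalar_eqP; rewrite ?(reD, imD) !(re_ofR, im_ofR) ?addr0. Qed.

Lemma ofRM (a b : R) : ofR k (a * b) = ofR k a * ofR k b.
Proof.
by apply: scalar_eqP; rewrite ?(reM, imM) !(re_ofR, im_ofR) ?(mulr0, mul0r, subr0, addr0).
Qed.

Lemma ofR0 : ofR k (0 : R) = 0.
Proof. by apply: scalar_eqP; rewrite ?(re_ofR, im_ofR, re0, im0). Qed.

Lemma ofR1 : ofR k (1 : R) = 1.
Proof. by apply: scalar_eqP; rewrite ?(re_ofR, im_ofR, re1, im1). Qed.

Lemma modulusE x : `|x| = ofR k (modulus x).
Proof.
rewrite /modulus; case: k x => [x|[a b]] /=; last by [].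
by rewrite expr0n addr0 sqrtr_sqr.
Qed.

Lemma ler_ofR (a b : R) : (ofR k a <= ofR k b) = (a <= b).
Proof. by case: k => //=; rewrite lecR. Qed.

Lemma modulus_ge0 x : 0 <= modulus x. Proof. exact: sqrtr_ge0. Qed.

Lemma ofR_inj : injective (ofR k : R -> K).
Proof. by move=> a b /(congr1 (@re R k)); rewrite !re_ofR. Qed.

Lemma modulusM x y : modulus (x * y) = modulus x * modulus y.
Proof. by apply: ofR_inj; rewrite ofRM -!modulusE normrM. Qed.

Lemma modulusD x y : modulus (x + y) <= modulus x + modulus y.
Proof. by rewrite -ler_ofR ofRD -!modulusE ler_normD. Qed.

Lemma modulusN x : modulus (- x) = modulus x.
Proof. by apply: ofR_inj; rewrite -!modulusE normrN. Qed.

Lemma modulusB x y : modulus (x - y) = modulus (y - x).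
Proof. by rewrite -modulusN opprB. Qed.

Lemma modulus_ofR (a : R) : modulus (ofR k a) = `|a|.
Proof. by rewrite /modulus re_ofR im_ofR expr0n addr0 sqrtr_sqr. Qed.

Lemma modulus0 : modulus (0 : K) = 0.
Proof. by rewrite -ofR0 modulus_ofR normr0. Qed.

Lemma modulus1 : modulus (1 : K) = 1.
Proof. by rewrite -ofR1 modulus_ofR normr1. Qed.

Lemma modulus_eq0 x : (modulus x == 0) = (x == 0).
Proof.
apply/eqP/eqP => [mx|->]; last exact: modulus0.
by apply/normr0_eq0; rewrite modulusE mx ofR0.
Qed.

Lemma re_le_modulus x : `|re x| <= modulus x.
Proof.
by rewrite /modulus -sqrtr_sqr ler_wsqrtr// lerDl sqr_ge0.
Qed.

Lemma im_le_modulus x : `|im x| <= modulus x.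
Proof.
by rewrite /modulus -sqrtr_sqr ler_wsqrtr// lerDr sqr_ge0.
Qed.

(* In the real case every second coordinate vanishes, so that every linear form
   in the coordinates of [z] is still of the form [re (theta * z)]. *)
Definition dual (p q : R) : K :=
  match k return scalarType R k with
  | RealScalar => p
  | ComplexScalar => Complex p (- q)
  end.

Lemma re_dual p q z : re (dual p q * z) = p * re z + q * im z.
Proof.
by rewrite reM /dual; case: k z => [z|[a b]] /=; ring.
Qed.

Definition form (theta : K) (z : plane R) : R := re theta * z.1 - im theta * z.2.

Lemma modulus_coords z :
  modulus z = Num.sqrt ((coords z).1 ^+ 2 + (coords z).2 ^+ 2).
Proof. by []. Qed.

Lemma modulus_double z : modulus (z + z) = 2 * modulus z.
Proof.
have -> : z + z = ofR k 2 * z by rewrite -[2]/(1 + 1) ofRD ofR1 mulrDl !mul1r.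
by rewrite modulusM modulus_ofR ger0_norm.
Qed.

Lemma form_coords theta z : form theta (coords z) = re (theta * z).
Proof. by rewrite reM. Qed.

Lemma form_measurable theta : measurable_fun [set: plane R] (form theta).
Proof.
apply: measurable_funB.
- by apply: measurable_funM; [exact: measurable_cst|exact: measurable_fst].
- by apply: measurable_funM; [exact: measurable_cst|exact: measurable_snd].
Qed.

Lemma measurable_large (e : R) :
  measurable [set z : plane R | e <= Num.sqrt (z.1 ^+ 2 + z.2 ^+ 2)].
Proof.
have ms : measurable_fun [set: R] (@Num.sqrt R).
  by apply: continuous_measurable_fun; exact: sqrt_continuous.
have m : measurable_fun [set: plane R]
    (fun z : plane R => Num.sqrt (z.1 ^+ 2 + z.2 ^+ 2)).
  apply: (measurableT_comp ms); apply: measurable_funD; apply: measurable_funX.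
  - exact: measurable_fst.
  - exact: measurable_snd.
have := m measurableT `[e, +oo[%classic (measurable_itv _); rewrite setTI.
by congr measurable; apply/seteqP; split => z /=; rewrite in_itv/= andbT.
Qed.

End scalar_theory.

Section scalar_measurability.
Context {R : realType} {k : scalar_kind} d (T : measurableType d).
Notation K := (scalarType R k).
Implicit Types f g : T -> K.

Lemma scalar_measurableP f : scalar_measurable f <->
  measurable_fun [set: T] (fun x => re (f x)) /\
  measurable_fun [set: T] (fun x => im (f x)).
Proof. exact: measurable_fun_pairP. Qed.

Lemma scalar_measurable_cst (c : K) : scalar_measurable (fun _ : T => c).
Proof. exact: measurable_cst. Qed.

Lemma scalar_measurableD f g : scalar_measurable f -> scalar_measurable g ->
  scalar_measurable (fun x => f x + g x).
Proof.
move=> /scalar_measurableP[rf jf] /scalar_measurableP[rg jg].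
apply/scalar_measurableP; split.
- by under eq_fun do rewrite reD; exact: measurable_funD.
- by under eq_fun do rewrite imD; exact: measurable_funD.
Qed.

Lemma scalar_measurableM f g : scalar_measurable f -> scalar_measurable g ->
  scalar_measurable (fun x => f x * g x).
Proof.
move=> /scalar_measurableP[rf jf] /scalar_measurableP[rg jg].
apply/scalar_measurableP; split.
- by under eq_fun do rewrite reM; apply: measurable_funB; exact: measurable_funM.
- by under eq_fun do rewrite imM; apply: measurable_funD; exact: measurable_funM.
Qed.

Lemma scalar_measurableZ (c : K) f : scalar_measurable f ->
  scalar_measurable (fun x => c * f x).
Proof. by apply: scalar_measurableM; exact: scalar_measurable_cst. Qed.

Lemma scalar_measurableN f : scalar_measurable f ->
  scalar_measurable (fun x => - f x).
Proof.
by move=> mf; under eq_fun do rewrite -mulN1r; exact: scalar_measurableZ.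
Qed.

Lemma scalar_measurableB f g : scalar_measurable f -> scalar_measurable g ->
  scalar_measurable (fun x => f x - g x).
Proof.
by move=> mf mg; apply: scalar_measurableD => //; exact: scalar_measurableN.
Qed.

Lemma scalar_measurable_sum (I : Type) (r : seq I) (F : I -> T -> K) :
  (forall i, scalar_measurable (F i)) ->
  scalar_measurable (fun x => \sum_(i <- r) F i x).
Proof.
move=> mF; elim: r => [|i r IHr].
  by under eq_fun do rewrite big_nil; exact: scalar_measurable_cst.
by under eq_fun do rewrite big_cons; exact: scalar_measurableD.
Qed.

Lemma scalar_measurable_ofR (h : T -> R) : measurable_fun [set: T] h ->
  scalar_measurable (fun x => ofR k (h x)).
Proof.
move=> mh; apply/scalar_measurableP; split.
- by under eq_fun do rewrite re_ofR.
- by under eq_fun do rewrite im_ofR; exact: measurable_cst.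
Qed.

Lemma scalar_measurable_indic (A : set T) : measurable A ->
  scalar_measurable (fun x => \1_A x : K).
Proof.
move=> mA; rewrite (_ : (fun x => _) = fun x => ofR k (\1_A x)).
  by apply: scalar_measurable_ofR; exact: measurable_indic.
by apply/funext => x; rewrite !indicE; case: (x \in A); rewrite ?ofR0 ?ofR1.
Qed.

Lemma modulus_measurable f : scalar_measurable f ->
  measurable_fun [set: T] (fun x => modulus (f x)).
Proof.
move=> /scalar_measurableP[rf jf].
have ms : measurable_fun [set: R] (@Num.sqrt R).
  by apply: continuous_measurable_fun; exact: sqrt_continuous.
by apply: (measurableT_comp ms); apply: measurable_funD; exact: measurable_funX.
Qed.

Lemma measurable_modulus_ge f (e : R) : scalar_measurable f ->
  measurable [set x | e <= modulus (f x)].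
Proof. by move=> mf; have := mf measurableT _ (measurable_large e); rewrite setTI. Qed.

Lemma scalar_measurable_re (theta : K) f : scalar_measurable f ->
  measurable_fun [set: T] (fun x => re (theta * f x)).
Proof.
by move=> mf; have /scalar_measurableP[] := scalar_measurableZ theta mf.
Qed.

(** The inverse is [modulus^-2] times the conjugate, and the conjugate is written [2 re z - z], a
    formula that serves both kinds of scalars. *)
Lemma scalar_measurableV f : scalar_measurable f -> (forall x, f x != 0) ->
  scalar_measurable (fun x => (f x)^-1).
Proof.
move=> mf f0; have mm := modulus_measurable mf.
have mi : measurable_fun [set: T] (fun x => (modulus (f x)) `^ (-2)).
  exact: (measurableT_comp (measurable_powR (-2)) mm).
have E x : (f x)^-1 = ofR k (modulus (f x) `^ (-2)) *
     (ofR k (re (f x)) * ofR k 2 - f x).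
  apply: (mulfI (f0 x)); rewrite mulfV//.
  rewrite powRN powR_mulrn ?modulus_ge0//.
  have m0 : modulus (f x) ^+ 2 != 0 by rewrite expf_neq0// modulus_eq0.
  apply: (mulfI (x := ofR k (modulus (f x) ^+ 2))).
    by rewrite -ofR0 (inj_eq ofR_inj).
  rewrite mulr1 mulrCA (mulrA (ofR k _) (ofR k _)) -ofRM mulfV// ofR1 mul1r.
  rewrite /modulus sqr_sqrtr ?addr_ge0 ?sqr_ge0//.
  by apply: scalar_eqP; rewrite !(reM, imM, reD, imD, reN, imN, re_ofR, im_ofR); ring.
under eq_fun do rewrite E.
have /scalar_measurableP[rf _] := mf.
apply: scalar_measurableM; first exact: scalar_measurable_ofR.
apply: scalar_measurableB => //.
by apply: scalar_measurableM; [exact: scalar_measurable_ofR|exact: scalar_measurable_cst].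
Qed.

End scalar_measurability.

Lemma scalar_measurable_comp (R : realType) (k : scalar_kind) d d'
    (T : measurableType d) (U : measurableType d') (f : U -> scalarType R k)
    (h : T -> U) :
  scalar_measurable f -> measurable_fun [set: T] h ->
  scalar_measurable (fun x => f (h x)).
Proof. by move=> mf mh; exact: (measurableT_comp mf mh). Qed.

(** * Joint laws, independence and stable variables *)

Section expectations.
Context {R : realType} d (T : measurableType d) (P : probability T R).

Lemma bounded_measurable_integrable f : bounded_measurable f ->
  P.-integrable [set: T] (EFin \o f).
Proof.
move=> [mf [C fC]]; apply: measurable_bounded_integrable => //.
  by rewrite fin_num_fun_lty.
exists C; split; first exact: num_real.
by move=> x Cx y _ /=; rewrite (le_trans (fC y))// ltW.
Qed.

Lemma charfunE k (Y : T -> scalarType R k) theta :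
  charfun P Y theta = Complex (\int[P]_w cos (re (theta * Y w)))
                              (\int[P]_w sin (re (theta * Y w))).
Proof. by rewrite /charfun unlock. Qed.

Lemma Rintegral_cvg (f_ : nat -> T -> R) f C :
  (forall n, measurable_fun [set: T] (f_ n)) ->
  (forall n x, `|f_ n x| <= C) ->
  (forall x, f_ n x @[n --> \oo] --> f x) ->
  \int[P]_w f_ n w @[n --> \oo] --> \int[P]_w f w.
Proof.
move=> mf fC ff.
have mlim : measurable_fun [set: T] f.
  by apply: (measurable_fun_cvg (h := f_)) => // x _; exact: ff.
have bf : bounded_measurable f.
  split=> //; exists C => x; rewrite ler_norml; apply/andP; split.
  - apply: (@cvgr_to_ge _ _ _ _ _ _ _ (ff x)); apply: nearW => n.
    by have := fC n x; rewrite ler_norml => /andP[].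
  - apply: (@cvgr_to_le _ _ _ _ _ _ _ (ff x)); apply: nearW => n.
    by have := fC n x; rewrite ler_norml => /andP[].
rewrite /Rintegral; apply: fine_cvg; rewrite fineK; last first.
  by apply: integrable_fin_num => //; exact: bounded_measurable_integrable.
apply: (@dominated_cvg _ _ _ _ _ _ _ _ (cst C%:E)) => //.
- by move=> n; apply/measurable_EFinP.
- by move=> x _; apply: cvg_EFin; [exact: nearW|exact: ff].
- exact: (bounded_measurable_integrable (bounded_measurable_cst _ _)).
- by move=> n x _; rewrite /= lee_fin.
Qed.

Lemma RintegralD_bounded f g : bounded_measurable f -> bounded_measurable g ->
  \int[P]_w (f w + g w) = \int[P]_w f w + \int[P]_w g w.
Proof. by move=> bf bg; rewrite RintegralD//; exact: bounded_measurable_integrable. Qed.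

Lemma RintegralZ_bounded a f : bounded_measurable f ->
  \int[P]_w (a * f w) = a * \int[P]_w f w.
Proof. by move=> bf; rewrite RintegralZl//; exact: bounded_measurable_integrable. Qed.

Lemma Rintegral_sum_bounded (I : Type) (r : seq I) (F : I -> T -> R) :
  (forall i, bounded_measurable (F i)) ->
  \int[P]_w \sum_(i <- r) F i w = \sum_(i <- r) \int[P]_w F i w.
Proof.
move=> bF; elim: r => [|i r IHr].
  under eq_Rintegral do rewrite big_nil.
  by rewrite big_nil /Rintegral integral0.
under eq_Rintegral do rewrite big_cons.
by rewrite RintegralD_bounded ?big_cons ?IHr//; exact: bounded_measurable_sum.
Qed.

Lemma Rintegral_indic (A : set T) : measurable A ->
  \int[P]_w \1_A w = fine (P A).
Proof. by move=> mA; rewrite /Rintegral integral_indic// setIT. Qed.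

Lemma bounded_functional_Rintegral d' (U : measurableType d') (Z : T -> R)
    (Y : T -> U) :
  bounded_measurable Z -> measurable_fun [set: T] Y ->
  bounded_functional (fun h : U -> R => \int[P]_w (Z w * h (Y w))).
Proof.
move=> bZ mY.
have bc h : bounded_measurable h -> bounded_measurable (fun w => h (Y w)).
  move=> [mh [C hC]]; split; first exact: (measurableT_comp mh mY).
  by exists C.
split=> [a f g bf bg|f_ f C mf fC ff].
  rewrite -RintegralZ_bounded -?RintegralD_bounded.
  - by apply: eq_Rintegral => w _; ring.
  - exact/bounded_measurableZ/bounded_measurableM/bc.
  - exact/bounded_measurableM/bc.
  - exact/bounded_measurableM/bc.
have [mZ [D ZD]] := bZ.
apply: (@Rintegral_cvg (fun n w => Z w * f_ n (Y w)) _ (D * C)).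
- by move=> n; apply: measurable_funM => //; exact: (measurableT_comp (mf n) mY).
- by move=> n w; rewrite normrM ler_pM.
- by move=> w; apply: cvgMr; exact: ff.
Qed.

End expectations.

(** Uniqueness of characteristic functions in the plane, for functionals. Half-spaces in a single
    coordinate are among those of the forms and already generate the product sigma-algebra. *)
Lemma functional_plane_eq0 (R : realType) (L : (plane R -> R) -> R) :
  bounded_functional L ->
  (forall p q b, L (fun z => cos (p * z.1 + q * z.2 + b)) = 0) ->
  forall f, bounded_measurable f -> L f = 0.
Proof.
move=> bL L0; apply: functional_eq0 => // B mB.
pose forms := [set l : plane R -> R | exists p q, l = fun z => p * z.1 + q * z.2].
apply: (@functional_indic_eq0 _ _ _ L forms) => //.
- move=> _ [p [q ->]]; apply: measurable_funD.
  + by apply: measurable_funM; [exact: measurable_cst|exact: measurable_fst].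
  + by apply: measurable_funM; [exact: measurable_cst|exact: measurable_snd].
- by exists 0, 0; apply/funext => z; rewrite !mul0r addr0.
- move=> a _ _ [p [q ->]] [p' [q' ->]]; exists (a * p + p'), (a * q + q').
  by apply/funext => z; ring.
- by move=> _ b [p [q ->]]; exact: L0.
pose G := [set A : set (plane R) | exists l a, forms l /\ A = [set x | a <= l x]].
have sub (l : plane R -> R) : forms l ->
    forall A : set R, measurable A -> <<s G >> (l @^-1` A).
  move=> fl A mA.
  suff: preimage_set_system setT l measurable `<=` <<s G >>.
    by apply; exists A => //; rewrite setTI.
  have -> : @measurable _ R = <<s @RGenCInfty.G R >> by exact: RGenCInfty.measurableE.
  rewrite -g_sigma_preimageE; apply: smallest_sub.
    exact: smallest_sigma_algebra.
  move=> _ [_ [a ->] <-]; apply: sub_sigma_algebra.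
  exists l, a; split => //.
  by rewrite setTI; apply/seteqP; split => x /=; rewrite in_itv/= andbT.
apply: smallest_sub mB; first exact: smallest_sigma_algebra.
move=> _ [[A mA <-]|[A mA <-]]; rewrite setTI; apply: sub => //.
- by exists 1, 0; apply/funext => z; rewrite mul1r mul0r addr0.
- by exists 0, 1; apply/funext => z; rewrite mul1r mul0r add0r.
Qed.

(** * Functionals of several test functions *)

Section multilinear_functionals.
Context {R : realType} d (U : measurableType d) (seed : set (U -> R)).
Hypothesis seed_bounded : forall f, seed f -> bounded_measurable f.
Hypothesis seed_total : forall L : (U -> R) -> R, bounded_functional L ->
  (forall f, seed f -> L f = 0) -> forall f, bounded_measurable f -> L f = 0.

Definition with_coord n (h : 'I_n -> U -> R) (i0 : 'I_n) (f : U -> R) :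
  'I_n -> U -> R := fun i => if i == i0 then f else h i.

(** The coordinates are released one at a time: with the others frozen, the functional of the
    released coordinate is bounded and vanishes on the seeds, hence everywhere. Questions about
    joint laws are thus reduced to one variable. *)
Lemma multilinear_eq0 n (G : ('I_n -> U -> R) -> R) :
  (forall h i0, (forall i, bounded_measurable (h i)) ->
     bounded_functional (fun f => G (with_coord h i0 f))) ->
  (forall h, (forall i, seed (h i)) -> G h = 0) ->
  forall h, (forall i, bounded_measurable (h i)) -> G h = 0.
Proof.
move=> bG G0.
(* Induction on [m]: the first [m] coordinates are arbitrary, the others are seeds. *)
suff H m h : (forall i, bounded_measurable (h i)) ->
    (forall i : 'I_n, (m <= i)%N -> seed (h i)) -> G h = 0.
  by move=> h bh; apply: (H n) => // i; rewrite leqNgt ltn_ord.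
elim: m h => [|m IHm] h bh sh; first by apply: G0 => i; exact: sh.
have [nm|mn] := leqP n m.
  by apply: IHm => // i mi; have := ltn_ord i; rewrite ltnNge (leq_trans nm mi).
pose i0 := Ordinal mn.
have -> : h = with_coord h i0 (h i0).
  by apply/funext => i; rewrite /with_coord; case: eqP => [->|].
apply: (seed_total (bG h i0 bh)) => // f sf; apply: IHm => i.
  by rewrite /with_coord; case: eqP => // _; exact: seed_bounded.
rewrite /with_coord; case: eqP => // ne; rewrite leq_eqVlt => /orP[/eqP mi|]; last exact: sh.
by case: ne; exact/val_inj.
Qed.

Context d' (T : measurableType d') (P : probability T R).

Lemma bounded_functional_Rintegral_prod n (Y : 'I_n -> T -> U) h i0 :
  (forall i, measurable_fun [set: T] (Y i)) ->
  (forall i, bounded_measurable (h i)) ->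
  bounded_functional (fun f => \int[P]_w \prod_i with_coord h i0 f i (Y i w)).
Proof.
move=> mY bh.
have bZ : bounded_measurable (fun w => \prod_(i | i != i0) h i (Y i w)).
  apply: bounded_measurable_prod => i; have [mh [C hC]] := bh i.
  by split; [exact: (measurableT_comp mh (mY i))|exists C].
have := bounded_functional_Rintegral P bZ (mY i0).
congr bounded_functional; apply/funext => f; apply: eq_Rintegral => w _.
rewrite [RHS](bigD1 i0)//= /with_coord eqxx mulrC; congr (_ * _).
by apply: eq_bigr => i /negbTE ->.
Qed.

Lemma bounded_functional_prod_Rintegral n (Y : 'I_n -> T -> U) h i0 :
  (forall i, measurable_fun [set: T] (Y i)) ->
  (forall i, bounded_measurable (h i)) ->
  bounded_functional (fun f => \prod_i \int[P]_w with_coord h i0 f i (Y i w)).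
Proof.
move=> mY bh.
have := bounded_functionalZ (\prod_(i | i != i0) \int[P]_w h i (Y i w))
  (bounded_functional_Rintegral P (bounded_measurable_cst _ 1) (mY i0)).
congr bounded_functional; apply/funext => f.
rewrite [RHS](bigD1 i0)//= /with_coord eqxx mulrC; congr (_ * _).
  by apply: eq_Rintegral => w _; rewrite mul1r.
by apply: eq_bigr => i /negbTE ->.
Qed.

End multilinear_functionals.

(** * Expansions of products of cosines *)

Section trigonometric_products.
Context {R : realType}.

Definition expi (x : R) : R[i] := Complex (cos x) (sin x).

Lemma expiD x y : expi (x + y) = expi x * expi y.
Proof. by apply/eqP; rewrite eq_complex /= cosD sinD addrC eqxx/= addrC. Qed.

Lemma expi0 : expi 0 = 1.
Proof. by rewrite /expi cos0 sin0. Qed.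

Lemma expi_sum (I : Type) (r : seq I) (F : I -> R) :
  expi (\sum_(i <- r) F i) = \prod_(i <- r) expi (F i).
Proof. by apply: (big_morph _ expiD expi0). Qed.

Lemma real_complex_prod (I : Type) (r : seq I) (F : I -> R) :
  (\prod_(i <- r) F i)%:C%C = \prod_(i <- r) (F i)%:C%C.
Proof. exact: rmorph_prod. Qed.

Lemma Re_sum (I : Type) (r : seq I) (F : I -> R[i]) :
  complex.Re (\sum_(i <- r) F i) = \sum_(i <- r) complex.Re (F i).
Proof. by apply: (big_morph (@complex.Re R)) => // -[a b] [c e]. Qed.

Lemma Re_scale (a : R) (z : R[i]) : complex.Re (a%:C%C * z) = a * complex.Re z.
Proof. by case: z => x y /=; rewrite mul0r subr0. Qed.

(** Each cosine is the mean of two conjugate exponentials; the product is distributed over all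
    choices of signs and the real part is taken. *)
Lemma prod_cos n (x : 'I_n -> R) :
  \prod_i cos (x i) =
  \sum_(e : {ffun 'I_n -> bool}) 2^-1 ^+ n * cos (\sum_i (-1) ^+ e i * x i).
Proof.
transitivity (complex.Re (\prod_i \sum_(b : bool) (2^-1 : R)%:C%C *
    expi ((-1) ^+ b * x i))).
  rewrite (eq_bigr (fun i => (cos (x i))%:C%C)) -?real_complex_prod// => i _.
  rewrite big_bool/= expr1 expr0 mulN1r mul1r; apply/eqP; rewrite eq_complex/=.
  by rewrite cosN sinN; apply/andP; split; apply/eqP; field.
rewrite bigA_distr_bigA/= Re_sum; apply: eq_bigr => e _.
rewrite big_split/= -expi_sum -real_complex_prod Re_scale.
by rewrite prodr_const card_ord.
Qed.

Definition imag_power (b : bool) : R[i] := if b then 'i%C else 1.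

(** Distributing the factors into real and imaginary parts writes the cosine of a sum, its phase
    being carried by [u], as a combination of products of functions of one variable each: the form
    to which independence applies. *)
Lemma Re_prod n (u : R[i]) (c s : 'I_n -> R) :
  complex.Re (u * \prod_i Complex (c i) (s i)) =
  \sum_(e : {ffun 'I_n -> bool}) complex.Re (u * \prod_i imag_power (e i)) *
    \prod_i (if e i then s i else c i).
Proof.
rewrite (eq_bigr (fun i => \sum_(b : bool) (if b then s i else c i)%:C%C * imag_power b)).
  rewrite bigA_distr_bigA/= mulr_sumr Re_sum; apply: eq_bigr => e _.
  by rewrite big_split/= -real_complex_prod mulrCA Re_scale mulrC.
move=> i _; rewrite big_bool/=; apply/eqP; rewrite eq_complex/=.
by apply/andP; split; apply/eqP; ring.
Qed.

End trigonometric_products.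

Section joint_laws.
Context {R : realType} {k : scalar_kind} d (T : measurableType d)
  (P : probability T R).
Notation K := (scalarType R k).

Definition wave (f : plane R -> R) := exists p q b,
  f = fun z => cos (p * z.1 + q * z.2 + b).

Lemma wave_bounded f : wave f -> bounded_measurable f.
Proof.
move=> [p [q [b ->]]]; apply: bounded_measurable_cos.
apply: measurable_funD; last exact: measurable_cst.
apply: measurable_funD.
- by apply: measurable_funM; [exact: measurable_cst|exact: measurable_fst].
- by apply: measurable_funM; [exact: measurable_cst|exact: measurable_snd].
Qed.

Lemma wave_total (L : (plane R -> R) -> R) : bounded_functional L ->
  (forall f, wave f -> L f = 0) -> forall f, bounded_measurable f -> L f = 0.
Proof.
move=> bL L0; apply: functional_plane_eq0 => // p q b.
by apply: L0; exists p, q, b.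
Qed.

Lemma wave_coordsP f : wave f -> exists (theta : K) b,
  forall z : K, f (coords z) = cos (re (theta * z) + b).
Proof.
by move=> [p [q [b ->]]]; exists (dual p q), b => z; rewrite re_dual.
Qed.

Lemma bounded_cos (Y : T -> K) theta b : scalar_measurable Y ->
  bounded_measurable (fun w => cos (re (theta * Y w) + b)).
Proof.
move=> mY; apply: bounded_measurable_cos; apply: measurable_funD => //.
exact: scalar_measurable_re.
Qed.

Lemma wave_family n (h : 'I_n -> plane R -> R) : (forall i, wave (h i)) ->
  exists (theta : 'I_n -> K) (b : 'I_n -> R),
    forall i (z : K), h i (coords z) = cos (re (theta i * z) + b i).
Proof.
move=> wh.
have /choice[tb H] : forall i, exists tb : K * R,
    forall z : K, h i (coords z) = cos (re (tb.1 * z) + tb.2).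
  by move=> i; have [t [b H]] := wave_coordsP (wh i); exists (t, b).
by exists (fun i => (tb i).1), (fun i => (tb i).2).
Qed.

Lemma prod_wave n (Y : 'I_n -> K) (theta : 'I_n -> K) (b : 'I_n -> R) :
  \prod_i cos (re (theta i * Y i) + b i) =
  \sum_(e : {ffun 'I_n -> bool}) 2^-1 ^+ n *
    cos (re (\sum_i (-1) ^+ e i * theta i * Y i) + \sum_i (-1) ^+ e i * b i).
Proof.
rewrite prod_cos; apply: eq_bigr => e _; congr (_ * cos _).
rewrite re_sum -big_split; apply: eq_bigr => i _ /=; rewrite mulrDr; congr (_ + _).
by case: (e i); rewrite ?expr1 ?expr0 ?mulN1r ?mul1r// mulNr reN.
Qed.

(** Cramer-Wold: a product of waves is a combination of cosines of linear combinations of the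
    variables, where the two families agree; multilinearity extends the agreement to all bounded
    test functions. *)
Lemma joint_law_eq n (Y Y' : 'I_n -> T -> K) :
  (forall i, scalar_measurable (Y i)) -> (forall i, scalar_measurable (Y' i)) ->
  (forall theta b, \int[P]_w cos (re (\sum_i theta i * Y i w) + b) =
                   \int[P]_w cos (re (\sum_i theta i * Y' i w) + b)) ->
  forall h, (forall i, bounded_measurable (h i)) ->
    \int[P]_w (\prod_i h i (coords (Y i w))) =
    \int[P]_w (\prod_i h i (coords (Y' i w))).
Proof.
move=> mY mY' EY h bh; apply/eqP; rewrite -subr_eq0; apply/eqP.
(* The coefficient 1 gives the difference the shape [L1 - c * L2] of [bounded_functional_sub]. *)
rewrite -[X in _ - X]mul1r; move: h bh.
apply: (multilinear_eq0 wave_bounded wave_total) => [h i0 bh|h wh].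
  by apply: bounded_functional_sub; exact: bounded_functional_Rintegral_prod.
have [theta [b H]] := wave_family wh.
rewrite mul1r; apply/eqP; rewrite subr_eq0; apply/eqP.
have E (Z : 'I_n -> T -> K) : (forall i, scalar_measurable (Z i)) ->
    \int[P]_w (\prod_i h i (coords (Z i w))) =
    \sum_(e : {ffun 'I_n -> bool}) 2^-1 ^+ n * \int[P]_w
      cos (re (\sum_i (-1) ^+ e i * theta i * Z i w) + \sum_i (-1) ^+ e i * b i).
  move=> mZ.
  under eq_Rintegral do [under eq_bigr do rewrite H; rewrite prod_wave].
  have bc (e : {ffun 'I_n -> bool}) : bounded_measurable (fun w =>
      cos (re (\sum_i (-1) ^+ e i * theta i * Z i w) + \sum_i (-1) ^+ e i * b i)).
    apply: bounded_measurable_cos; apply: measurable_funD => //.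
    have /scalar_measurableP[] // := scalar_measurable_sum (index_enum _)
       (fun i => scalar_measurableZ ((-1) ^+ e i * theta i) (mZ i)).
  rewrite Rintegral_sum_bounded; last by move=> e; exact: bounded_measurableZ.
  by apply: eq_bigr => e _; rewrite RintegralZ_bounded.
by rewrite !E//; apply: eq_bigr => e _; rewrite EY.
Qed.

End joint_laws.

Section independence.
Context {R : realType} {k : scalar_kind} d (T : measurableType d)
  (P : probability T R).
Notation K := (scalarType R k).

Lemma bounded_measurable_coords (Y : T -> K) (h : plane R -> R) :
  scalar_measurable Y -> bounded_measurable h ->
  bounded_measurable (fun w => h (coords (Y w))).
Proof.
move=> mY [mh [C hC]]; split; first exact: (measurableT_comp mh mY).
by exists C.
Qed.

Lemma measurable_coords (Y : T -> K) (B : set (plane R)) :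
  scalar_measurable Y -> measurable B -> measurable [set w | B (coords (Y w))].
Proof.
by move=> mY mB; have := mY measurableT _ mB; rewrite setTI.
Qed.

Lemma prod_indic n (B : 'I_n -> set T) w :
  \prod_i (\1_(B i) w : R) = \1_(\big[setI/setT]_i B i) w.
Proof.
apply: (big_ind2 (fun (x : R) A => x = \1_A w)) => // [|x A y A' -> ->].
- by rewrite indicT.
- by rewrite indicI.
Qed.

Lemma prod_fine_probability n (B : 'I_n -> set T) :
  (forall i, measurable (B i)) ->
  (\prod_i P (B i))%E = (\prod_i fine (P (B i)))%:E.
Proof.
move=> mB; elim/big_ind2 : _ => // [x y a b -> ->//|i _].
by rewrite fineK// fin_num_measure.
Qed.

(** Independence with bounded test functions in place of events: both sides are then bounded
    functionals of each test function separately. *)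
Definition product_law n (Y : 'I_n -> T -> K) :=
  forall h, (forall i, bounded_measurable (h i)) ->
    \int[P]_w (\prod_i h i (coords (Y i w))) =
    \prod_i \int[P]_w h i (coords (Y i w)).

Let bounded_functional_product_law n (Y : 'I_n -> T -> K) h i0 :
  (forall i, scalar_measurable (Y i)) -> (forall i, bounded_measurable (h i)) ->
  bounded_functional (fun f =>
    \int[P]_w (\prod_i with_coord h i0 f i (coords (Y i w))) -
    1 * \prod_i \int[P]_w with_coord h i0 f i (coords (Y i w))).
Proof.
move=> mY bh; apply: bounded_functional_sub.
- exact: bounded_functional_Rintegral_prod.
- exact: bounded_functional_prod_Rintegral.
Qed.

(** Indicators serve as seeds; for them the identity is the independence of the corresponding
    events, taken over the full index set. *)
Lemma independent_product_law n (Y : 'I_n -> T -> K) :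
  (forall i, scalar_measurable (Y i)) -> mutually_independent P Y ->
  product_law Y.
Proof.
move=> mY iY h bh; apply/eqP; rewrite -subr_eq0; apply/eqP.
rewrite -[X in _ - X]mul1r; move: h bh.
apply: (@multilinear_eq0 _ _ _ [set f | exists2 B, measurable B & f = \1_B]).
- by move=> _ [B mB ->]; exact: bounded_measurable_indic.
- move=> L bL L0; apply: functional_eq0 => // B mB.
  by apply: L0; exists B.
- by move=> h i0 bh; exact: bounded_functional_product_law.
move=> h sh.
have /choice[B HB] : forall i, exists B : set (plane R),
    measurable B /\ h i = \1_B by move=> i; have [B mB ->] := sh i; exists B.
have mB i : measurable (B i) by exact: (HB i).1.
pose A i := [set w | B i (coords (Y i w))].
have mA i : measurable (A i) by exact: measurable_coords.
have hA i w : h i (coords (Y i w)) = \1_(A i) w by rewrite (HB i).2.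
under eq_Rintegral do [under eq_bigr do rewrite hA; rewrite prod_indic].
rewrite Rintegral_indic; last by apply: bigsetI_measurable => i _; exact: mA.
have := iY [set: 'I_n]%SET B mB; rewrite (eq_bigl predT); last by move=> i; rewrite inE.
rewrite [X in _ = X -> _](eq_bigl predT); last by move=> i; rewrite inE.
move=> ->; rewrite (prod_fine_probability mA) /= mul1r; apply/eqP.
rewrite subr_eq0; apply/eqP/eq_bigr => i _.
by under eq_Rintegral do rewrite hA; rewrite Rintegral_indic.
Qed.

Lemma product_law_independent n (Y : 'I_n -> T -> K) :
  (forall i, scalar_measurable (Y i)) -> product_law Y -> mutually_independent P Y.
Proof.
move=> mY pY J B mB.
(* Coordinates outside [J] receive the whole plane, which contributes the factor 1. *)
pose B' i := if i \in J then B i else setT.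
have mB' i : measurable (B' i) by rewrite /B'; case: ifP.
pose A i := [set w | B' i (coords (Y i w))].
have mA i : measurable (A i) by exact: measurable_coords.
have bB' i : bounded_measurable (\1_(B' i) : plane R -> R).
  exact: bounded_measurable_indic.
have := pY (fun i => \1_(B' i)) bB'.
have hA i w : (\1_(B' i) (coords (Y i w)) : R) = \1_(A i) w by [].
under eq_Rintegral do [under eq_bigr do rewrite hA; rewrite prod_indic].
rewrite Rintegral_indic; last by apply: bigsetI_measurable => i _; exact: mA.
have {}hA i : \int[P]_w (\1_(B' i) (coords (Y i w)) : R) = fine (P (A i)).
  by under eq_Rintegral do rewrite hA; rewrite Rintegral_indic.
rewrite (eq_bigr (fun i => fine (P (A i)))); last by move=> i _; exact: hA.
move=> EP0; have : P (\big[setI/setT]_i A i) = (\prod_i P (A i))%E.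
  rewrite (prod_fine_probability mA) -EP0 fineK// fin_num_measure//.
  by apply: bigsetI_measurable => i _; exact: mA.
rewrite [in X in X -> _](bigID (mem J))/= [X in _ `&` X]big1; last first.
  by move=> i iJ; rewrite /A/= /B' (negbTE iJ); apply/seteqP; split.
rewrite setIT [X in _ = X -> _](bigID (mem J))/= [X in (_ * X)%E]big1; last first.
  move=> i iJ; rewrite /A/= /B' (negbTE iJ) -[RHS](@probability_setT _ _ _ P).
  by congr (P _); apply/seteqP; split.
rewrite mule1 => EB.
rewrite (eq_bigr A); last by move=> i iJ; rewrite /A /B' iJ.
by rewrite EB; apply: eq_bigr => i iJ; rewrite /A /B' iJ.
Qed.

End independence.

Section stable_variables.
Context {R : realType} {k : scalar_kind} (alpha : R).
Hypothesis alpha_gt0 : 0 < alpha.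
Context d (T : measurableType d) (P : probability T R).
Notation K := (scalarType R k).
Implicit Types (Y : T -> K) (theta : K).

(* [c] is the [alpha]-th power of the scale parameter of [Y]. *)
Definition has_scale Y (c : R) := scalar_measurable Y /\
  forall theta, charfun P Y theta =
    real_complex R (expR (- (modulus theta `^ alpha * c))).

Lemma has_scale_cos Y c theta b : has_scale Y c ->
  \int[P]_w cos (re (theta * Y w) + b) =
  cos b * expR (- (modulus theta `^ alpha * c)).
Proof.
move=> [mY /(_ theta)]; rewrite charfunE => -[Ec Es].
have bc : bounded_measurable (fun w => cos (re (theta * Y w))).
  by apply: bounded_measurable_cos; exact: scalar_measurable_re.
have bs : bounded_measurable (fun w => sin (re (theta * Y w))).
  by apply: bounded_measurable_sin; exact: scalar_measurable_re.
transitivity (\int[P]_w (cos b * cos (re (theta * Y w)) +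
                         (- sin b) * sin (re (theta * Y w)))).
  by apply: eq_Rintegral => w _; rewrite cosD; ring.
rewrite RintegralD_bounded ?RintegralZ_bounded//; try exact: bounded_measurableZ.
by rewrite Ec Es mulr0 addr0.
Qed.

Lemma has_scaleP Y c : scalar_measurable Y ->
  (forall theta b, \int[P]_w cos (re (theta * Y w) + b) =
     cos b * expR (- (modulus theta `^ alpha * c))) -> has_scale Y c.
Proof.
move=> mY EY; split => // theta; rewrite charfunE; apply/eqP.
rewrite eq_complex/=; apply/andP; split; apply/eqP.
- have := EY theta 0; rewrite cos0 mul1r => <-.
  by apply: eq_Rintegral => w _; rewrite addr0.
- have := EY theta (- (pi / 2)); rewrite cosN cos_pihalf mul0r => <-.
  by apply: eq_Rintegral => w _; rewrite cosBpihalf.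
Qed.

(** [Re_prod] expands the cosine of the sum into products of functions of single [Y i]. Independence
    factors their expectations, and the same expansion read backwards reassembles these into the
    product of the characteristic functions. *)
Lemma independent_has_scale n (Y : 'I_n -> T -> K) (c : 'I_n -> R)
    (a : 'I_n -> K) :
  (forall i, has_scale (Y i) (c i)) -> mutually_independent P Y ->
  has_scale (fun w => \sum_i a i * Y i w)
            (\sum_i modulus (a i) `^ alpha * c i).
Proof.
move=> sY iY; have mY i : scalar_measurable (Y i) by exact: (sY i).1.
have pY := independent_product_law mY iY.
apply: has_scaleP => [|theta b].
  by apply: scalar_measurable_sum => i; exact: scalar_measurableZ.
pose t i z := if z is true then fun x : plane R => sin (form (theta * a i) x)
              else fun x : plane R => cos (form (theta * a i) x).
have bt i z : bounded_measurable (t i z).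
  case: z.
  - by apply: bounded_measurable_sin; exact: form_measurable.
  - by apply: bounded_measurable_cos; exact: form_measurable.
have E w : cos (re (theta * (\sum_i a i * Y i w)) + b) =
    \sum_(e : {ffun 'I_n -> bool}) complex.Re (expi b * \prod_i imag_power (e i)) *
      \prod_i t i (e i) (coords (Y i w)).
  transitivity (complex.Re (expi b * \prod_i expi (re (theta * a i * Y i w)))).
    rewrite -expi_sum -expiD addrC /=; congr (cos (_ + _)).
    by rewrite mulr_sumr re_sum; apply: eq_bigr => i _; rewrite mulrA.
  rewrite Re_prod; apply: eq_bigr => e _; congr (_ * _); apply: eq_bigr => i _.
  by rewrite /t; case: (e i); rewrite form_coords.
under eq_Rintegral do rewrite E.
rewrite Rintegral_sum_bounded; last first.
  move=> e; apply/bounded_measurableZ/bounded_measurable_prod => i.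
  exact: bounded_measurable_coords.
under eq_bigr => e _.
  rewrite RintegralZ_bounded; last first.
    by apply: bounded_measurable_prod => i; exact: bounded_measurable_coords.
  rewrite (pY (fun i => t i (e i)))//.
  over.
rewrite -[RHS]/(complex.Re ((cos b * expR (- (modulus theta `^ alpha *
  \sum_i modulus (a i) `^ alpha * c i)))%:C%C)).
transitivity (complex.Re (expi b * \prod_i
    Complex (expR (- (modulus (theta * a i) `^ alpha * c i))) 0)).
  rewrite Re_prod; apply: eq_bigr => e _; congr (_ * _); apply: eq_bigr => i _.
  have [_ /(_ (theta * a i))] := sY i; rewrite charfunE => -[Ec Es].
  rewrite /t; case: (e i).
  - by rewrite -[RHS]Es; apply: eq_Rintegral => w _; rewrite form_coords.
  - by rewrite -[RHS]Ec; apply: eq_Rintegral => w _; rewrite form_coords.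
rewrite (eq_bigr (fun i => (expR (- (modulus (theta * a i) `^ alpha * c i)))%:C%C))//.
rewrite -real_complex_prod mulrC Re_scale /= mulrC; congr (_ * _).
rewrite -expR_sum; congr expR; rewrite sumrN mulr_sumr; congr (- _).
apply: eq_bigr => i _; rewrite modulusM powRM ?modulus_ge0//; ring.
Qed.

(** Additivity of the scale for all coefficients says that the joint characteristic function is the
    product of the marginal ones. Both sides then agree on waves, and multilinearity does the
    rest. *)
Lemma has_scale_product_law n (Y : 'I_n -> T -> K) (c : 'I_n -> R) :
  (forall i, scalar_measurable (Y i)) ->
  (forall theta : 'I_n -> K, has_scale (fun w => \sum_i theta i * Y i w)
     (\sum_i modulus (theta i) `^ alpha * c i)) ->
  product_law P Y.
Proof.
move=> mY sY h bh; apply/eqP; rewrite -subr_eq0; apply/eqP.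
rewrite -[X in _ - X]mul1r; move: h bh.
apply: (multilinear_eq0 (@wave_bounded _) (@wave_total _)) => [h i0 bh|h wh].
  apply: bounded_functional_sub.
  - exact: bounded_functional_Rintegral_prod.
  - exact: bounded_functional_prod_Rintegral.
(* Taking all coefficients zero but one recovers the marginal law. *)
have sY1 i : has_scale (Y i) (c i).
  have := sY (fun j => if j == i then 1 else 0).
  rewrite (bigD1 i)//= eqxx modulus1 powR1 mul1r big1 ?addr0; last first.
    by move=> j /negbTE ->; rewrite modulus0 powR0 ?mul0r// gt_eqF.
  congr has_scale; apply/funext => w.
  rewrite (bigD1 i)//= eqxx mul1r big1 ?addr0// => j /negbTE ->.
  by rewrite mul0r.
have [theta [b H]] := wave_family (k := k) wh.
rewrite mul1r; apply/eqP; rewrite subr_eq0; apply/eqP.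
under [RHS]eq_bigr => i _.
  under eq_Rintegral do rewrite H.
  rewrite (has_scale_cos _ _ (sY1 i)).
  over.
rewrite big_split/= prod_cos -expR_sum mulr_suml.
under eq_Rintegral do [under eq_bigr do rewrite H; rewrite prod_wave].
have bc (e : {ffun 'I_n -> bool}) : bounded_measurable (fun w =>
    cos (re (\sum_i (-1) ^+ e i * theta i * Y i w) + \sum_i (-1) ^+ e i * b i)).
  apply: bounded_measurable_cos; apply: measurable_funD => //.
  by have /scalar_measurableP[] // := scalar_measurable_sum (index_enum _)
     (fun i => scalar_measurableZ ((-1) ^+ e i * theta i) (mY i)).
rewrite Rintegral_sum_bounded; last by move=> e; exact: bounded_measurableZ.
apply: eq_bigr => e _; rewrite RintegralZ_bounded// -mulrA; congr (_ * _).
have := has_scale_cos 1 (\sum_i (-1) ^+ e i * b i) (sY (fun i => (-1) ^+ e i * theta i)).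
under eq_Rintegral do rewrite mul1r; move=> ->; congr (_ * expR _).
rewrite modulus1 powR1 mul1r sumrN; congr (- _); apply: eq_bigr => i _.
congr (_ `^ _ * _).
by case: (e i); rewrite ?expr1 ?expr0 ?mulN1r ?mul1r// modulusN.
Qed.

Lemma has_scale_law Y Y' c : has_scale Y c -> has_scale Y' c ->
  forall B : set (plane R), measurable B ->
    P [set w | B (coords (Y w))] = P [set w | B (coords (Y' w))].
Proof.
move=> sY sY' B mB.
have := @joint_law_eq _ k _ _ P 1 (fun=> Y) (fun=> Y') (fun=> sY.1) (fun=> sY'.1).
have EY (theta : 'I_1 -> K) b : \int[P]_w cos (re (\sum_(i < 1) theta i * Y w) + b) =
                  \int[P]_w cos (re (\sum_(i < 1) theta i * Y' w) + b).
  under eq_Rintegral do rewrite big_ord1.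
  under [RHS]eq_Rintegral do rewrite big_ord1.
  by rewrite (has_scale_cos _ _ sY) (has_scale_cos _ _ sY').
have bB (i : 'I_1) : bounded_measurable (\1_B : plane R -> R).
  exact: bounded_measurable_indic.
move=> /(_ EY (fun=> \1_B) bB).
under eq_Rintegral do rewrite big_ord1.
under [X in _ = X -> _]eq_Rintegral do rewrite big_ord1.
have mE (Z : T -> K) : scalar_measurable Z ->
    \int[P]_w (\1_B (coords (Z w)) : R) = fine (P [set w | B (coords (Z w))]).
  move=> mZ; rewrite -Rintegral_indic//; exact: measurable_coords.
rewrite mE ?mE; [|exact: sY'.1|exact: sY.1].
move=> EP; rewrite -[LHS]fineK; last first.
  by rewrite fin_num_measure//; apply: measurable_coords mB; exact: sY.1.
rewrite EP fineK// fin_num_measure//.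
by apply: measurable_coords mB; exact: sY'.1.
Qed.

Lemma has_scaleZ Y c (s : R) : 0 <= s -> has_scale Y c ->
  has_scale (fun w => ofR k s * Y w) (s `^ alpha * c).
Proof.
move=> s0 [mY EY]; apply: has_scaleP => [|theta b]; first exact: scalar_measurableZ.
have := has_scale_cos (theta * ofR k s) b (conj mY EY).
under eq_Rintegral do rewrite -mulrA.
move=> ->; rewrite modulusM powRM ?modulus_ge0// modulus_ofR ger0_norm//.
by rewrite mulrA.
Qed.

Lemma has_scale0 : has_scale (fun=> 0) 0.
Proof.
apply: has_scaleP => [|theta b]; first exact: scalar_measurable_cst.
under eq_Rintegral do rewrite mulr0 re0 add0r.
rewrite Rintegral_cst// [X in _ * X = _](_ : _ = 1); last first.
  by rewrite -[RHS]/(fine 1%E) -(probability_setT P).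
by rewrite mulr1 mulr0 oppr0 expR0 mulr1.
Qed.

Lemma has_scale_modulus_law Y Y' c (e : R) : has_scale Y c -> has_scale Y' c ->
  P [set w | e <= modulus (Y w)] = P [set w | e <= modulus (Y' w)].
Proof. by move=> sY sY'; exact: (has_scale_law sY sY' (measurable_large e)). Qed.

Lemma has_scale0_modulus Y (e : R) : 0 < e -> has_scale Y 0 ->
  P [set w | e <= modulus (Y w)] = 0%E.
Proof.
move=> e0 sY; rewrite (has_scale_modulus_law e sY has_scale0).
rewrite -(measure0 P); congr (P _); apply/seteqP; split => // w /=.
by rewrite modulus0 leNgt e0.
Qed.

Lemma tight_modulus Y (eta : R) : scalar_measurable Y -> 0 < eta ->
  exists n : nat, (P [set w | (n%:R <= modulus (Y w))%R] <= eta%:E)%E.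
Proof.
move=> mY eta0; pose A n := [set w | n%:R <= modulus (Y w)].
have mA n : measurable (A n) by exact: measurable_modulus_ge.
have : P (A n) @[n --> \oo] --> P (\bigcap_n A n).
  apply: nonincreasing_cvg_mu => //.
  - by rewrite -ge0_fin_numE// fin_num_measure.
  - exact: bigcapT_measurable.
  - move=> m n mn; apply/subsetPset => w; rewrite /A/=; apply: le_trans.
    by rewrite ler_nat.
have -> : \bigcap_n A n = set0.
  apply/seteqP; split => // w /(_ (Num.truncn (modulus (Y w))).+1 I).
  by rewrite /A/= leNgt truncnS_gt.
rewrite measure0 => /fine_cvgP[_ /cvgrPdist_le /(_ _ eta0)[n _ /(_ n (leqnn _))]].
rewrite /= sub0r normrN => h; exists n.
rewrite -(@fineK _ (P (A n))) ?fin_num_measure// lee_fin.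
exact: le_trans (ler_norm _) h.
Qed.

(* By scaling, all the variables [Y] have the tails of a single one. *)
Lemma has_scale_tail (e eta : R) : 0 < e -> 0 < eta ->
  exists2 delta : R, 0 < delta & forall Y c, 0 <= c <= delta -> has_scale Y c ->
    (P [set w | (e <= modulus (Y w))%R] <= eta%:E)%E.
Proof.
move=> e0 eta0.
(* If the probability space carries no variable of positive scale, then [c = 0] and the tail
   vanishes; otherwise a single [Y0] is the model of all the others. *)
have [[Y0 [c0 [c00 s0]]]|none] :=
    pselect (exists Y0 (c0 : R), 0 < c0 /\ has_scale Y0 c0); last first.
  exists 1 => // Y c /andP[c0 _] sY.
  have cE : c = 0.
    by apply/eqP; rewrite eq_le c0 andbT leNgt; apply/negP => cp; apply: none; exists Y, c.
  by rewrite cE in sY; rewrite has_scale0_modulus// lee_fin ltW.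
have [n hn] := tight_modulus s0.1 eta0.
exists (c0 * (e / n.+1%:R) `^ alpha).
  by rewrite mulr_gt0// powR_gt0// divr_gt0.
move=> Y c /andP[c_ge0 cd] sY.
(* The factor that turns the scale [c0] of [Y0] into [c]; the choice of [delta] keeps it below
   [e / (n+1)]. *)
pose s := (c / c0) `^ alpha^-1.
have s_ge0 : 0 <= s by exact: powR_ge0.
have c0n : c0 != 0 by rewrite gt_eqF.
have sE : s `^ alpha * c0 = c.
  rewrite /s -powRrM mulVf ?gt_eqF// powRr1; first by rewrite mulfVK.
  by rewrite divr_ge0// ltW.
have sY0 := has_scaleZ s_ge0 s0; rewrite sE in sY0.
rewrite (has_scale_modulus_law e sY sY0); apply: le_trans hn.
have [m1 _] := sY0; have [m2 _] := s0.
apply: le_measure; rewrite ?inE; [exact: measurable_modulus_ge|exact: measurable_modulus_ge|].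
move=> w /=; rewrite modulusM modulus_ofR ger0_norm// => h.
have ps : s <= e / n.+1%:R.
  rewrite /s -[leRHS](powRr1 (divr_ge0 (ltW e0) (ler0n _ _))).
  rewrite -[X in _ <= _ `^ X](mulfV (negbT (gt_eqF alpha_gt0))) powRrM; apply: ge0_ler_powR.
  - by rewrite invr_ge0 ltW.
  - by rewrite nnegrE divr_ge0// ltW.
  - by rewrite nnegrE powR_ge0.
  - by rewrite ler_pdivrMr// mulrC.
have {}h : e <= e / n.+1%:R * modulus (Y0 w).
  by apply: le_trans h _; rewrite ler_wpM2r// modulus_ge0.
have : n.+1%:R <= modulus (Y0 w).
  by move: h; rewrite -mulrA -[X in X <= _]mulr1 ler_pM2l// ler_pdivlMl// mulr1.
by apply: le_trans; rewrite ler_nat.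
Qed.

Lemma has_scale_eq0 Y : has_scale Y 0 -> {ae P, forall w, Y w = 0}.
Proof.
move=> sY; pose A n := [set w | n.+1%:R^-1 <= modulus (Y w)].
have nA n : P.-negligible (A n).
  have mA : measurable (A n) by apply: measurable_modulus_ge; exact: sY.1.
  by apply/negligibleP => //; apply: has_scale0_modulus => //; rewrite invr_gt0.
apply: (negligibleS _ (negligible_bigcup nA)) => w /= /eqP Yw.
have m0 : 0 < modulus (Y w) by rewrite lt_def modulus_ge0 modulus_eq0 Yw.
exists (Num.truncn (modulus (Y w))^-1) => //=.
by rewrite /A/= invf_ple ?posrE// ltW// truncnS_gt.
Qed.

End stable_variables.

(** * Kernels and simple integrals *)

#[local] Opaque modulus powR integral.

Lemma fine_le_lin (R : realType) (x y z : \bar R) (a b : R) :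
  x \is a fin_num -> y \is a fin_num -> z \is a fin_num ->
  (x <= a%:E * y + b%:E * z)%E -> fine x <= a * fine y + b * fine z.
Proof. by case: x y z => [x| |] [y| |] [z| |]//= _ _ _; rewrite lee_fin. Qed.

(** Stands in for the triangle inequality. The factor [(1 + a) ^+ 2] is close to 1 for small [a], at
    the price of the constant [(1 + a^-1) ^+ 2] on [D]; so [a] is fixed from [e] and [N], and [n] is
    taken large afterwards. *)
Lemma cvg_quasi_additive (R : realType) (N : R) (N_ D : nat -> R) :
  0 <= N -> (forall n, 0 <= N_ n) -> (forall n, 0 <= D n) ->
  D n @[n --> \oo] --> 0 ->
  (forall (a : R) n, 0 < a ->
     N_ n <= (1 + a) ^+ 2 * N + (1 + a^-1) ^+ 2 * D n /\
     N <= (1 + a) ^+ 2 * N_ n + (1 + a^-1) ^+ 2 * D n) ->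
  N_ n @[n --> \oo] --> N.
Proof.
move=> N0 N_0 D0 Dcv bnd.
apply/cvgrPdist_le => e e0.
(* [4 * N + 4] bounds [N_ n] as soon as [D n <= 1], by the hypothesis for [a = 1]. Since
   [(1 + a) ^+ 2 <= 1 + 3 * a], the factor then costs at most [e / 2]. *)
pose a := Num.min 1 (e / (6 * (4 * N + 4 + 1))).
have a0 : 0 < a by rewrite lt_min ltr01/= divr_gt0// mulr_gt0//; lra.
have a1 : a <= 1 by rewrite ge_min lexx.
have ae : a * (6 * (4 * N + 4 + 1)) <= e.
  rewrite -ler_pdivlMr ?ge_min ?lexx ?orbT//; rewrite mulr_gt0//; lra.
pose C := (1 + a^-1) ^+ 2.
have C0 : 0 < C by rewrite exprn_gt0// ltr_wpDl// invr_gt0.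
have h1 : \forall n \near \oo, D n <= 1.
  move/cvgrPdist_le : Dcv => /(_ 1 ltr01); apply: filterS => n.
  by rewrite sub0r normrN ger0_norm.
have h2 : \forall n \near \oo, C * D n <= e / 2.
  move/cvgrPdist_le : Dcv => /(_ (e / 2 / C)) H.
  have {}H := H (divr_gt0 (divr_gt0 e0 (ltr0Sn _ _)) C0).
  apply: filterS H => n; rewrite sub0r normrN ger0_norm// ler_pdivlMr//.
  by rewrite mulrC.
near=> n.
have d1 : D n <= 1 by near: n.
have d2 : C * D n <= e / 2 by near: n.
have [b1 b2] := bnd a n a0.
have [b3 _] := bnd 1 n ltr01.
rewrite invr1 in b3; rewrite -/C in b1 b2.
have b4 : N_ n <= 4 * N + 4 by lra.
have sqa : (1 + a) ^+ 2 <= 1 + 3 * a by rewrite expr2; nra.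
have p1 : (1 + a) ^+ 2 * N <= (1 + 3 * a) * N by rewrite ler_wpM2r.
have p2 : (1 + a) ^+ 2 * N_ n <= (1 + 3 * a) * N_ n by rewrite ler_wpM2r.
have p3 : a * N_ n <= a * (4 * N + 4) by rewrite ler_wpM2l// ltW.
have p4 : 0 <= a * N by rewrite mulr_ge0// ltW.
by rewrite ler_norml; apply/andP; split; lra.
Unshelve. all: by end_near. Qed.

(** * Powers of the modulus and the mass of a kernel *)

Section modulus_powers.
Context {R : realType} {k : scalar_kind} (alpha : R).
Hypothesis alpha_gt0 : 0 < alpha.
Hypothesis alpha_lt2 : alpha < 2.
Notation K := (scalarType R k).

(** Either [|x - y| <= a |y|], and then [|x| <= (1 + a) |y|], or [|y| < |x - y| / a], and then
    [|x| <= (1 + 1/a) |x - y|]. Both factors are at least 1, so by [alpha < 2] their powers are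
    bounded by their squares. For [a = 1] this gives the constant 4 of sums. *)
Lemma modulus_powR_le (x y : K) (a : R) : 0 < a ->
  modulus x `^ alpha <= (1 + a) ^+ 2 * modulus y `^ alpha +
    (1 + a^-1) ^+ 2 * modulus (x - y) `^ alpha.
Proof.
move=> a0; have xy : modulus x <= modulus y + modulus (x - y).
  by rewrite (le_trans _ (modulusD _ _))// addrC subrK.
have sq (u v : R) : 1 <= u -> 0 <= v -> (u * v) `^ alpha <= u ^+ 2 * v `^ alpha.
  move=> u1 v0; rewrite powRM//; last by rewrite (le_trans ler01).
  rewrite ler_wpM2r ?powR_ge0// -powR_mulrn ?(le_trans ler01)//.
  by rewrite ler_powR// ltW.
have [h|h] := leP (modulus (x - y)) (a * modulus y).
  rewrite -[leLHS]addr0 lerD//; last by rewrite mulr_ge0 ?sqr_ge0 ?powR_ge0.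
  apply: le_trans (sq (1 + a) (modulus y) _ (modulus_ge0 _)); last by lra.
  rewrite ge0_ler_powR ?nnegrE ?modulus_ge0// ?(ltW alpha_gt0)//.
    by rewrite mulr_ge0 ?modulus_ge0//; lra.
  by rewrite mulrDl mul1r (le_trans xy)// lerD2l.
rewrite -[leLHS]add0r lerD//; first by rewrite mulr_ge0 ?sqr_ge0 ?powR_ge0.
have a1 : 1 <= 1 + a^-1 by rewrite lerDl invr_ge0 ltW.
apply: le_trans (sq (1 + a^-1) (modulus (x - y)) a1 (modulus_ge0 _)).
rewrite ge0_ler_powR ?nnegrE ?modulus_ge0// ?(ltW alpha_gt0)//.
  by rewrite mulr_ge0 ?modulus_ge0// (le_trans ler01).
rewrite mulrDl mul1r addrC (le_trans xy)// lerD2r.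
by rewrite mulrC ler_pdivlMr// mulrC ltW.
Qed.

Lemma modulus_powRD (x y : K) :
  modulus (x + y) `^ alpha <= 4 * (modulus x `^ alpha + modulus y `^ alpha).
Proof.
have := @modulus_powR_le (x + y) y 1 ltr01; rewrite addrK invr1.
by set u := _ `^ _; set v := _ `^ _; set w := _ `^ _; lra.
Qed.

Lemma modulus_powRM (x y : K) :
  modulus (x * y) `^ alpha = modulus x `^ alpha * modulus y `^ alpha.
Proof. by rewrite modulusM powRM ?modulus_ge0. Qed.

Lemma modulus_powR0 : modulus (0 : K) `^ alpha = 0.
Proof. by rewrite modulus0 powR0// gt_eqF. Qed.

End modulus_powers.

Section Lalpha_theory.
Context {R : realType} {k : scalar_kind} (alpha : R).
Hypothesis alpha_gt0 : 0 < alpha.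
Hypothesis alpha_lt2 : alpha < 2.
Context d (S : measurableType d) (mu : {measure set S -> \bar R}).
Notation K := (scalarType R k).
Implicit Types f g h : S -> K.

Definition Lalpha_mass f : \bar R := (\int[mu]_s (modulus (f s) `^ alpha)%:E)%E.

Lemma Lalpha_distE f g : Lalpha_dist alpha mu f g = Lalpha_mass (fun s => f s - g s).
Proof. by []. Qed.

Lemma modulus_powR_measurable f : scalar_measurable f ->
  measurable_fun [set: S] (fun s => modulus (f s) `^ alpha).
Proof.
by move=> mf; exact: (measurableT_comp (measurable_powR alpha) (modulus_measurable mf)).
Qed.

Lemma modulus_powR_emeasurable f : scalar_measurable f ->
  measurable_fun [set: S] (fun s => (modulus (f s) `^ alpha)%:E).
Proof. by move=> mf; apply/measurable_EFinP; exact: modulus_powR_measurable. Qed.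

Lemma Lalpha_mass_ge0 f : (0 <= Lalpha_mass f)%E.
Proof. by apply: integral_ge0 => s _; rewrite lee_fin powR_ge0. Qed.

Lemma Lalpha_mass_fin f : in_Lalpha alpha mu f -> Lalpha_mass f \is a fin_num.
Proof. by move=> [mf fi]; rewrite ge0_fin_numE// Lalpha_mass_ge0. Qed.

Lemma le_Lalpha_mass f (v : S -> \bar R) : scalar_measurable f ->
  measurable_fun [set: S] v -> (forall s, ((modulus (f s) `^ alpha)%:E <= v s)%E) ->
  (Lalpha_mass f <= \int[mu]_s v s)%E.
Proof.
move=> mf mv fv; apply: (ge0_le_integral _ measurableT).
- by move=> s _; rewrite lee_fin powR_ge0.
- exact: modulus_powR_emeasurable.
- exact: mv.
- by move=> s _; exact: fv.
Qed.

Let ge0Z (a : R) f (s : S) : 0 <= a -> (0 <= a%:E * (modulus (f s) `^ alpha)%:E)%E.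
Proof. by move=> a0; rewrite -EFinM lee_fin mulr_ge0 ?powR_ge0. Qed.

Let measZ (a : R) f : scalar_measurable f ->
  measurable_fun [set: S] (fun s => a%:E * (modulus (f s) `^ alpha)%:E)%E.
Proof.
move=> mf; apply: emeasurable_funM; first exact: measurable_cst.
exact: modulus_powR_emeasurable.
Qed.

Lemma Lalpha_massZl f (a : R) : scalar_measurable f -> 0 <= a ->
  (\int[mu]_s (a%:E * (modulus (f s) `^ alpha)%:E) = a%:E * Lalpha_mass f)%E.
Proof.
move=> mf a0; apply: (ge0_integralZl_EFin _ measurableT) => //.
- by move=> s _; rewrite lee_fin powR_ge0.
- exact: modulus_powR_emeasurable.
Qed.

Lemma Lalpha_mass_lin f g h (a b : R) : scalar_measurable f ->
  scalar_measurable g -> scalar_measurable h -> 0 <= a -> 0 <= b ->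
  (forall s, modulus (f s) `^ alpha <=
     a * modulus (g s) `^ alpha + b * modulus (h s) `^ alpha) ->
  (Lalpha_mass f <= a%:E * Lalpha_mass g + b%:E * Lalpha_mass h)%E.
Proof.
move=> mf mg mh a0 b0 le_fgh.
rewrite -(Lalpha_massZl mg a0) -(Lalpha_massZl mh b0).
have mag := measZ a mg; have mbh := measZ b mh.
have g1 s : [set: S] s -> (0 <= a%:E * (modulus (g s) `^ alpha)%:E)%E by move=> _; exact: ge0Z.
have g2 s : [set: S] s -> (0 <= b%:E * (modulus (h s) `^ alpha)%:E)%E by move=> _; exact: ge0Z.
rewrite -(ge0_integralD mu measurableT g1 mag g2 mbh).
apply: le_Lalpha_mass mf (emeasurable_funD mag mbh) _ => s.
by rewrite -!EFinM -EFinD lee_fin.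
Qed.

Lemma Lalpha_massD f g : scalar_measurable f -> scalar_measurable g ->
  (Lalpha_mass (fun s => f s + g s)%R <=
     4%:E * Lalpha_mass f + 4%:E * Lalpha_mass g)%E.
Proof.
move=> mf mg; apply: Lalpha_mass_lin => //; first exact: scalar_measurableD.
by move=> s; rewrite -mulrDr; exact: modulus_powRD.
Qed.

Lemma Lalpha_massZ (c : K) f : scalar_measurable f ->
  Lalpha_mass (fun s => c * f s) = ((modulus c `^ alpha)%:E * Lalpha_mass f)%E.
Proof.
move=> mf; rewrite -(Lalpha_massZl mf (powR_ge0 _ _)).
by apply: eq_integral => s _; rewrite modulus_powRM.
Qed.

Lemma in_LalphaD f g : in_Lalpha alpha mu f -> in_Lalpha alpha mu g ->
  in_Lalpha alpha mu (fun s => f s + g s).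
Proof.
move=> [mf fi] [mg gi]; split; first exact: scalar_measurableD.
apply: le_lt_trans (Lalpha_massD mf mg) _; apply: lte_add_pinfty.
- by apply: lte_mul_pinfty fi; rewrite ?lee_fin.
- by apply: lte_mul_pinfty gi; rewrite ?lee_fin.
Qed.

Lemma in_LalphaZ (c : K) f : in_Lalpha alpha mu f ->
  in_Lalpha alpha mu (fun s => c * f s).
Proof.
move=> [mf fi]; split; first exact: scalar_measurableZ.
rewrite -/(Lalpha_mass _) (Lalpha_massZ _ mf); apply: lte_mul_pinfty fi => //.
by rewrite lee_fin powR_ge0.
Qed.

Lemma in_LalphaB f g : in_Lalpha alpha mu f -> in_Lalpha alpha mu g ->
  in_Lalpha alpha mu (fun s => f s - g s).
Proof.
move=> fi gi; have := in_LalphaD fi (in_LalphaZ (-1) gi).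
by under eq_fun do rewrite mulN1r.
Qed.

Lemma in_Lalpha0 : in_Lalpha alpha mu (fun=> 0 : K).
Proof.
split; first exact: scalar_measurable_cst.
by rewrite modulus_powR0// integral0 ltry.
Qed.

Lemma Lalpha_mass0 : Lalpha_mass (fun=> 0 : K) = 0%E.
Proof. by rewrite /Lalpha_mass modulus_powR0// integral0. Qed.

Lemma Lalpha_mass_le f g : scalar_measurable f -> scalar_measurable g ->
  (forall s, modulus (f s) <= modulus (g s)) -> (Lalpha_mass f <= Lalpha_mass g)%E.
Proof.
move=> mf mg fg; apply: le_Lalpha_mass mf (modulus_powR_emeasurable mg) _ => s.
by rewrite lee_fin ge0_ler_powR ?nnegrE ?modulus_ge0// ltW.
Qed.

Lemma Lalpha_mass_eq f g : (forall s, modulus (f s) = modulus (g s)) ->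
  Lalpha_mass f = Lalpha_mass g.
Proof. by move=> fg; apply: eq_integral => s _; rewrite fg. Qed.

Lemma in_LalphaP f : in_Lalpha alpha mu f <->
  scalar_measurable f /\ (Lalpha_mass f < +oo)%E.
Proof. by []. Qed.

Lemma in_Lalpha_sum (I : Type) (r : seq I) (F : I -> S -> K) :
  (forall i, in_Lalpha alpha mu (F i)) ->
  in_Lalpha alpha mu (fun s => \sum_(i <- r) F i s).
Proof.
move=> iF; elim: r => [|i r IHr].
  by under eq_fun do rewrite big_nil; exact: in_Lalpha0.
by under eq_fun do rewrite big_cons; exact: (in_LalphaD (iF i) IHr).
Qed.

Lemma eq_Lalpha_mass f g :
  scalar_measurable f -> scalar_measurable g ->
  {ae mu, forall s, f s = g s} -> Lalpha_mass f = Lalpha_mass g.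
Proof.
move=> mf mg fg; apply: (ge0_ae_eq_integral measurableT).
- exact: modulus_powR_emeasurable.
- exact: modulus_powR_emeasurable.
- by move=> s _; rewrite lee_fin powR_ge0.
- by move=> s _; rewrite lee_fin powR_ge0.
- by apply: filterS fg => s /= -> _.
Qed.

Lemma Lalpha_mass_indic (A : set S) : measurable A ->
  Lalpha_mass (fun s => \1_A s) = mu A.
Proof.
move=> mA; transitivity (\int[mu]_s (\1_A s)%:E)%E; last first.
  by rewrite integral_indic// setIT.
apply: eq_integral => s _; rewrite !indicE; case: (s \in A).
- by rewrite modulus1 powR1.
- by rewrite modulus_powR0.
Qed.

Lemma in_Lalpha_indic (A : set S) : finite_set_of mu A ->
  in_Lalpha alpha mu (fun s => \1_A s : K).
Proof.
move=> [mA Af]; split; first exact: scalar_measurable_indic.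
by rewrite -/(Lalpha_mass _) Lalpha_mass_indic.
Qed.

Lemma Lalpha_mass_cvg (f_ : nat -> S -> K) f :
  (forall n, in_Lalpha alpha mu (f_ n)) -> in_Lalpha alpha mu f ->
  Lalpha_dist alpha mu (f_ n) f @[n --> \oo] --> 0%E ->
  fine (Lalpha_mass (f_ n)) @[n --> \oo] --> fine (Lalpha_mass f).
Proof.
move=> fi_ fi fcv.
pose D n := Lalpha_mass (fun s => f_ n s - f s).
have Dfin n : D n \is a fin_num by apply: Lalpha_mass_fin; exact: (in_LalphaB (fi_ n) fi).
have D0 n : 0 <= fine (D n) by rewrite fine_ge0// Lalpha_mass_ge0.
have Dcv : fine (D n) @[n --> \oo] --> 0 by exact: (fine_cvg fcv).
pose N := fine (Lalpha_mass f); pose N_ n := fine (Lalpha_mass (f_ n)).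
have N0 : 0 <= N by rewrite fine_ge0// Lalpha_mass_ge0.
have N_0 n : 0 <= N_ n by rewrite fine_ge0// Lalpha_mass_ge0.
have bnd (a : R) n : 0 < a -> N_ n <= (1 + a) ^+ 2 * N + (1 + a^-1) ^+ 2 * fine (D n) /\
    N <= (1 + a) ^+ 2 * N_ n + (1 + a^-1) ^+ 2 * fine (D n).
  have Nf : Lalpha_mass f \is a fin_num by exact: Lalpha_mass_fin fi.
  have Nnf : Lalpha_mass (f_ n) \is a fin_num by exact: Lalpha_mass_fin (fi_ n).
  have mD : scalar_measurable (fun s => f_ n s - f s).
    exact: scalar_measurableB (fi_ n).1 fi.1.
  move=> a0; split; apply: (fine_le_lin _ _ (Dfin n)) => //.
  - apply: (Lalpha_mass_lin (fi_ n).1 fi.1 mD (sqr_ge0 _) (sqr_ge0 _)) => s.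
    exact: modulus_powR_le.
  - apply: (Lalpha_mass_lin fi.1 (fi_ n).1 mD (sqr_ge0 _) (sqr_ge0 _)) => s.
    by rewrite modulusB; exact: modulus_powR_le.
exact: (cvg_quasi_additive N0 N_0 D0 Dcv bnd).
Qed.

End Lalpha_theory.

Lemma has_scale_ae (R : realType) (k : scalar_kind) (alpha : R) d
    (T : measurableType d) (P : probability T R) (Y Y' : T -> scalarType R k) c :
  scalar_measurable Y' -> {ae P, forall w, Y w = Y' w} ->
  has_scale alpha P Y c -> has_scale alpha P Y' c.
Proof.
move=> mY' YY' sY; apply: has_scaleP => // theta b.
rewrite -(has_scale_cos theta b sY); congr fine; apply/esym.
apply: ae_eq_integral => //.
- by apply/measurable_EFinP; exact: (bounded_cos _ _ sY.1).1.
- by apply/measurable_EFinP; exact: (bounded_cos _ _ mY').1.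
- by apply: filterS YY' => w /= -> _.
Qed.

Section random_measure_additivity.
Context {R : realType} {k : scalar_kind} (alpha : R).
Hypothesis alpha_gt0 : 0 < alpha.
Hypothesis alpha_lt2 : alpha < 2.
Context d (S : measurableType d) (mu : {measure set S -> \bar R}).
Context d' (T : measurableType d') (P : probability T R).
Notation K := (scalarType R k).
Variable M : set S -> T -> K.
Hypothesis hM : SaS_random_measure alpha mu P M.

Let finite_set0 : finite_set_of mu (@set0 S).
Proof. by split => //; rewrite measure0. Qed.

Lemma random_measure_scale (A : set S) : finite_set_of mu A ->
  has_scale alpha P (M A) (fine (mu A)).
Proof. by case: hM => mM cM _ _ fA; split; [exact: mM|exact: cM]. Qed.

Lemma random_measure0 : {ae P, forall w, M set0 w = 0}.
Proof.
apply: (has_scale_eq0 (alpha := alpha)); have := random_measure_scale finite_set0.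
by rewrite measure0.
Qed.

(** Sigma-additivity of the family padded with empty sets, on which [M] vanishes almost surely: the
    partial sums are then eventually constant. *)
Lemma random_measure_sum n (A : nat -> set S) :
  (forall i, finite_set_of mu (A i)) -> trivIset setT A ->
  {ae P, forall w, M (\big[setU/set0]_(i < n) A i) w = \sum_(i < n) M (A i) w}.
Proof.
move=> fA tA; pose A' i := if (i < n)%N then A i else set0.
have fA' i : finite_set_of mu (A' i) by rewrite /A'; case: ifP.
have tA' : trivIset setT A'.
  apply/trivIsetP => i j _ _ ij; rewrite /A'.
  by case: ifP => _; case: ifP => _; rewrite ?set0I ?setI0//; move/trivIsetP : tA; apply.
have UA' : \bigcup_i A' i = \big[setU/set0]_(i < n) A i.
  rewrite -bigcup_mkord; apply/seteqP; split => s [i /=].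
  - by rewrite /A'; case: ifP => // ilt _ Ais; exists i.
  - by move=> ilt Ais; exists i => //; rewrite /A' ilt.
have fU : finite_set_of mu (\bigcup_i A' i).
  split; first by apply: bigcupT_measurable => i; exact: (fA' i).1.
  rewrite UA' (le_lt_trans (Boole_inequality _ (n := n) (fun i _ => (fA i).1)))//.
  by apply: lte_sum_pinfty => i _; exact: (fA i).2.
case: hM => _ _ _ /(_ A' fA' tA' fU).
apply: filterS2 random_measure0 => w M0 cvM; rewrite -UA'.
have E m : (n <= m)%N -> \sum_(i < m) M (A' i) w = \sum_(i < n) M (A i) w.
  move=> nm; rewrite (big_ord_widen_cond m predT (fun i => M (A i) w) nm).
  rewrite [RHS]big_mkcond; apply: eq_bigr => i _; rewrite /A'.
  by case: ifP => //= ilt; rewrite M0.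
have : modulus (\sum_(i < n) M (A i) w - M (\bigcup_n A' n) w) = 0.
  apply/esym; apply: (@cvg_unique _ (@Rhausdorff R) _ _ _ _ cvM).
  apply: cvg_near_cst; near=> m; rewrite E//; near: m; exact: nbhs_infty_ge.
by move=> /eqP; rewrite modulus_eq0 subr_eq0 => /eqP ->.
Unshelve. all: by end_near. Qed.

(** * Simple kernels on overlapping sets *)

Section atoms.
Variables (m : nat) (c : 'I_m -> K) (A : 'I_m -> set S).
Hypothesis fA : forall i, finite_set_of mu (A i).

Let pattern s : {set 'I_m} := [set i | s \in A i]%SET.

Let N := #|{set 'I_m}|.

(** Subsets of the index set numbered by natural numbers, because additivity is stated for
    sequences; past [N] the value is the empty set by default. *)
Let J (j : nat) : {set 'I_m} :=
  if insub j is Some j' then enum_val (j' : 'I_N) else finset.set0.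

(** The atoms of the algebra generated by the [A i]. The empty pattern is left out: its points form
    the complement of the union, whose measure may be infinite. *)
Let atom (j : nat) : set S :=
  [set s | (j < N)%N /\ J j != finset.set0 /\ pattern s = J j].

Let JE (j : 'I_N) : J j = enum_val j.
Proof. by rewrite /J valK. Qed.

Let measurable_atom j : measurable (atom j).
Proof.
have [jN|jN] := boolP ((j < N)%N && (J j != finset.set0)); last first.
  rewrite (_ : atom j = set0)//; apply/seteqP; split => // s [h1 [h2 _]].
  by move: jN; rewrite h1 h2.
rewrite (_ : atom j = \big[setI/setT]_(i < m) (if i \in J j then A i else ~` A i)).
  apply: bigsetI_measurable => i _; case: ifP => _; first exact: (fA i).1.
  by apply: measurableC; exact: (fA i).1.
have bigE s : (\big[setI/setT]_(i < m) (if i \in J j then A i else ~` A i)) s <->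
    forall i, (if i \in J j then A i else ~` A i) s.
  rewrite -(bigcap_seq _ (fun i => if i \in J j then A i else ~` A i)).
  split => [h i|h i _]; last exact: h.
  by apply: h; rewrite /= mem_index_enum.
apply/seteqP; split => s; rewrite bigE.
- move=> [_ [_ pJ]] i; rewrite -pJ inE; case: ifP => [/set_mem//|/negbT].
  by rewrite notin_setE.
- move=> h; case/andP: jN => h1 h2; split=> //; split=> //; apply/setP => i; rewrite inE.
  have := h i; case: ifP => _ Ais; first exact: mem_set.
  exact: memNset.
Qed.

Let finite_atom j : finite_set_of mu (atom j).
Proof.
split; first exact: measurable_atom.
have [jN|jN] := boolP ((j < N)%N && (J j != finset.set0)); last first.
  rewrite (_ : atom j = set0) ?measure0//; apply/seteqP; split => // s [h1 [h2 _]].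
  by move: jN; rewrite h1 h2.
have /andP[_ /set0Pn[i iJ]] := jN.
apply: le_lt_trans (fA i).2.
apply: le_measure; rewrite ?inE; [exact: measurable_atom|exact: (fA i).1|].
move=> s [_ [_ pJ]]; have : i \in pattern s by rewrite pJ.
by rewrite inE => /set_mem.
Qed.

Let trivIset_atom : trivIset setT atom.
Proof.
move=> i j _ _ [s [[iN [_ pi]] [jN [_ pj]]]].
have : J i = J j by rewrite -pi -pj.
rewrite (JE (Ordinal iN)) (JE (Ordinal jN)) => /enum_val_inj.
by move/(congr1 val).
Qed.

Let coef (j : nat) : K := \sum_(i in J j) c i.

Let simple_pattern s : \sum_i c i * \1_(A i) s = \sum_(i in pattern s) c i.
Proof.
rewrite [RHS]big_mkcond; apply: eq_bigr => i _; rewrite inE indicE.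
by case: (s \in A i); rewrite ?mulr1 ?mulr0.
Qed.

Let atom_sum (g : {set 'I_m} -> R) s : g finset.set0 = 0 ->
  \sum_(j < N) g (J j) * \1_(atom j) s = g (pattern s).
Proof.
move=> g0; rewrite (bigD1 (enum_rank (pattern s)))//= JE enum_rankK.
rewrite big1 ?addr0 => [|j jp].
  have [p0|p0] := eqVneq (pattern s) finset.set0; first by rewrite p0 g0 mul0r.
  rewrite indicE mem_set ?mulr1//; split; first exact: ltn_ord.
  by rewrite JE enum_rankK.
rewrite indicE memNset ?mulr0// => -[_ [_ pJ]].
by move: jp; rewrite pJ JE enum_valK eqxx.
Qed.

Let mass_simple : fine (Lalpha_mass alpha mu (fun s => \sum_i c i * \1_(A i) s)) =
  \sum_(j < N) modulus (coef j) `^ alpha * fine (mu (atom j)).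
Proof.
have mi j : measurable_fun [set: S]
    (fun s => (modulus (coef j) `^ alpha)%:E * (\1_(atom j) s)%:E)%E.
  apply: emeasurable_funM; first exact: measurable_cst.
  by apply/measurable_EFinP; apply: measurable_indic; exact: measurable_atom.
have ge0 j s : [set: S] s ->
    (0 <= (modulus (coef j) `^ alpha)%:E * (\1_(atom j) s)%:E)%E.
  by move=> _; rewrite -EFinM lee_fin mulr_ge0 ?powR_ge0// indicE.
transitivity (fine (\int[mu]_s (\sum_(j < N)
    (modulus (coef j) `^ alpha)%:E * (\1_(atom j) s)%:E))%E).
  congr fine; apply: eq_integral => s _; rewrite simple_pattern.
  rewrite -(@atom_sum (fun I => modulus (\sum_(i in I) c i) `^ alpha)).
    by rewrite -sumEFin.
  by rewrite big_set0 modulus_powR0.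
rewrite (ge0_integral_sum _ measurableT (fun j : 'I_N => mi j) (fun j s h => ge0 j s h)).
rewrite [X in fine X](_ : _ = (\sum_(j < N)
    modulus (coef j) `^ alpha * fine (mu (atom j)))%:E)//.
rewrite -sumEFin; apply: eq_bigr => j _.
rewrite (ge0_integralZl_EFin _ measurableT).
- have [ma fa] := finite_atom j.
  rewrite integral_indic// setIT EFinM fineK// ge0_fin_numE//.
- by move=> s _; rewrite lee_fin indicE.
- by apply/measurable_EFinP; apply: measurable_indic; exact: measurable_atom.
- exact: powR_ge0.
Qed.

Let random_measure_atoms (i : 'I_m) :
  {ae P, forall w, M (A i) w = \sum_(j < N) (if i \in J j then M (atom j) w else 0)}.
Proof.
pose B j := if i \in J j then atom j else set0.
have fB j : finite_set_of mu (B j).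
  by rewrite /B; case: ifP => _ //; exact: finite_atom.
have tB : trivIset setT B.
  apply/trivIsetP => j l _ _ jl; rewrite /B.
  case: ifP => _; case: ifP => _; rewrite ?set0I ?setI0//.
  by move/trivIsetP : trivIset_atom; apply.
have UB : \big[setU/set0]_(j < N) B j = A i.
  rewrite -bigcup_mkord; apply/seteqP; split => s.
  - move=> [j /= _]; rewrite /B; case: ifP => // iJ [_ [_ pJ]].
    by move: iJ; rewrite -pJ inE => /set_mem.
  - move=> Ais; have ip : i \in pattern s by rewrite inE; apply: mem_set.
    exists (enum_rank (pattern s)) => /=; first exact: ltn_ord.
    rewrite /B JE enum_rankK ip; split; first exact: ltn_ord.
    by rewrite JE enum_rankK; split => //; apply/set0Pn; exists i.
have := random_measure_sum N fB tB; rewrite UB.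
apply: filterS2 random_measure0 => w M0 ->.
by apply: eq_bigr => j _; rewrite /B; case: ifP.
Qed.

(** The sets may overlap, so the [M (A i)] need not be independent, but the values of [M] on the
    disjoint atoms are. Almost surely the sum regroups over the atoms, with coefficient [coef j] on
    the atom [j], and the scales add. *)
Lemma random_measure_simple :
  has_scale alpha P (fun w => \sum_i c i * M (A i) w)
    (fine (Lalpha_mass alpha mu (fun s => \sum_i c i * \1_(A i) s))).
Proof.
rewrite mass_simple.
have mMA i : scalar_measurable (M (A i)) by case: hM => mM _ _ _; exact: mM.
have s_atom : has_scale alpha P (fun w => \sum_(j < N) coef j * M (atom j) w)
    (\sum_(j < N) modulus (coef j) `^ alpha * fine (mu (atom j))).
  apply: (independent_has_scale (Y := fun (j : 'I_N) => M (atom j))) => [j|].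
    by apply: random_measure_scale; exact: finite_atom.
  case: hM => _ _ iM _; apply: (iM N (fun j : 'I_N => atom j)) => [j|].
    exact: finite_atom.
  move=> i j _ _ /(trivIset_atom I I) ij; exact/val_inj.
apply: has_scale_ae s_atom.
  by apply: scalar_measurable_sum => i; exact: scalar_measurableZ.
have : {ae P, forall w, forall i, M (A i) w = \sum_(j < N) (if i \in J j then M (atom j) w else 0)}.
  apply: filter_forall => i; exact: random_measure_atoms.
apply: filterS => w Mw.
rewrite (eq_bigr (fun i => \sum_(j < N) c i * (if i \in J j then M (atom j) w else 0))); last first.
  by move=> i _; rewrite Mw mulr_sumr.
rewrite exchange_big; apply: eq_bigr => j _; rewrite /coef mulr_suml big_mkcond.
by apply: eq_bigr => i _; case: ifP; rewrite ?mulr0.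
Qed.

End atoms.

End random_measure_additivity.

(** * Stochastic integrals *)

#[local] Opaque Lalpha_dist Lalpha_mass.

Section convergence_tools.
Context {R : realType}.
Implicit Types x y z : nat -> \bar R.

Lemma cvge0_lin (a b : R) x y z :
  (forall n, (0 <= x n)%E) ->
  (forall n, (x n <= a%:E * y n + b%:E * z n)%E) ->
  y n @[n --> \oo] --> 0%E -> z n @[n --> \oo] --> 0%E ->
  x n @[n --> \oo] --> 0%E.
Proof.
move=> x0 xyz cy cz.
apply: (@squeeze_cvge _ _ _ _ (fun=> 0%E) _ (fun n => a%:E * y n + b%:E * z n)%E).
- by apply: nearW => n; rewrite x0 xyz.
- exact: cvg_cst.
- have -> : 0%E = (a%:E * 0 + b%:E * 0)%E :> \bar R by rewrite !mule0 adde0.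
  by apply: cvgeD; [rewrite !mule0|exact: cvgeZl|exact: cvgeZl].
Qed.

Lemma cos_lipschitz (x y : R) : `|cos x - cos y| <= `|x - y|.
Proof.
wlog xy : x y / x <= y => [H|].
  have [xy|yx] := leP x y; first exact: H.
  by rewrite distrC [leRHS]distrC H// ltW.
have dcos (t : R) : t \in `]x, y[ -> is_derive t 1 (@cos R) (- sin t).
  by move=> _; exact: is_derive_cos.
have [|c _ E] := MVT_segment xy dcos.
  by apply: continuous_subspaceT; exact: continuous_cos.
rewrite distrC E normrM normrN distrC -[leRHS]mul1r ler_wpM2r//; exact: sin_max.
Qed.

End convergence_tools.

Section convergence_in_probability.
Context {R : realType} {k : scalar_kind} d (T : measurableType d)
  (P : probability T R).
Notation K := (scalarType R k).
Implicit Types (Y Z : T -> K).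

(** The cosine is bounded and 1-Lipschitz. Where [|Y_n - Y|] is below [del], the two cosines differ
    by at most [e / 2]; elsewhere they differ by at most 2, on an event of probability at most
    [e / 4]. The [1] added to [modulus theta] allows [theta = 0]. *)
Lemma cvg_in_probability_cos (Y_ : nat -> T -> K) Y theta b :
  (forall n, scalar_measurable (Y_ n)) -> scalar_measurable Y ->
  cvg_in_probability P Y_ Y ->
  \int[P]_w cos (re (theta * Y_ n w) + b) @[n --> \oo] -->
  \int[P]_w cos (re (theta * Y w) + b).
Proof.
move=> mY_ mY cY; apply/cvgrPdist_le => e e0.
have t0 : 0 < modulus theta + 1 by rewrite ltr_wpDl// modulus_ge0.
pose del := e / 2 / (modulus theta + 1).
have del0 : 0 < del by rewrite !divr_gt0.
have /fine_cvgP[_ /cvgrPdist_le /(_ _ (divr_gt0 e0 (ltr0Sn _ 3)))] := cY _ del0.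
apply: filterS => n /=; rewrite sub0r normrN => Pn.
pose A := [set w | del <= modulus (Y_ n w - Y w)].
have mA : measurable A by apply: measurable_modulus_ge; exact: scalar_measurableB.
have b1 := bounded_cos theta b (mY_ n).
have b2 := bounded_cos theta b mY.
have -> : \int[P]_w cos (re (theta * Y w) + b) - \int[P]_w cos (re (theta * Y_ n w) + b) =
    \int[P]_w (cos (re (theta * Y w) + b) - cos (re (theta * Y_ n w) + b)).
  by rewrite RintegralB//; exact: bounded_measurable_integrable.
have b3 := bounded_measurableB b2 b1.
apply: le_trans (le_normr_Rintegral _ _) _ => //.
  exact: bounded_measurable_integrable.
apply: (@le_trans _ _ (\int[P]_w (e / 2 + 2 * \1_A w))).
  apply: le_Rintegral => //.
  - by apply: (integrable_norm (f := fun w => _ : R)); exact: bounded_measurable_integrable.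
  - apply: bounded_measurable_integrable; apply: bounded_measurableD.
      exact: bounded_measurable_cst.
    by apply: bounded_measurableZ; exact: bounded_measurable_indic.
  - move=> w _; have [Aw|Aw] := pselect (A w).
      rewrite indicE mem_set// mulr1 (@le_trans _ _ 2)//; last by rewrite lerDr divr_ge0// ltW.
      by rewrite (le_trans (ler_normB _ _))// -[2]/(1 + 1) lerD// cos_max.
    rewrite indicE memNset// mulr0 addr0 (le_trans (cos_lipschitz _ _))//.
    have -> : re (theta * Y w) + b - (re (theta * Y_ n w) + b) =
        re (theta * (Y w - Y_ n w)) by rewrite mulrBr reD reN; ring.
    rewrite (le_trans (re_le_modulus _))// modulusM modulusB.
    have {}Aw : modulus (Y_ n w - Y w) <= del by move/negP: Aw; rewrite -ltNge => /ltW.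
    rewrite (le_trans (ler_wpM2l (modulus_ge0 _) Aw))//.
    rewrite /del mulrCA ler_piMr//; first by rewrite divr_ge0// ltW.
    by rewrite ler_pdivrMr// mul1r lerDl.
have b4 : bounded_measurable (fun w => 2 * \1_A w : R).
  by apply: bounded_measurableZ; exact: bounded_measurable_indic.
rewrite (RintegralD_bounded P (bounded_measurable_cst _ _) b4).
have b5 : bounded_measurable (\1_A : T -> R) by exact: bounded_measurable_indic.
rewrite (RintegralZ_bounded P 2 b5) Rintegral_indic// Rintegral_cst// [X in _ * X + _](_ : _ = 1); last first.
  by rewrite -[RHS]/(fine 1%E) -(probability_setT P).
by rewrite mulr1; have := le_trans (ler_norm _) Pn; rewrite -/A; lra.
Qed.

Lemma cvg_in_probability_scale alpha (Y_ : nat -> T -> K) Y (c_ : nat -> R) c :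
  (forall n, has_scale alpha P (Y_ n) (c_ n)) -> scalar_measurable Y ->
  cvg_in_probability P Y_ Y -> c_ n @[n --> \oo] --> c ->
  has_scale alpha P Y c.
Proof.
move=> sY_ mY cY cc; apply: has_scaleP => // theta b.
have := @cvg_in_probability_cos Y_ Y theta b (fun n => (sY_ n).1) mY cY.
move/(@cvg_unique _ (@Rhausdorff R) _ _ _ _); apply => /=.
under eq_fun do rewrite (has_scale_cos _ _ (sY_ _)).
apply: cvgMr; apply: (@cvg_comp _ _ _ _ expR); last exact: continuous_expR.
by apply: cvgN; exact: cvgMr.
Qed.

Lemma cvg_in_probabilityD (Y_ Z_ : nat -> T -> K) Y Z :
  (forall n, scalar_measurable (Y_ n)) -> scalar_measurable Y ->
  (forall n, scalar_measurable (Z_ n)) -> scalar_measurable Z ->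
  cvg_in_probability P Y_ Y -> cvg_in_probability P Z_ Z ->
  cvg_in_probability P (fun n w => Y_ n w + Z_ n w) (fun w => Y w + Z w).
Proof.
move=> mY_ mY mZ_ mZ cY cZ e e0.
have e20 : 0 < e / 2 by rewrite divr_gt0.
apply: (cvge0_lin (a := 1) (b := 1) _ _ (cY _ e20) (cZ _ e20)) => n.
  exact: measure_ge0.
rewrite !mul1e; pose A := [set w | e / 2 <= modulus (Y_ n w - Y w)].
pose B := [set w | e / 2 <= modulus (Z_ n w - Z w)].
have mA : measurable A by apply: measurable_modulus_ge; exact: scalar_measurableB.
have mB : measurable B by apply: measurable_modulus_ge; exact: scalar_measurableB.
apply: le_trans (measureU2 P mA mB); apply: le_measure; rewrite ?inE.
- apply: measurable_modulus_ge.
  by apply: scalar_measurableB; exact: scalar_measurableD.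
- exact: measurableU.
- move=> w /= ew; rewrite /A /B /=; apply/orP; apply: contraTT ew.
  rewrite negb_or -!ltNge => /andP[h1 h2].
  have -> : Y_ n w + Z_ n w - (Y w + Z w) = (Y_ n w - Y w) + (Z_ n w - Z w) by ring.
  by rewrite (le_lt_trans (modulusD _ _))//; lra.
Qed.

Lemma cvg_in_probabilityZ (a : K) (Y_ : nat -> T -> K) Y :
  (forall n, scalar_measurable (Y_ n)) -> scalar_measurable Y ->
  cvg_in_probability P Y_ Y ->
  cvg_in_probability P (fun n w => a * Y_ n w) (fun w => a * Y w).
Proof.
move=> mY_ mY cY e e0.
have a0 : 0 < modulus a + 1 by rewrite ltr_wpDl// modulus_ge0.
have ea0 : 0 < e / (modulus a + 1) by rewrite divr_gt0.
apply: (cvge0_lin (a := 1) (b := 0) _ _ (cY _ ea0) (cY _ ea0)) => n.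
  exact: measure_ge0.
rewrite mul1e mul0e adde0; apply: le_measure; rewrite ?inE.
- by apply: measurable_modulus_ge; apply: scalar_measurableB; exact: scalar_measurableZ.
- by apply: measurable_modulus_ge; exact: scalar_measurableB.
- move=> w /=; rewrite -mulrBr modulusM => h; rewrite ler_pdivrMr//.
  by rewrite (le_trans h)// mulrC ler_wpM2l ?modulus_ge0// lerDl.
Qed.

End convergence_in_probability.

Section simple_integrals.
Context {R : realType} {k : scalar_kind} (alpha : R).
Hypothesis alpha_gt0 : 0 < alpha.
Hypothesis alpha_lt2 : alpha < 2.
Context d (S : measurableType d) (mu : {measure set S -> \bar R}).
Context d' (T : measurableType d') (P : probability T R).
Notation K := (scalarType R k).
Variable M : set S -> T -> K.
Hypothesis mM : forall A, finite_set_of mu A -> scalar_measurable (M A).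
Notation integral_of := (is_stochastic_integral alpha mu P M).
Implicit Types (f g : S -> K) (Y Z : T -> K).

Definition simple_kernel n (c : nat -> K) (A : nat -> set S) (s : S) : K :=
  \sum_(i < n) c i * \1_(A i) s.

Lemma simple_integral_measurable n (c : nat -> K) (A : nat -> set S) :
  (forall i, finite_set_of mu (A i)) ->
  scalar_measurable (fun w => \sum_(i < n) c i * M (A i) w).
Proof.
move=> fA; apply: scalar_measurable_sum => i; apply: scalar_measurableZ.
exact: mM.
Qed.

Lemma in_Lalpha_simple n (c : nat -> K) (A : nat -> set S) :
  (forall i, finite_set_of mu (A i)) -> in_Lalpha alpha mu (simple_kernel n c A).
Proof.
move=> fA; apply: in_Lalpha_sum => // i.
by apply: in_LalphaZ => //; exact: in_Lalpha_indic.
Qed.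

(** The two approximating simple kernels are concatenated. [M] is any measurable set function here,
    since the result is also applied to the zero set function. *)
Lemma stochastic_integralD f g Y Z : integral_of f Y -> integral_of g Z ->
  integral_of (fun s => f s + g s) (fun w => Y w + Z w).
Proof.
move=> [fi mY [m1 [c1 [A1 [fA1 cf cY]]]]] [gi mZ [m2 [c2 [A2 [fA2 cg cZ]]]]].
split; [exact: in_LalphaD|exact: scalar_measurableD|].
pose m n := (m1 n + m2 n)%N.
pose c n i := if (i < m1 n)%N then c1 n i else c2 n (i - m1 n)%N.
pose A n i := if (i < m1 n)%N then A1 n i else A2 n (i - m1 n)%N.
(* [F] is arbitrary because the same splitting is applied to the kernels, with indicators, and to
   their integrals, with [M]. *)
have E (V : Type) (F : V -> set S -> K) (v : V) n :
    \sum_(i < m n) c n i * F v (A n i) =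
    \sum_(i < m1 n) c1 n i * F v (A1 n i) + \sum_(i < m2 n) c2 n i * F v (A2 n i).
  rewrite big_split_ord/=; congr (_ + _); apply: eq_bigr => i _; rewrite /c /A /=.
  - by rewrite ltn_ord.
  - by rewrite ltnNge leq_addr/= addKn.
exists m, c, A; split.
- by move=> n i; rewrite /A; case: ifP.
- apply: (cvge0_lin (a := 4) (b := 4) _ _ cf cg) => n; first exact: Lalpha_mass_ge0.
  rewrite !Lalpha_distE.
  have m1n := scalar_measurableB (in_Lalpha_simple (m1 n) (c1 n) (fA1 n)).1 fi.1.
  have m2n := scalar_measurableB (in_Lalpha_simple (m2 n) (c2 n) (fA2 n)).1 gi.1.
  apply: le_trans (Lalpha_massD alpha_gt0 alpha_lt2 mu m1n m2n).
  rewrite le_eqVlt; apply/orP; left; apply/eqP; congr (Lalpha_mass _ _ _).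
  apply/funext => s; rewrite (E _ (fun s A => \1_A s)) /simple_kernel; ring.
- rewrite (_ : (fun n w => \sum_(i < m n) c n i * M (A n i) w) = fun n w =>
    \sum_(i < m1 n) c1 n i * M (A1 n i) w + \sum_(i < m2 n) c2 n i * M (A2 n i) w).
    apply: cvg_in_probabilityD => // n; exact: simple_integral_measurable.
  by apply/funext => n; apply/funext => w; rewrite (E _ (fun w A => M A w)).
Qed.

Lemma stochastic_integralZ (a : K) f Y : integral_of f Y ->
  integral_of (fun s => a * f s) (fun w => a * Y w).
Proof.
move=> [fi mY [m [c [A [fA cf cY]]]]].
split; [exact: in_LalphaZ|exact: scalar_measurableZ|].
exists m, (fun n i => a * c n i), A; split; first exact: fA.
- apply: (cvge0_lin (a := modulus a `^ alpha) (b := 0) _ _ cf cf) => n.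
    exact: Lalpha_mass_ge0.
  rewrite mul0e adde0 !Lalpha_distE.
  have mn := scalar_measurableB (in_Lalpha_simple (m n) (c n) (fA n)).1 fi.1.
  rewrite -(Lalpha_massZ alpha mu a mn) le_eqVlt; apply/orP; left; apply/eqP.
  congr (Lalpha_mass _ _ _); apply/funext => s.
  rewrite mulrBr mulr_sumr; congr (_ - _).
  by apply: eq_bigr => i _; rewrite mulrA.
- rewrite (_ : (fun n w => \sum_(i < m n) a * c n i * M (A n i) w) = fun n w =>
      a * \sum_(i < m n) c n i * M (A n i) w).
    exact: cvg_in_probabilityZ (fun n => simple_integral_measurable (m n) (c n) (fA n)) mY cY.
  apply/funext => n; apply/funext => w; rewrite mulr_sumr.
  by apply: eq_bigr => i _; rewrite mulrA.
Qed.

Lemma stochastic_integralB f g Y Z : integral_of f Y -> integral_of g Z ->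
  integral_of (fun s => f s - g s) (fun w => Y w - Z w).
Proof.
move=> fY gZ; have := stochastic_integralD fY (stochastic_integralZ (-1) gZ).
by under eq_fun do rewrite mulN1r; under [X in integral_of _ X -> _]eq_fun do rewrite mulN1r.
Qed.

End simple_integrals.

Section stochastic_integrals.
Context {R : realType} {k : scalar_kind} (alpha : R).
Hypothesis alpha_gt0 : 0 < alpha.
Hypothesis alpha_lt2 : alpha < 2.
Context d (S : measurableType d) (mu : {measure set S -> \bar R}).
Context d' (T : measurableType d') (P : probability T R).
Notation K := (scalarType R k).
Variable M : set S -> T -> K.
Hypothesis hM : SaS_random_measure alpha mu P M.
Notation integral_of := (is_stochastic_integral alpha mu P M).
Implicit Types (f g : S -> K) (Y Z : T -> K).

Lemma random_measure_measurable A : finite_set_of mu A -> scalar_measurable (M A).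
Proof. by case: hM => mM _ _ _; exact: mM. Qed.

Let stochastic_integralD := stochastic_integralD (P := P) alpha_gt0 alpha_lt2 random_measure_measurable.
Let stochastic_integralZ := stochastic_integralZ (P := P) alpha_gt0 alpha_lt2 random_measure_measurable.
Let stochastic_integralB := stochastic_integralB (P := P) alpha_gt0 alpha_lt2 random_measure_measurable.
Let in_Lalpha_simple := in_Lalpha_simple (k := k) alpha_gt0 alpha_lt2 (mu := mu).

(** For simple kernels the scale is the mass. The mass is continuous in [L^alpha] and the scale
    passes to limits in probability. *)
Lemma stochastic_integral_scale f Y : integral_of f Y ->
  has_scale alpha P Y (fine (Lalpha_mass alpha mu f)).
Proof.
move=> [fi mY [m [c [A [fA cf cY]]]]].
apply: (cvg_in_probability_scale _ mY cY
   (c_ := fun n => fine (Lalpha_mass alpha mu (simple_kernel (m n) (c n) (A n))))).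
  by move=> n; apply: (random_measure_simple alpha_gt0 hM).
apply: (Lalpha_mass_cvg alpha_gt0 alpha_lt2 _ fi cf) => n.
exact: in_Lalpha_simple.
Qed.

Lemma stochastic_integral_indic A : finite_set_of mu A ->
  integral_of (fun s => \1_A s) (M A).
Proof.
move=> fA; split; [exact: in_Lalpha_indic|exact: random_measure_measurable|].
exists (fun=> 1%N), (fun _ _ => 1), (fun _ _ => A); split => //.
- rewrite (_ : (fun n => _) = fun=> 0%E); first exact: cvg_cst.
  apply/funext => n; rewrite Lalpha_distE -(Lalpha_mass0 (k := k) alpha_gt0 mu).
  by congr Lalpha_mass; apply/funext => s; rewrite big_ord1 mul1r subrr.
- move=> e e0; rewrite (_ : (fun n => _) = fun=> 0%E); first exact: cvg_cst.
  apply/funext => n; rewrite (_ : [set w | _] = set0) ?measure0//.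
  by apply/seteqP; split => // w /=; rewrite big_ord1 mul1r subrr modulus0 leNgt e0.
Qed.

Lemma stochastic_integral0 : integral_of (fun=> 0) (fun=> 0).
Proof.
have f0 : finite_set_of mu (@set0 S) by split => //; rewrite measure0.
have := stochastic_integralZ 0 (stochastic_integral_indic f0).
by under eq_fun do rewrite mul0r; under [X in integral_of _ X -> _]eq_fun do rewrite mul0r.
Qed.

Lemma stochastic_integral_sum (I : Type) (r : seq I) (F : I -> S -> K)
    (G : I -> T -> K) : (forall i, integral_of (F i) (G i)) ->
  integral_of (fun s => \sum_(i <- r) F i s) (fun w => \sum_(i <- r) G i w).
Proof.
move=> FG; elim: r => [|i r IHr].
  under eq_fun do rewrite big_nil; under [X in integral_of _ X]eq_fun do rewrite big_nil.
  exact: stochastic_integral0.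
under eq_fun do rewrite big_cons; under [X in integral_of _ X]eq_fun do rewrite big_cons.
exact: (stochastic_integralD (FG i) IHr).
Qed.

Lemma eq_stochastic_integral f g Y : scalar_measurable g ->
  {ae mu, forall s, f s = g s} -> integral_of f Y -> integral_of g Y.
Proof.
move=> mg fg [fi mY [m [c [A [fA cf cY]]]]]; split; [|exact: mY|].
  apply/in_LalphaP; split; first exact: mg.
  by rewrite -(eq_Lalpha_mass alpha fi.1 mg fg); have /in_LalphaP[] := fi.
exists m, c, A; split; [exact: fA| |exact: cY].
rewrite (_ : (fun n => Lalpha_dist _ _ _ g) = fun n => Lalpha_dist alpha mu
  (fun s => \sum_(i < m n) c n i * \1_(A n i) s) f); first exact: cf.
apply/funext => n; rewrite !Lalpha_distE.
have mn := (in_Lalpha_simple (m n) (c n) (fA n)).1.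
apply: (eq_Lalpha_mass alpha (scalar_measurableB mn mg) (scalar_measurableB mn fi.1)).
by apply: filterS fg => s ->.
Qed.

(** One [delta] serves all kernels: a small mass is a small scale, and the scale controls the tails
    uniformly. This is the continuity of the integral from [L^alpha] to convergence in
    probability. *)
Lemma stochastic_integral_tail (e eta : R) : 0 < e -> 0 < eta ->
  exists2 delta : R, 0 < delta & forall f Y, integral_of f Y ->
    (Lalpha_mass alpha mu f <= delta%:E)%E ->
    (P [set w | (e <= modulus (Y w))%R] <= eta%:E)%E.
Proof.
move=> e0 eta0.
have [delta delta0 H] := has_scale_tail (k := k) alpha_gt0 P e0 eta0.
exists delta => // f Y fY le_d; apply: H (stochastic_integral_scale fY).
rewrite fine_ge0 ?Lalpha_mass_ge0//= -lee_fin fineK//.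
by case: fY => fi _ _; exact: Lalpha_mass_fin.
Qed.

Lemma stochastic_integral_cvg (f_ : nat -> S -> K) f (Y_ : nat -> T -> K) Y :
  (forall n, integral_of (f_ n) (Y_ n)) -> integral_of f Y ->
  Lalpha_dist alpha mu (f_ n) f @[n --> \oo] --> 0%E ->
  cvg_in_probability P Y_ Y.
Proof.
move=> fY_ fY cf e e0; apply/fine_cvgP; split.
  apply: nearW => n; rewrite fin_num_measure//; apply: measurable_modulus_ge.
  by case: (fY_ n) => _ mYn _; case: fY => _ mY _; exact: scalar_measurableB.
apply/cvgrPdist_le => eta eta0.
have [delta delta0 H] := stochastic_integral_tail e0 eta0.
have /fine_cvgP[nf /cvgrPdist_le /(_ _ delta0)] := cf.
apply: filterS2 nf => n nf; rewrite sub0r normrN => h.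
have := H _ _ (stochastic_integralB (fY_ n) fY).
rewrite -Lalpha_distE -(fineK nf) lee_fin (le_trans (ler_norm _) h) => /(_ isT).
rewrite sub0r normrN ger0_norm ?fine_ge0// -lee_fin fineK//.
rewrite fin_num_measure//; apply: measurable_modulus_ge.
by case: (fY_ n) => _ mYn _; case: fY => _ mY _; exact: scalar_measurableB.
Qed.

End stochastic_integrals.

(** * Density of the simple kernels in L^alpha *)

Section kernel_approximation.
Context {R : realType} {k : scalar_kind} (alpha : R).
Hypothesis alpha_gt0 : 0 < alpha.
Hypothesis alpha_lt2 : alpha < 2.
Context d (S : measurableType d) (mu : {measure set S -> \bar R}).
Notation K := (scalarType R k).

Definition approximable (f : S -> K) := exists (m : nat -> nat)
  (c : nat -> nat -> K) (A : nat -> nat -> set S),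
  (forall n i, finite_set_of mu (A n i)) /\
  Lalpha_dist alpha mu (simple_kernel (m n) (c n) (A n)) f @[n --> \oo] --> 0%E.

Lemma markov_finite (h : S -> R) (q : R) :
  in_Lalpha alpha mu (fun s => ofR k (h s)) -> 0 < q ->
  finite_set_of mu [set s | q <= h s].
Proof.
move=> /in_LalphaP[mh hfin] q0; set A := [set s | _].
have mrh : measurable_fun [set: S] h.
  have /scalar_measurableP[mr _] := mh.
  by move: mr; under eq_fun do rewrite re_ofR.
have mA : measurable A.
  rewrite (_ : A = h @^-1` `[q, +oo[); last first.
    by apply/seteqP; split => s /=; rewrite in_itv/= andbT.
  by rewrite -[X in measurable X]setTI; exact: mrh.
split=> //.
have qa0 : 0 < q `^ alpha by exact: powR_gt0.
have mi : scalar_measurable (fun s => \1_A s : K) by exact: scalar_measurable_indic.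
have : ((q `^ alpha)%:E * mu A < +oo)%E.
  apply: le_lt_trans hfin.
  have := Lalpha_massZ alpha mu (ofR k q) mi.
  rewrite Lalpha_mass_indic// modulus_ofR gtr0_norm// => <-.
  apply: (Lalpha_mass_le alpha_gt0 mu (scalar_measurableZ _ mi) mh) => s.
  rewrite modulusM !modulus_ofR gtr0_norm// indicE.
  have [As|As] := pselect (A s).
    by rewrite mem_set//= modulus1 mulr1 (le_trans As)// ler_norm.
  by rewrite memNset// modulus0 mulr0.
case: (mu A) (measure_ge0 mu A) => [r _ _|_|//]; first by rewrite ltry.
by rewrite gt0_muley ?lte_fin// ltxx.
Qed.

(** The layers of [h] are simple on its level sets, which have finite measure by Markov's
    inequality; they lie below [h], so [h] to the power [alpha] dominates the error. *)
Lemma approximable_nonneg (h : S -> R) : (forall s, 0 <= h s) ->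
  in_Lalpha alpha mu (fun s => ofR k (h s)) -> approximable (fun s => ofR k (h s)).
Proof.
move=> h0 hin.
pose A (n i : nat) := [set s | i.+1%:R / n.+1%:R <= h s].
have fA n i : finite_set_of mu (A n i).
  by apply: markov_finite => //; rewrite divr_gt0.
exists (fun n => n.+1 ^ 2)%N, (fun n _ => ofR k n.+1%:R^-1), A; split => //.
have sE n s : simple_kernel (n.+1 ^ 2) (fun=> ofR k n.+1%:R^-1) (A n) s = ofR k (layer n (h s)).
  rewrite /simple_kernel /layer.
  rewrite (big_morph (ofR k) (id1 := 0) (op1 := +%R) (ofRD (k := k)) (ofR0 (k := k))).
  apply: eq_bigr => i _; rewrite ofRM; congr (_ * _).
  rewrite (indic_pred _ (fun y => i.+1%:R / n.+1%:R <= y)).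
  rewrite (indic_pred _ (fun s => i.+1%:R / n.+1%:R <= h s)).
  by case: (_ <= _); rewrite ?ofR0 ?ofR1.
have mn n : scalar_measurable (fun s => ofR k (layer n (h s)) - ofR k (h s)).
  apply: scalar_measurableB; last exact: hin.1.
  have := (in_Lalpha_simple alpha_gt0 alpha_lt2 (n.+1 ^ 2) (fun=> ofR k n.+1%:R^-1) (fA n)).1.
  by rewrite (funext (sE n)).
have dE n s : modulus (ofR k (layer n (h s)) - ofR k (h s)) = h s - layer n (h s).
  have -> : ofR k (layer n (h s)) - ofR k (h s) = ofR k (layer n (h s) - h s).
    by apply/eqP; rewrite subr_eq -ofRD subrK.
  by rewrite modulus_ofR distrC ger0_norm// subr_ge0 layer_le.
rewrite (_ : (fun n => Lalpha_dist _ _ _ _) = fun n =>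
    (\int[mu]_s ((h s - layer n (h s)) `^ alpha)%:E)%E); last first.
  apply/funext => n; rewrite Lalpha_distE.
  transitivity (Lalpha_mass alpha mu (fun s => ofR k (layer n (h s)) - ofR k (h s))).
    by congr (Lalpha_mass _ _ _); apply/funext => s; rewrite sE.
  by apply: eq_integral => s _; rewrite dE.
rewrite -(integral0 mu setT).
have hE : (fun s => (modulus (ofR k (h s)) `^ alpha)%:E) = fun s => (h s `^ alpha)%:E.
  by apply/funext => s; rewrite modulus_ofR ger0_norm.
have mpow n : measurable_fun [set: S] (fun s => ((h s - layer n (h s)) `^ alpha)%:E).
  by have := modulus_powR_emeasurable alpha (mn n); under eq_fun do rewrite dE.
apply: (@dominated_cvg _ _ _ mu setT measurableT _ _ (fun s => (h s `^ alpha)%:E)).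
- exact: mpow.
- move=> s _; apply: cvg_EFin; first exact: nearW.
  apply/cvgrPdist_le => e e0 /=.
  have e'0 : 0 < e `^ alpha^-1 by exact: powR_gt0.
  have /cvgrPdist_le/(_ _ e'0) := cvg_layer (h0 s).
  apply: filterS => n; rewrite sub0r normrN.
  rewrite ger0_norm ?subr_ge0 ?layer_le// => le_e.
  rewrite ger0_norm ?powR_ge0//.
  rewrite -[leRHS]powRr1 ?(ltW e0)// -[X in _ <= _ `^ X](mulVf (negbT (gt_eqF alpha_gt0))).
  rewrite powRrM; apply: ge0_ler_powR => //.
  + exact: ltW.
  + by rewrite nnegrE subr_ge0 layer_le.
  + by rewrite nnegrE ltW.
- by [].
- apply/integrableP; split.
    by rewrite -hE; apply: modulus_powR_emeasurable; exact: hin.1.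
  rewrite (eq_integral (fun s => (modulus (ofR k (h s)) `^ alpha)%:E)).
    exact: hin.2.
  by move=> s _; rewrite gee0_abs ?lee_fin ?powR_ge0// modulus_ofR ger0_norm.
- move=> n s _; rewrite /= lee_fin ger0_norm ?powR_ge0//; apply: ge0_ler_powR.
  + exact: ltW.
  + by rewrite nnegrE subr_ge0 layer_le.
  + by rewrite nnegrE.
  + by rewrite gerBl layer_ge0.
Qed.

(** [dual 0 (-1)] is the imaginary unit for complex scalars and 0 for real ones. *)
Lemma scalar_split (z : K) :
  z = ofR k (re z) + dual 0 (-1) * ofR k (im z).
Proof.
apply: scalar_eqP; rewrite !(reD, imD, reM, imM, re_ofR, im_ofR).
- by rewrite mulr0 subr0 /dual; case: k z => [z|[a b]] /=; rewrite mul0r addr0.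
- by rewrite mulr0 add0r /dual; case: k z => [z|[a b]] /=;
    rewrite ?mul0r ?add0r ?opprK ?mul1r.
Qed.

Context d' (T : measurableType d') (P : probability T R).

(* Approximability is stochastic integrability against the zero measure, so it
   inherits the linearity of stochastic integrals. *)
Let zero_measure (A : set S) (w : T) : K := 0.

Let zero_integralP f : in_Lalpha alpha mu f ->
  approximable f <->
  is_stochastic_integral alpha mu P zero_measure f (fun=> 0).
Proof.
move=> fi; split => [[m [c [A [fA cf]]]]|[_ _ [m [c [A [fA cf _]]]]]].
- split; [exact: fi|exact: scalar_measurable_cst|].
  exists m, c, A; split; [exact: fA|exact: cf|].
  move=> e e0; rewrite (_ : (fun n => _) = fun=> 0%E); first exact: cvg_cst.
  apply/funext => n; rewrite -(measure0 P); congr (P _); apply/seteqP; split => // w /=.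
  rewrite big1 => [|i _]; first by rewrite subr0 modulus0 leNgt e0.
  by rewrite /zero_measure mulr0.
- by exists m, c, A; split; [exact: fA|exact: cf].
Qed.

Let mzero A : finite_set_of mu A -> scalar_measurable (zero_measure A).
Proof. by move=> _; exact: scalar_measurable_cst. Qed.

(** The positive and negative parts of the two coordinates are bounded by the modulus, hence in
    [L^alpha]; linearity reassembles them. *)
Lemma in_Lalpha_approximable f : in_Lalpha alpha mu f -> approximable f.
Proof.
move=> fi; have /scalar_measurableP[mr mi] := fi.1.
have part (h : S -> R) : measurable_fun [set: S] h ->
    (forall s, 0 <= h s <= modulus (f s)) ->
    is_stochastic_integral alpha mu P zero_measure (fun s => ofR k (h s)) (fun=> 0).
  move=> mh hf.
  have hin : in_Lalpha alpha mu (fun s => ofR k (h s)).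
    split; first exact: scalar_measurable_ofR.
    have /in_LalphaP[_ ff] := fi.
    apply: le_lt_trans ff; apply: Lalpha_mass_le fi.1 _ => //.
      exact: scalar_measurable_ofR.
    by move=> s; have /andP[h0 hs] := hf s; rewrite modulus_ofR ger0_norm.
  apply/zero_integralP => //; apply: approximable_nonneg => // s.
  by case/andP: (hf s).
have signed (h : S -> R) : measurable_fun [set: S] h ->
    (forall s, `|h s| <= modulus (f s)) ->
    is_stochastic_integral alpha mu P zero_measure (fun s => ofR k (h s)) (fun=> 0).
  move=> mh hf.
  have m1 : measurable_fun [set: S] (fun s => Num.max (h s) 0).
    by apply: measurable_maxr => //; exact: measurable_cst.
  have m2 : measurable_fun [set: S] (fun s => Num.max (- h s) 0).
    by apply: measurable_maxr; [exact: measurable_funN|exact: measurable_cst].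
  have i1 := part _ m1; have i2 := part _ m2.
  have /i1 {}i1 : forall s, 0 <= Num.max (h s) 0 <= modulus (f s).
    move=> s; rewrite le_max lexx orbT ge_max modulus_ge0 andbT.
    by rewrite (le_trans (ler_norm _) (hf s)).
  have /i2 {}i2 : forall s, 0 <= Num.max (- h s) 0 <= modulus (f s).
    move=> s; rewrite le_max lexx orbT ge_max modulus_ge0 andbT.
    by rewrite (le_trans (ler_norm _))// normrN.
  have := stochastic_integralB alpha_gt0 alpha_lt2 mzero i1 i2.
  rewrite subrr.
  rewrite (_ : (fun s => ofR k (Num.max (h s) 0) - _) = fun s => ofR k (h s))//.
  apply/funext => s; apply/eqP; rewrite subr_eq -ofRD; apply/eqP; congr ofR.
  have [h0|h0] := leP 0 (h s).
  - by rewrite max_r ?addr0// oppr_le0.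
  - by rewrite max_l ?addrN// oppr_ge0 ltW.
have ir := signed _ mr (fun s => re_le_modulus (f s)).
have ii := signed _ mi (fun s => im_le_modulus (f s)).
have := stochastic_integralD alpha_gt0 alpha_lt2 mzero ir
  (stochastic_integralZ alpha_gt0 alpha_lt2 mzero (dual 0 (-1)) ii).
rewrite mulr0 addr0; under eq_fun do rewrite -scalar_split.
by move=> H; apply/zero_integralP.
Qed.

End kernel_approximation.

(** * Completeness for convergence in probability *)

Section completeness.
Context {R : realType} {k : scalar_kind} d (T : measurableType d)
  (P : probability T R).
Notation K := (scalarType R k).

Let delta (j : nat) : R := (2 ^ j.+1)%:R^-1.

Let delta_gt0 j : 0 < delta j.
Proof. by rewrite invr_gt0 ltr0n expn_gt0. Qed.

Let deltaS j : delta j.+1 *+ 2 = delta j.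
Proof.
rewrite /delta (expnS 2 j.+1) natrM invfM mulr2n.
by set x := (2 ^ j.+1)%:R^-1; lra.
Qed.

Let cvg_delta : delta j @[j --> \oo] --> 0.
Proof.
have h : `|2^-1| < 1 :> R by rewrite ger0_norm// invf_lt1// ltr1n.
rewrite (_ : delta = geometric 2^-1 2^-1); first exact: cvg_geometric.
by apply/funext => j; rewrite /geometric/= /delta natrX exprS invfM exprVn.
Qed.

(** As [delta j] is twice [delta j.+1], from [n] on [v - 2 delta] increases and [v + 2 delta]
    decreases; the former is therefore bounded and converges. *)
Lemma cvg_geometric_increments (v : nat -> R) n :
  (forall j, (n <= j)%N -> `|v j - v j.+1| < delta j) -> cvgn v.
Proof.
move=> vd; pose p j := v (n + j)%N - delta (n + j) *+ 2.
have vd1 j : `|v (n + j)%N - v (n + j).+1| < delta (n + j) by apply: vd; rewrite leq_addr.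
have pS j : p j <= p j.+1.
  have := vd1 j; rewrite ltr_norml => /andP[h1 h2].
  rewrite /p addnS deltaS mulr2n; lra.
have qS j : v (n + j.+1)%N + delta (n + j.+1) *+ 2 <= v (n + j)%N + delta (n + j) *+ 2.
  have := vd1 j; rewrite ltr_norml => /andP[h1 h2].
  rewrite addnS deltaS mulr2n; lra.
have qle j : v (n + j)%N + delta (n + j) *+ 2 <= v (n + 0)%N + delta (n + 0) *+ 2.
  by elim: j => [//|j IHj]; exact: le_trans (qS j) IHj.
have cp : cvgn p.
  apply: nondecreasing_is_cvgn.
    by apply/nondecreasing_seqP => j; exact: pS.
  exists (v (n + 0)%N + delta (n + 0) *+ 2) => _ [j _ <-].
  apply: le_trans (qle j); rewrite /p; have := delta_gt0 (n + j); rewrite mulr2n; lra.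
have cd : delta (n + j) *+ 2 @[j --> \oo] --> (0 *+ 2 : R).
  rewrite (_ : (fun j => _) = fun j => 2 * delta (n + j)); last first.
    by apply/funext => j; rewrite mulr_natl.
  rewrite mul0rn -(mulr0 2); apply: cvgMr.
  by have := cvg_delta; rewrite -(cvg_shiftn n); under eq_fun do rewrite addnC.
have : cvgn (fun j => v (j + n)%N).
  rewrite (_ : (fun j => _) = fun j => p j + delta (n + j) *+ 2).
    by apply: is_cvgD => //; apply: (cvgP (0 *+ 2)).
  by apply/funext => j; rewrite /p subrK addnC.
by move=> /cvg_ex[l /= h]; apply/cvg_ex; exists l; rewrite -(cvg_shiftn n).
Qed.

Lemma ae_cvg_in_probability (Y_ : nat -> T -> K) (Z : T -> K) :
  (forall n, scalar_measurable (Y_ n)) -> scalar_measurable Z ->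
  {ae P, forall w, modulus (Y_ n w - Z w) @[n --> \oo] --> (0 : R)} ->
  cvg_in_probability P Y_ Z.
Proof.
move=> mY mZ YZ e e0.
pose A n := [set w | e <= modulus (Y_ n w - Z w)].
have mA n : measurable (A n) by apply: measurable_modulus_ge; exact: scalar_measurableB.
have mi n : measurable_fun [set: T] (fun w => (\1_(A n) w : R)%:E).
  by apply/measurable_EFinP; exact: measurable_indic.
have [] := @dominated_convergence _ _ _ P setT measurableT
  (fun n w => (\1_(A n) w : R)%:E) (cst 0%E) (cst 1%:E) mi (measurable_cst _).
- apply: filterS YZ => w YZ _ /=; apply: cvg_near_cst.
  move/cvgrPdist_lt : YZ => /(_ e e0); apply: filterS => n.
  rewrite sub0r normrN ger0_norm ?modulus_ge0// => h.
  by rewrite indicE memNset//; rewrite /A/=; apply/negP; rewrite -ltNge.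
- exact: (bounded_measurable_integrable P (bounded_measurable_cst _ 1)).
- apply: aeW => w n _; rewrite /= indicE.
  by case: (w \in A n); rewrite ?normr1 ?normr0 lee_fin.
move=> _ _; rewrite integral0.
rewrite (_ : [sequence _]_n = fun n => P (A n))//; apply/funext => n /=.
by rewrite integral_indic// setIT.
Qed.

(** Along a sparse subsequence the events [F j] of large increments have summable probabilities, so
    by Borel-Cantelli almost every path has eventually geometric increments. A subsequence suffices,
    since the approximating kernels can be thinned out in the same way. *)
Lemma cauchy_in_probability (Y_ : nat -> T -> K) :
  (forall n, scalar_measurable (Y_ n)) ->
  (forall e eta : R, 0 < e -> 0 < eta -> exists N, forall n m,
     (N <= n)%N -> (N <= m)%N ->
     (P [set w | (e <= modulus (Y_ n w - Y_ m w))%R] <= eta%:E)%E) ->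
  exists2 u : nat -> nat, (forall n, (n <= u n)%N) &
    exists2 Z : T -> K, scalar_measurable Z &
      cvg_in_probability P (fun n => Y_ (u n)) Z.
Proof.
move=> mY cY.
have /choice[N HN] j := cY _ _ (delta_gt0 j) (delta_gt0 j).
(* The sum makes [u] nondecreasing and at least [N j]; the term [j] makes it tend to infinity. *)
pose u j := (\sum_(i < j.+1) N i + j)%N.
have uN j : (N j <= u j)%N by rewrite /u big_ord_recr/= -addnA addnCA leq_addr.
have uS j : (u j <= u j.+1)%N.
  by rewrite /u [in leqRHS]big_ord_recr/= -addnA leq_add2l addnS -addSn leq_addl.
exists u => [n|]; first exact: leq_addl.
pose V j := Y_ (u j).
have mV j : scalar_measurable (V j) by exact: mY.
pose F j := [set w | delta j <= modulus (V j w - V j.+1 w)].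
have mF j : measurable (F j) by apply: measurable_modulus_ge; exact: scalar_measurableB.
have PF j : (P (F j) <= (delta j)%:E)%E.
  by apply: HN; [exact: uN|exact: leq_trans (uN j) (uS j)].
have limF : P (lim_sup_set F) = 0%E.
  apply: lim_sup_set_cvg0 => //.
  apply: (@le_lt_trans _ _ (\sum_(0 <= i <oo) (1 / (2 ^ i.+1)%:R : R)%:E)%E).
    by apply: lee_nneseries => j _; rewrite ?measure_ge0// mul1r; exact: PF.
  by rewrite (le_lt_trans (epsilon_trick0 xpredT ler01))// ltry.
(* The upper limit is measurable on the whole space and is the limit wherever the path converges;
   [fine] supplies a value where it is infinite. *)
pose zr w := fine (limn_esup (fun j => (re (V j w))%:E)).
pose zi w := fine (limn_esup (fun j => (im (V j w))%:E)).
have mzr : measurable_fun [set: T] zr.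
  apply: (measurableT_comp (fine_measurable measurableT)).
  apply: measurable_fun_limn_esup => j; apply/measurable_EFinP.
  by have /scalar_measurableP[] := mV j.
have mzi : measurable_fun [set: T] zi.
  apply: (measurableT_comp (fine_measurable measurableT)).
  apply: measurable_fun_limn_esup => j; apply/measurable_EFinP.
  by have /scalar_measurableP[] := mV j.
pose Z w : K := ofR k (zr w) + dual 0 (-1) * ofR k (zi w).
have mZ : scalar_measurable Z.
  apply: scalar_measurableD; first exact: scalar_measurable_ofR.
  by apply: scalar_measurableZ; exact: scalar_measurable_ofR.
exists Z => //; apply: ae_cvg_in_probability => //.
exists (lim_sup_set F); split => //.
  by apply: bigcap_measurable => // n _; exact: bigcup_measurable.
move=> w /=; apply: contra_notP => nw.
have [n Hn] : exists n, forall j, (n <= j)%N -> modulus (V j w - V j.+1 w) < delta j.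
  move: nw; rewrite /lim_sup_set => /existsNP[n /not_implyP[_ h]].
  exists n => j nj; rewrite ltNge; apply/negP => dj; apply: h; by exists j.
have cr : cvgn (fun j => re (V j w)).
  apply: (@cvg_geometric_increments _ n) => j nj.
  by rewrite -reN -reD (le_lt_trans (re_le_modulus _))// Hn.
have ci : cvgn (fun j => im (V j w)).
  apply: (@cvg_geometric_increments _ n) => j nj.
  by rewrite -imN -imD (le_lt_trans (im_le_modulus _))// Hn.
have zE (v : nat -> R) : cvgn v -> v j @[j --> \oo] --> fine (limn_esup (fun j => (v j)%:E)).
  move=> cv; have cvE : (v j)%:E @[j --> \oo] --> (limn v)%:E.
    by apply: cvg_EFin => //; exact: nearW.
  by rewrite (cvg_limn_einf_sup cvE).2.
have crz := zE _ cr; have ciz := zE _ ci.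
rewrite -/(zr w) in crz; rewrite -/(zi w) in ciz.
pose D : K := dual 0 (-1).
apply: (@squeeze_cvgr _ _ _ _ (fun=> 0)
  (fun j => `|re (V j w) - zr w| + modulus D * `|im (V j w) - zi w|)).
- apply: nearW => j; rewrite modulus_ge0/=.
  have -> : V j w - Z w = ofR k (re (V j w) - zr w) + D * ofR k (im (V j w) - zi w).
    rewrite [in LHS](scalar_split (V j w)) /Z.
    have ofRB (a b : R) : ofR k (a - b) = ofR k a - ofR k b.
      by apply/eqP; rewrite eq_sym subr_eq -ofRD subrK.
    by rewrite !ofRB /D; ring.
  by rewrite (le_trans (modulusD _ _))// modulusM !modulus_ofR.
- exact: cvg_cst.
- rewrite -(addr0 0) -{2}(mulr0 (modulus D)); apply: cvgD; last apply: cvgMr.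
  + by rewrite -(normr0 R); apply: cvg_norm; rewrite -(subrr (zr w)); apply: cvgB => //; exact: cvg_cst.
  + by rewrite -(normr0 R); apply: cvg_norm; rewrite -(subrr (zi w)); apply: cvgB => //; exact: cvg_cst.
Qed.

End completeness.

Section existence.
Context {R : realType} {k : scalar_kind} (alpha : R).
Hypothesis alpha_gt0 : 0 < alpha.
Hypothesis alpha_lt2 : alpha < 2.
Context d (S : measurableType d) (mu : {measure set S -> \bar R}).
Context d' (T : measurableType d') (P : probability T R).
Notation K := (scalarType R k).
Variable M : set S -> T -> K.
Hypothesis hM : SaS_random_measure alpha mu P M.

Lemma stochastic_integral_exists (f : S -> K) : in_Lalpha alpha mu f ->
  exists Y, is_stochastic_integral alpha mu P M f Y.
Proof.
move=> fi; have [m [c [A [fA cf]]]] := in_Lalpha_approximable alpha_gt0 alpha_lt2 P fi.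
have mM := random_measure_measurable hM.
pose s n := simple_kernel (m n) (c n) (A n).
pose Y_ n w := \sum_(i < m n) c n i * M (A n i) w.
have sY n : is_stochastic_integral alpha mu P M (s n) (Y_ n).
  apply: (stochastic_integral_sum alpha_gt0 alpha_lt2 hM) => i.
  apply: (stochastic_integralZ alpha_gt0 alpha_lt2 mM).
  exact: (stochastic_integral_indic alpha_gt0 hM (fA n i)).
have sin n : in_Lalpha alpha mu (s n) by case: (sY n).
have mY n : scalar_measurable (Y_ n) by case: (sY n).
have [u un [Z mZ cZ]] : exists2 u : nat -> nat, (forall n, (n <= u n)%N) &
    exists2 Z : T -> K, scalar_measurable Z &
      cvg_in_probability P (fun n => Y_ (u n)) Z.
  apply: cauchy_in_probability => // e eta e0 eta0.
  have [del del0 H] := stochastic_integral_tail alpha_gt0 alpha_lt2 hM e0 eta0.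
  (* The inequality for sums multiplies each of the two distances by 4, and [4 * (del / 8)] is half
     of [del]. *)
  have /fine_cvgP[nf /cvgrPdist_le /(_ (del / 8))] := cf.
  have del80 : 0 < del / 8 by rewrite divr_gt0.
  move=> /(_ del80) cd.
  have [N _ HN] : \forall n \near \oo, (Lalpha_dist alpha mu (s n) f <= (del / 8)%:E)%E.
    apply: filterS2 nf cd => n nf; rewrite sub0r normrN => h.
    by rewrite -(fineK nf) lee_fin (le_trans (ler_norm _) h).
  exists N => p q Np Nq.
  apply: (H _ _ (stochastic_integralB alpha_gt0 alpha_lt2 mM (sY p) (sY q))).
  have mp := scalar_measurableB (sin p).1 fi.1.
  have mq := scalar_measurableB fi.1 (sin q).1.
  rewrite (_ : (fun t => s p t - s q t) = fun t => (s p t - f t) + (f t - s q t)).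
    2: by apply/funext => t; rewrite addrA subrK.
  apply: (le_trans (Lalpha_massD alpha_gt0 alpha_lt2 mu mp mq)).
  have -> : Lalpha_mass alpha mu (fun t => f t - s q t) = Lalpha_dist alpha mu (s q) f.
    by rewrite Lalpha_distE; apply: eq_integral => t _; rewrite modulusB.
  rewrite -(Lalpha_distE alpha mu (s p) f).
  apply: (@le_trans _ _ (4%:E * (del / 8)%:E + 4%:E * (del / 8)%:E)%E).
    by apply: leeD; apply: lee_wpmul2l; rewrite ?lee_fin//; [exact: (HN p)|exact: (HN q)].
  by rewrite -!EFinM -EFinD lee_fin; lra.
exists Z; split; [exact: fi|exact: mZ|].
exists (m \o u), (c \o u), (A \o u); split; [by move=> n i; exact: fA| |exact: cZ].
- apply: (@cvg_comp _ _ _ u (fun n => Lalpha_dist alpha mu (s n) f) \oo _ _ _ cf).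
  by apply/cvgnyPge => N; near=> n; rewrite (leq_trans _ (un n))//; near: n; exact: nbhs_infty_ge.
Unshelve. all: by end_near. Qed.

End existence.

(** * A maximal inequality *)

Section maximal_inequality.
Context {R : realType} {k : scalar_kind} (alpha : R).
Hypothesis alpha_gt0 : 0 < alpha.
Hypothesis alpha_lt2 : alpha < 2.
Context d (S : measurableType d) (mu : {measure set S -> \bar R}).
Context d' (T : measurableType d') (P : probability T R).
Notation K := (scalarType R k).
Variable M : set S -> T -> K.
Hypothesis hM : SaS_random_measure alpha mu P M.
Notation integral_of := (is_stochastic_integral alpha mu P M).

Lemma linear_combination_integral n (f : 'I_n -> S -> K) (Y : 'I_n -> T -> K)
    (theta : 'I_n -> K) : (forall i, integral_of (f i) (Y i)) ->
  integral_of (fun s => \sum_i theta i * f i s) (fun w => \sum_i theta i * Y i w).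
Proof.
move=> fY; apply: (stochastic_integral_sum alpha_gt0 alpha_lt2 hM) => i.
exact: (stochastic_integralZ alpha_gt0 alpha_lt2 (random_measure_measurable hM)).
Qed.

(** The law of a linear combination of integrals depends on its kernel only through the mass, hence
    through the modulus; [joint_law_eq] passes from linear combinations to the joint law. *)
Lemma integral_rectangle_law n (f f' : 'I_n -> S -> K) (Y Y' : 'I_n -> T -> K)
    (C : 'I_n -> set (plane R)) :
  (forall i, integral_of (f i) (Y i)) -> (forall i, integral_of (f' i) (Y' i)) ->
  (forall (theta : 'I_n -> K) s, modulus (\sum_i theta i * f i s) =
                                 modulus (\sum_i theta i * f' i s)) ->
  (forall i, measurable (C i)) ->
  P (\big[setI/setT]_(i < n) [set w | C i (coords (Y i w))]) =
  P (\big[setI/setT]_(i < n) [set w | C i (coords (Y' i w))]).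
Proof.
move=> fY fY' ff' mC.
have mY i : scalar_measurable (Y i) by case: (fY i).
have mY' i : scalar_measurable (Y' i) by case: (fY' i).
have EY (theta : 'I_n -> K) b : \int[P]_w cos (re (\sum_i theta i * Y i w) + b) =
    \int[P]_w cos (re (\sum_i theta i * Y' i w) + b).
  have s1 := stochastic_integral_scale alpha_gt0 alpha_lt2 hM (linear_combination_integral theta fY).
  have s2 := stochastic_integral_scale alpha_gt0 alpha_lt2 hM (linear_combination_integral theta fY').
  have := has_scale_cos 1 b s1; under eq_Rintegral do rewrite mul1r; move=> ->.
  have := has_scale_cos 1 b s2; under eq_Rintegral do rewrite mul1r; move=> ->.
  by rewrite (Lalpha_mass_eq alpha mu (ff' theta)).
have bC i : bounded_measurable (\1_(C i) : plane R -> R) by exact: bounded_measurable_indic.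
have E (Z : 'I_n -> T -> K) : (forall i, scalar_measurable (Z i)) ->
    P (\big[setI/setT]_(i < n) [set w | C i (coords (Z i w))]) =
    (\int[P]_w (\prod_i (\1_(C i) (coords (Z i w)) : R)))%:E.
  move=> mZ; have mA i : measurable [set w | C i (coords (Z i w))].
    by apply: measurable_coords.
  have mI : measurable (\big[setI/setT]_(i < n) [set w | C i (coords (Z i w))]).
    by apply: bigsetI_measurable => i _; exact: mA.
  rewrite -[LHS]fineK ?fin_num_measure//; congr EFin.
  rewrite -(Rintegral_indic P mI); apply: eq_Rintegral => w _.
  by rewrite -prod_indic.
rewrite (E _ mY) (E _ mY'); congr EFin.
exact: (joint_law_eq mY mY' EY (h := fun i => \1_(C i)) bC).
Qed.

Variables (F : S -> K) (E : nat -> set S) (D : nat -> T -> K).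
Hypothesis E_decr : forall m n, (m <= n)%N -> E n `<=` E m.
Hypothesis hD : forall n, integral_of (fun s => F s * \1_(E n) s) (D n).

Let mD n : scalar_measurable (D n). Proof. by case: (hD n). Qed.

Section one_level.
Variable e : R.

Let B j := [set w | e <= modulus (D j w)].

Let mB j : measurable (B j). Proof. exact: measurable_modulus_ge. Qed.

Section reflection.
Variables (m N : nat).

(** The last exceedance replaces the usual first passage because the sets [E] decrease: the
    integrals [D (m + i)] with [i >= j] involve only [E (m + j)] and are unaffected by a change of
    sign on the rest of [E m]. *)
Let last_exceedance j := B (m + j) `&` \bigcap_(i in [set i | (j < i < N)%N]) ~` B (m + i).

Let measurable_last j : measurable (last_exceedance j).
Proof.
apply: measurableI => //; apply: bigcap_measurableType => i _.
exact: measurableC.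
Qed.

(* Changing the sign of the integral over [E m `\` E (m + j)] preserves the joint
   law of the family and replaces [D m] by [2 * D (m + j) - D m]. *)
Let reflection j : (j < N)%N ->
  P (last_exceedance j `&` B m) =
  P (last_exceedance j `&`
     [set w | e <= modulus (D (m + j)%N w + D (m + j)%N w - D m w)]).
Proof.
move=> jN.
(* The coordinates [j <= i < N] carry [D (m + i)] and the coordinate [N] carries [D m] or its
   reflection. Those below [j] carry the zero kernel and are left unconstrained by [C]. *)
pose f (r : bool) (i : 'I_N.+1) : S -> K :=
  if (i < N)%N then (if (j <= i)%N then fun s => F s * \1_(E (m + i)) s else fun=> 0)
  else if r then fun s => (F s * \1_(E (m + j)) s + F s * \1_(E (m + j)) s) - F s * \1_(E m) s
  else fun s => F s * \1_(E m) s.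
pose Y (r : bool) (i : 'I_N.+1) : T -> K :=
  if (i < N)%N then (if (j <= i)%N then D (m + i) else fun=> 0)
  else if r then fun w => (D (m + j)%N w + D (m + j)%N w) - D m w else D m.
pose big := [set z : plane R | e <= Num.sqrt (z.1 ^+ 2 + z.2 ^+ 2)].
have mbig : measurable big by exact: measurable_large.
have bigE (z : K) : big (coords z) = (e <= modulus z)%R by rewrite modulus_coords.
pose C (i : 'I_N.+1) : set (plane R) :=
  if (i < N)%N then (if (i < j)%N then setT else if i == j :> nat then big else ~` big)
  else big.
have mC i : measurable (C i).
  rewrite /C; case: ifP => // _; case: ifP => // _; case: ifP => // _.
  exact: measurableC.
have fY r i : integral_of (f r i) (Y r i).
  have mM := random_measure_measurable hM.
  rewrite /f /Y; case: ifP => _; first case: ifP => _.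
  - exact: hD.
  - exact: (stochastic_integral0 alpha_gt0 alpha_lt2 hM).
  - case: r; last exact: hD.
    apply: (stochastic_integralB alpha_gt0 alpha_lt2 mM); last exact: hD.
    by apply: (stochastic_integralD alpha_gt0 alpha_lt2 mM); exact: hD.
have ff (theta : 'I_N.+1 -> K) s : modulus (\sum_i theta i * f false i s) =
    modulus (\sum_i theta i * f true i s).
  rewrite !big_ord_recr/=.
  have fE (i : 'I_N) r : f r (widen_ord (leqnSn N) i) s =
      if (j <= i)%N then F s * \1_(E (m + i)) s else 0.
    by rewrite /f/= ltn_ord; case: ifP.
  rewrite (eq_bigr (fun i : 'I_N => theta (widen_ord (leqnSn N) i) *
    (if (j <= i)%N then F s * \1_(E (m + i)) s else 0))); last by move=> i _; rewrite fE.
  rewrite [in RHS](eq_bigr (fun i : 'I_N => theta (widen_ord (leqnSn N) i) *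
    (if (j <= i)%N then F s * \1_(E (m + i)) s else 0))); last by move=> i _; rewrite fE.
  rewrite /f/= ltnn.
  (* On [E (m + j)] the reflection changes nothing; off it all the other kernels vanish, and only
     the sign of the last term changes. *)
  have [Es|Es] := pselect (E (m + j) s).
    have Ems : E m s by apply: E_decr Es; exact: leq_addr.
    by rewrite !indicE !mem_set// mulr1 addrK.
  rewrite big1 => [|i _]; last first.
    case: ifP => ji; last by rewrite mulr0.
    rewrite indicE memNset ?mulr0// => Eis; apply: Es; apply: E_decr Eis.
    by rewrite leq_add2l.
  rewrite !add0r (_ : \1_(E (m + j)) s = 0); last by rewrite indicE memNset.
  by rewrite mulr0 addr0 sub0r mulrN modulusN.
have setE r : \big[setI/setT]_(i < N.+1) [set w | C i (coords (Y r i w))] =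
    last_exceedance j `&` [set w | e <= modulus (Y r ord_max w)].
  apply/seteqP; split => w; rewrite -(bigcap_seq _ (fun i => [set w | C i (coords (Y r i w))])).
  - move=> h; have {}h i : C i (coords (Y r i w)) by apply: h; rewrite /= mem_index_enum.
    split; last first.
      by have := h ord_max; rewrite /C/= ltnn bigE.
    split.
      have jN1 : (j < N.+1)%N by rewrite ltnS ltnW.
      by have := h (Ordinal jN1); rewrite /C/= jN ltnn eqxx bigE /Y/= jN leqnn.
    move=> i /= /andP[ji iN].
    have iN1 : (i < N.+1)%N by rewrite ltnS ltnW.
    have := h (Ordinal iN1); rewrite /C/= iN ltnNge (ltnW ji)/= gtn_eqF//.
    by rewrite /Y/= iN (ltnW ji) /setC/= bigE.
  - move=> [[Bj nB] hN] i _ /=; rewrite /C; case: ifP => iN; last first.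
      have -> : i = ord_max by apply/val_inj/eqP; rewrite /= eqn_leq -ltnS ltn_ord leqNgt iN.
      by rewrite bigE.
    case: ifP => [//|/negbT]; rewrite -leqNgt => ji.
    rewrite /Y iN ji; case: ifP => [/eqP ->|/negbT ij]; first by rewrite bigE.
    rewrite /setC/= bigE; apply: nB => /=.
    by rewrite iN ltn_neqAle eq_sym ij ji.
have := integral_rectangle_law (fY false) (fY true) ff mC.
by rewrite !setE /Y /= ltnn.
Qed.

(** [2 D (m + j)] is the sum of [D m] and its reflection, so when [|D (m + j)| >= e] one of the two
    has modulus at least [e]; within the last exceedance both cases have the same probability. *)
Let last_exceedance_le j : (j < N)%N ->
  (P (last_exceedance j) <= 2%:E * P (last_exceedance j `&` B m))%E.
Proof.
move=> jN; pose B' := [set w | e <= modulus (D (m + j)%N w + D (m + j)%N w - D m w)].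
have mB' : measurable B'.
  apply: measurable_modulus_ge; apply: scalar_measurableB => //.
  exact: scalar_measurableD.
have m1 : measurable (last_exceedance j `&` B m) by exact: measurableI.
have m2 : measurable (last_exceedance j `&` B') by exact: measurableI.
apply: (@le_trans _ _ (P ((last_exceedance j `&` B m) `|` (last_exceedance j `&` B')))).
  apply: le_measure; rewrite ?inE//; first exact: measurableU.
  rewrite -setIUr => w Lw; split => //; have [Bj _] := Lw.
  rewrite /B /B' /=; apply/orP; apply: contraTT Bj; rewrite negb_or -!ltNge => /andP[h1 h2].
  have := modulusD (D m w) (D (m + j)%N w + D (m + j)%N w - D m w).
  by rewrite [X in modulus X]addrC subrK modulus_double; lra.
have refl : P (last_exceedance j `&` B m) = P (last_exceedance j `&` B') := reflection jN.
have mU2 : (P ((last_exceedance j `&` B m) `|` (last_exceedance j `&` B')) <=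
    P (last_exceedance j `&` B m) + P (last_exceedance j `&` B'))%E := measureU2 P m1 m2.
rewrite -refl in mU2; apply: (le_trans mU2).
by rewrite mule_natl mule2n.
Qed.

(** The last exceedances are disjoint and cover the union, and their intersections with [B m] are
    disjoint parts of [B m]: summing over [j] costs only one factor 2. *)
Lemma levy_inequality_fin :
  (P (\big[setU/set0]_(j < N) B (m + j)) <= 2%:E * P (B m))%E.
Proof.
pose L j := if (j < N)%N then last_exceedance j else set0.
have mL j : measurable (L j) by rewrite /L; case: ifP.
have LE (i : 'I_N) : L i = last_exceedance i by rewrite /L ltn_ord.
have tL : trivIset setT L.
  apply/trivIsetP.
  suff H i j : (i < j)%N -> L i `&` L j = set0.
    by move=> i j _ _; rewrite neq_ltn => /orP[/H//|/H]; rewrite setIC.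
  rewrite /L => ij; case: (ltnP j N) => jN; last by rewrite setI0.
  rewrite (ltn_trans ij jN); apply/seteqP; split => // w [[_ h] [Bj _]].
  by apply: (h j) Bj; rewrite /= ij jN.
have UL : \big[setU/set0]_(j < N) B (m + j) `<=` \big[setU/set0]_(j < N) L j.
  rewrite -(bigcup_mkord N (fun j => B (m + j))) -(bigcup_mkord N L) => w [j0 /= j0N Bj0].
  have ex : exists i, (i < N)%N && `[< B (m + i) w >].
    by exists j0; rewrite j0N; apply/asboolP.
  have bnd i : (i < N)%N && `[< B (m + i) w >] -> (i <= N)%N.
    by case/andP => /ltnW.
  case: (ex_maxnP ex bnd) => i /andP[iN /asboolP Bi] imax.
  exists i => //=; rewrite /L iN; split => // l /= /andP[il lN] Bl.
  have := imax l; rewrite lN/= => /(_ (introT (asboolP _) Bl)).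
  by rewrite leqNgt il.
have mLB j : measurable (L j `&` B m) by exact: measurableI.
have tLB : trivIset setT (fun j => L j `&` B m).
  apply/trivIsetP => i j _ _ ij; rewrite setIACA.
  by move/trivIsetP : tL => ->//; rewrite set0I.
have mU (G : nat -> set T) : (forall j, measurable (G j)) ->
    measurable (\big[setU/set0]_(j < N) G j).
  by move=> mG; apply: bigsetU_measurable => j _.
apply: (@le_trans _ _ (P (\big[setU/set0]_(j < N) L j))).
  by apply: le_measure; rewrite ?inE; [exact: (mU (fun j => B (m + j)))|exact: mU|].
apply: (le_trans (Boole_inequality P (fun i _ => mL i))).
apply: (@le_trans _ _ (\sum_(j < N) 2%:E * P (L j `&` B m))%E).
  by apply: lee_sum => j _; rewrite LE; exact: last_exceedance_le.
rewrite -ge0_sume_distrr//; apply: lee_wpmul2l => //.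
have tLBN : trivIset [set k0 | (k0 < N)%N] (fun j => L j `&` B m) by exact: sub_trivIset tLB.
have <- : P (\big[setU/set0]_(j < N) (L j `&` B m)) = (\sum_(j < N) P (L j `&` B m))%E.
  apply: (measure_semi_additive_ord_I P (F := fun j => L j `&` B m)) => //.
  exact: (mU (fun j => L j `&` B m)).
apply: le_measure; rewrite ?inE; [exact: (mU (fun j => L j `&` B m))|exact: mB|].
by rewrite -(bigcup_mkord N (fun j => L j `&` B m)) => w [j _ []].
Qed.

End reflection.

Lemma levy_inequality m : (P (\bigcup_j B (m + j)) <= 2%:E * P (B m))%E.
Proof.
have mU N : measurable (\big[setU/set0]_(j < N) B (m + j)).
  by apply: bigsetU_measurable => j _; exact: mB.
have cU : P (\big[setU/set0]_(j < N) B (m + j)) @[N --> \oo] --> P (\bigcup_j B (m + j)).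
  rewrite -(cvg_shiftS (fun N => P (\big[setU/set0]_(j < N) B (m + j)))).
  rewrite -(bigcup_bigsetU_bigcup (fun j => B (m + j))).
  apply: (nondecreasing_cvg_mu (mu := P) (F := fun N => \big[setU/set0]_(j < N.+1) B (m + j))).
  - by move=> N; exact: mU.
  - by apply: bigcup_measurable => N _; exact: mU.
  - move=> p q pq; apply/subsetPset.
    rewrite -(bigcup_mkord p.+1 (fun j => B (m + j))) -(bigcup_mkord q.+1 (fun j => B (m + j))).
    by move=> w [j /= jp Bj]; exists j => //=; exact: leq_trans jp _.
rewrite -(cvg_lim _ cU)//; apply: lime_le; first by apply/cvg_ex; eexists; exact: cU.
by apply: nearW => N; exact: levy_inequality_fin.
Qed.

End one_level.

(** For large [m] the tail of [D m] is small because the mass is. Levy's inequality extends the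
    bound, up to a factor 2, to all later terms at once, so infinitely many exceedances of a level
    have probability 0. *)
Lemma stochastic_integral_ae_cvg0 :
  Lalpha_mass alpha mu (fun s => F s * \1_(E n) s) @[n --> \oo] --> 0%E ->
  {ae P, forall w, modulus (D n w) @[n --> \oo] --> (0 : R)}.
Proof.
move=> cm.
pose B j n := [set w | j.+1%:R^-1 <= modulus (D n w)].
have mB j n : measurable (B j n) by exact: measurable_modulus_ge.
pose Z j := \bigcap_m \bigcup_i B j (m + i)%N.
have mU j m : measurable (\bigcup_i B j (m + i)%N) by apply: bigcup_measurable => i _; exact: mB.
have mZ j : measurable (Z j) by apply: bigcap_measurableType => m _; exact: mU.
have PZ j : P (Z j) = 0%E.
  apply/eqP; rewrite eq_le measure_ge0 andbT; apply/lee_addgt0Pr => eta eta0.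
  rewrite add0e.
  have j0 : 0 < j.+1%:R^-1 :> R by rewrite invr_gt0.
  have eta20 : 0 < eta / 2 by rewrite divr_gt0.
  have [del del0 H] := stochastic_integral_tail alpha_gt0 alpha_lt2 hM j0 eta20.
  have /fine_cvgP[nf /cvgrPdist_le /(_ _ del0)] := cm.
  move=> cd; have [m _ Hm] : \forall n \near \oo, (Lalpha_mass alpha mu (fun s => (F s * \1_(E n) s)%R) <= del%:E)%E.
    apply: filterS2 nf cd => n nf; rewrite sub0r normrN => h.
    by rewrite -(fineK nf) lee_fin (le_trans (ler_norm _) h).
  have Bm := H _ _ (hD m) (Hm m (leqnn m)).
  apply: (@le_trans _ _ (P (\bigcup_i B j (m + i)%N))).
    by apply: le_measure; rewrite ?inE; [exact: mZ|exact: mU|move=> w; apply].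
  apply: le_trans (levy_inequality _ m) _.
  apply: (@le_trans _ _ (2%:E * (eta / 2)%:E)%E); first exact: lee_wpmul2l.
  by rewrite -EFinM lee_fin; lra.
exists (\bigcup_j Z j); split.
- by apply: bigcup_measurable => j _; exact: mZ.
- apply/eqP; rewrite eq_le measure_ge0 andbT.
  apply: le_trans (measure_sigma_subadditive P mZ _ (fun w h => h)) _.
    by apply: bigcup_measurable => j _; exact: mZ.
  by rewrite eseries0// => j _ _; exact: PZ.
- move=> w /=; apply: contra_notP => nZ.
  apply/cvgrPdist_lt => e e0.
  have [j je] : exists j, j.+1%:R^-1 < e :> R.
    have [j _ Hj] := near_infty_natSinv_lt (PosNum e0); by exists j; exact: (Hj j (leqnn j)).
  have [m nB] : exists m, ~ (\bigcup_i B j (m + i)%N) w.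
    apply/existsNP => h; apply: nZ; exists j => // m _; exact: h.
  exists m => // n /= mn; rewrite sub0r normrN ger0_norm ?modulus_ge0//.
  apply: lt_trans je; rewrite ltNge; apply/negP => h; apply: nB.
  by exists (n - m)%N => //; rewrite subnKC.
Qed.

End maximal_inequality.

(** * Images of random measures *)

Section transfer.
Context {R : realType} {k : scalar_kind} (alpha : R).
Hypothesis alpha_gt0 : 0 < alpha.
Hypothesis alpha_lt2 : alpha < 2.
Context d (S : measurableType d) (mu : {measure set S -> \bar R}).
Context dW (W : measurableType dW) (nu : {measure set W -> \bar R}).
Context d' (T : measurableType d') (P : probability T R).
Notation K := (scalarType R k).
Variable M : set S -> T -> K.
Hypothesis hM : SaS_random_measure alpha mu P M.
Variables (psi : S -> W) (c : S -> K).
Hypothesis mpsi : measurable_fun [set: S] psi.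
Hypothesis mc : scalar_measurable c.

(* [nu] is the image under [psi] of [|c|^alpha mu], so that
   [F |-> c * (F \o psi)] embeds [L^alpha nu] isometrically in [L^alpha mu]. *)
Hypothesis change : forall G : W -> \bar R, measurable_fun [set: W] G ->
  (forall x, 0 <= G x)%E ->
  (\int[nu]_x G x = \int[mu]_s (G (psi s) * (modulus (c s) `^ alpha)%:E))%E.

Definition pull (F : W -> K) (s : S) : K := c s * F (psi s).

Lemma pull_measurable F : scalar_measurable F -> scalar_measurable (pull F).
Proof.
by move=> mF; apply: scalar_measurableM => //; exact: (measurableT_comp mF mpsi).
Qed.

Lemma pull_mass F : scalar_measurable F ->
  Lalpha_mass alpha mu (pull F) = Lalpha_mass alpha nu F.
Proof.
move=> mF; rewrite [RHS](change (modulus_powR_emeasurable alpha mF)).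
  by apply: eq_integral => s _; rewrite modulus_powRM mulrC EFinM.
by move=> x; rewrite lee_fin powR_ge0.
Qed.

Lemma pull_in_Lalpha F : scalar_measurable F ->
  in_Lalpha alpha nu F <-> in_Lalpha alpha mu (pull F).
Proof.
move=> mF; rewrite !in_LalphaP (pull_mass mF); split => -[_ h]; split => //.
exact: pull_measurable.
Qed.

Lemma pull_dist F G : scalar_measurable F -> scalar_measurable G ->
  Lalpha_dist alpha mu (pull F) (pull G) = Lalpha_dist alpha nu F G.
Proof.
move=> mF mG; rewrite !Lalpha_distE -(pull_mass (scalar_measurableB mF mG)).
by apply: Lalpha_mass_eq => s; rewrite /pull mulrBr.
Qed.

Lemma pull_random_measure_exists : exists N : set W -> T -> K,
  forall A, finite_set_of nu A ->
    is_stochastic_integral alpha mu P M (pull (fun x => \1_A x)) (N A).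
Proof.
suff /choice[N HN] : forall A, exists Y, finite_set_of nu A ->
    is_stochastic_integral alpha mu P M (pull (fun x => \1_A x)) Y by exists N.
move=> A.
have [fA|nA] := pselect (finite_set_of nu A); last by exists (fun=> 0).
have [Y hY] : exists Y,
    is_stochastic_integral alpha mu P M (pull (fun x => \1_A x)) Y.
  apply: (stochastic_integral_exists alpha_gt0 alpha_lt2 hM).
  by apply/pull_in_Lalpha; [exact: (in_Lalpha_indic alpha_gt0 fA).1|exact: in_Lalpha_indic].
by exists Y.
Qed.

Variable N : set W -> T -> K.
Hypothesis hN : forall A, finite_set_of nu A ->
  is_stochastic_integral alpha mu P M (pull (fun x => \1_A x)) (N A).

Let mN A : finite_set_of nu A -> scalar_measurable (N A).
Proof. by case/hN. Qed.

Let simple_pull_integral n (a : 'I_n -> K) (A : 'I_n -> set W) :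
  (forall i, finite_set_of nu (A i)) ->
  is_stochastic_integral alpha mu P M (pull (fun x => \sum_i a i * \1_(A i) x))
    (fun w => \sum_i a i * N (A i) w).
Proof.
move=> fA; rewrite (_ : pull _ = fun s => \sum_i a i * pull (fun x => \1_(A i) x) s).
  by apply: (linear_combination_integral alpha_gt0 alpha_lt2 hM) => i; exact: hN.
apply/funext => s; rewrite /pull mulr_sumr; apply: eq_bigr => i _.
by rewrite mulrCA.
Qed.

Let measurable_simple n (a : 'I_n -> K) (A : 'I_n -> set W) :
  (forall i, finite_set_of nu (A i)) ->
  scalar_measurable (fun x => \sum_i a i * \1_(A i) x).
Proof.
move=> fA; apply: scalar_measurable_sum => i; apply: scalar_measurableZ.
by apply: scalar_measurable_indic; exact: (fA i).1.
Qed.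

Lemma Lalpha_mass_simple_disjoint n (a : 'I_n -> K) (A : 'I_n -> set W) :
  (forall i, finite_set_of nu (A i)) -> trivIset setT A ->
  fine (Lalpha_mass alpha nu (fun x => \sum_i a i * \1_(A i) x)) =
  \sum_i modulus (a i) `^ alpha * fine (nu (A i)).
Proof.
move=> fA tA.
have mi i : measurable_fun [set: W] (fun x => (\1_(A i) x : R)%:E).
  by apply/measurable_EFinP; apply: measurable_indic; exact: (fA i).1.
transitivity (fine (\int[nu]_x (\sum_i
    ((modulus (a i) `^ alpha)%:E * (\1_(A i) x)%:E)%E))%E).
  congr fine; apply: eq_integral => x _.
  rewrite (_ : (\sum_i _)%E = (\sum_i modulus (a i) `^ alpha * \1_(A i) x)%:E); last first.
    by rewrite -sumEFin; apply: eq_bigr => i _; rewrite EFinM.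
  congr EFin.
  have [[i Aix]|nA] := pselect (exists i, A i x).
    rewrite (bigD1 i)//= big1 ?addr0 => [|j ji]; last first.
      rewrite indicE memNset ?mulr0// => Ajx.
      by move/eqP : ji; apply; apply: (tA _ _ I I); exists x.
    rewrite [RHS](bigD1 i)//= big1 ?addr0 => [|j ji]; last first.
      rewrite indicE memNset ?mulr0// => Ajx.
      by move/eqP : ji; apply; apply: (tA _ _ I I); exists x.
    by rewrite !indicE mem_set// !mulr1.
  rewrite !big1 ?modulus_powR0// => i _; rewrite indicE memNset ?mulr0//.
    by move=> Aix; apply: nA; exists i.
  by move=> Aix; apply: nA; exists i.
rewrite (ge0_integral_sum nu measurableT
  (f := fun i x => ((modulus (a i) `^ alpha)%:E * (\1_(A i) x)%:E)%E)).
- rewrite [X in fine X](_ : _ = (\sum_i modulus (a i) `^ alpha * fine (nu (A i)))%:E)//.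
  rewrite -sumEFin; apply: eq_bigr => i _; have [ma fa] := fA i.
  rewrite (ge0_integralZl_EFin _ measurableT _ (mi i) (powR_ge0 _ _)); last first.
    by move=> x _; rewrite lee_fin indicE.
  by rewrite integral_indic// setIT EFinM fineK// ge0_fin_numE.
- move=> i; apply: emeasurable_funM; first exact: measurable_cst.
  exact: mi.
- by move=> i x _; rewrite -EFinM lee_fin mulr_ge0 ?powR_ge0// indicE.
Qed.

Let pull_scale n (a : 'I_n -> K) (A : 'I_n -> set W) :
  (forall i, finite_set_of nu (A i)) -> trivIset setT A ->
  has_scale alpha P (fun w => \sum_i a i * N (A i) w)
    (\sum_i modulus (a i) `^ alpha * fine (nu (A i))).
Proof.
move=> fA tA; rewrite -(Lalpha_mass_simple_disjoint a fA tA).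
rewrite -(pull_mass (measurable_simple a fA)).
by apply: (stochastic_integral_scale alpha_gt0 alpha_lt2 hM); exact: simple_pull_integral.
Qed.

(** The remainder [D n] is the integral of the kernel of [U] cut down to the tail union [B n]. The
    tail unions decrease to the empty set, so the mass tends to 0 and the maximal inequality gives
    almost sure convergence. *)
Let pull_additive (A : nat -> set W) :
  (forall n, finite_set_of nu (A n)) -> trivIset [set: nat] A ->
  finite_set_of nu (\bigcup_n A n) ->
  {ae P, forall w,
    (fun n => modulus (\sum_(i < n) N (A i) w - N (\bigcup_n A n) w))
      @ \oo --> (0 : R)}.
Proof.
move=> fA tA fU; set U := \bigcup_n A n.
pose B n := \bigcup_i A (n + i)%N.
have mB n : measurable (B n) by apply: bigcup_measurable => i _; exact: (fA _).1.
have BU n : B n `<=` U by move=> x [i _ ?]; exists (n + i)%N.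
have B_decr m n : (m <= n)%N -> B n `<=` B m.
  by move=> mn x [i _ Ax]; exists (n - m + i)%N => //; rewrite addnA subnKC.
have fB n : finite_set_of nu (B n).
  split => //; apply: le_lt_trans fU.2; apply: le_measure; rewrite ?inE//.
  exact: fU.1.
pose D n w := N U w - \sum_(i < n) N (A i) w.
have mM := random_measure_measurable hM.
have hD n : is_stochastic_integral alpha mu P M
    (fun s => pull (fun x => \1_U x) s * \1_(psi @^-1` B n) s) (D n).
  rewrite (_ : (fun s => _) = fun s => pull (fun x => \1_U x) s -
      \sum_(i < n) pull (fun x => \1_(A i) x) s).
    apply: (stochastic_integralB alpha_gt0 alpha_lt2 mM); first exact: hN.
    by apply: (stochastic_integral_sum alpha_gt0 alpha_lt2 hM) => i; exact: hN.
  apply/funext => s; rewrite /pull -mulr_sumr -mulrBr -mulrA; congr (_ * _).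
  set x := psi s.
  have [[i _ Aix]|nU] := pselect (U x); last first.
    rewrite (_ : \1_U x = 0); last by rewrite indicE memNset.
    rewrite mul0r big1 ?subr0// => i _; rewrite indicE memNset// => Aix.
    by apply: nU; exists i.
  have -> : \1_U x = 1 :> K by rewrite indicE mem_set//; exists i.
  rewrite mul1r.
  have N0 (j : nat) : j != i -> \1_(A j) x = 0 :> K.
    move=> ji; rewrite indicE memNset// => Ajx.
    by move/eqP : ji; apply; apply: (tA _ _ I I); exists x.
  have [ni|ni] := leqP n i.
    rewrite big1 ?subr0; last by move=> j _; apply: N0; rewrite ltn_eqF// (leq_trans (ltn_ord j)).
    by rewrite indicE mem_set//=; exists (i - n)%N => //; rewrite subnKC.
  rewrite (bigD1 (Ordinal ni))//= big1 ?addr0; last first.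
    by move=> j ji; apply: N0; apply: contra ji => /eqP ji; apply/eqP/val_inj.
  rewrite [in RHS]indicE mem_set// subrr indicE memNset// => -[j _ Ajx].
  have /(N0 _)/eqP : (n + j)%N != i by rewrite gtn_eqF// (leq_trans ni)// leq_addr.
  by rewrite indicE mem_set// oner_eq0.
have cm : Lalpha_mass alpha mu (fun s => pull (fun x => \1_U x) s * \1_(psi @^-1` B n) s)
    @[n --> \oo] --> 0%E.
  rewrite (_ : (fun n => _) = nu \o B).
    have <- : nu (\bigcap_n B n) = 0%E.
      rewrite (_ : \bigcap_n B n = set0) ?measure0//.
      apply/seteqP; split => // x Bx; have [i _ Aix] := Bx 0%N I.
      have [j _ Ajx] := Bx i.+1 I.
      have : (i.+1 + j = 0 + i)%N by apply: (tA _ _ I I); exists x.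
      by rewrite add0n addSn => /eqP; rewrite eqn_leq ltnNge leq_addr.
    apply: nonincreasing_cvg_mu => //; first exact: (fB 0%N).2.
      exact: bigcapT_measurable.
    by move=> p q pq; apply/subsetPset; exact: B_decr.
  apply/funext => n /=; rewrite -(Lalpha_mass_indic (k := k) alpha_gt0 nu (mB n)).
  rewrite -(pull_mass (scalar_measurable_indic (mB n))).
  apply: Lalpha_mass_eq => s; congr modulus; rewrite /pull -mulrA; congr (_ * _).
  rewrite !indicE /=.
  have [Bs|nBs] := pselect (B n (psi s)).
    by rewrite !mem_set ?mulr1//; apply: BU Bs.
  by rewrite [X in _ * X](_ : _ = 0) ?mulr0; rewrite memNset.
have := stochastic_integral_ae_cvg0 alpha_gt0 alpha_lt2 hM (E := fun n => psi @^-1` B n) _ hD cm.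
move=> H; have {}H := H (fun m n mn s => @B_decr m n mn (psi s)).
by apply: filterS H => w; under eq_fun do rewrite modulusB.
Qed.

Lemma pull_SaS_random_measure : SaS_random_measure alpha nu P N.
Proof.
split.
- exact: mN.
- move=> A fA theta.
  have := stochastic_integral_scale alpha_gt0 alpha_lt2 hM (hN fA).
  rewrite (pull_mass (scalar_measurable_indic fA.1)).
  by rewrite (Lalpha_mass_indic alpha_gt0 nu fA.1) => -[_ ->].
- move=> n A fA tA; apply: product_law_independent => [i|]; first exact: mN.
  apply: (has_scale_product_law alpha_gt0 (fun i => mN (fA i))) => theta.
  exact: pull_scale.
- exact: pull_additive.
Qed.

(** A simple integral against [N] is the integral against [M] of the pulled simple kernel. By
    isometry the pulled kernels converge to [pull F], so both integrals are the same variable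
    [Y]. *)
Lemma pull_stochastic_integral F Y : scalar_measurable F ->
  is_stochastic_integral alpha mu P M (pull F) Y ->
  is_stochastic_integral alpha nu P N F Y.
Proof.
move=> mF FY; have fF : in_Lalpha alpha nu F.
  by apply/(pull_in_Lalpha mF); case: FY.
split; [exact: fF|by case: FY|].
have [m [a [A [fA cf]]]] := in_Lalpha_approximable alpha_gt0 alpha_lt2 P fF.
exists m, a, A; split => //.
apply: (stochastic_integral_cvg alpha_gt0 alpha_lt2 hM _ FY
  (f_ := fun n => pull (simple_kernel (m n) (a n) (A n)))).
  move=> n; apply: (simple_pull_integral (fun i : 'I_(m n) => a n i)
    (A := fun i : 'I_(m n) => A n i)) => i; exact: fA.
have ms n : scalar_measurable (simple_kernel (m n) (a n) (A n)).
  by apply: (measurable_simple (fun i : 'I_(m n) => a n i)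
    (A := fun i : 'I_(m n) => A n i)) => i; exact: fA.
by rewrite (_ : (fun n => _) = fun n =>
    Lalpha_dist alpha nu (simple_kernel (m n) (a n) (A n)) F)//;
  apply/funext => n; rewrite pull_dist.
Qed.

End transfer.

(** * Densities and iterated integrals *)

Section density.
Context d (S : measurableType d) (R : realType) (mu : {measure set S -> \bar R}).
Variable r : S -> \bar R.
Hypothesis r0 : forall s, (0 <= r s)%E.
Hypothesis mr : measurable_fun [set: S] r.

(** The two proofs are arguments of the definition so that the measure structure can be found from
    the term alone. *)
Definition density of (forall s, (0 <= r s)%E) & measurable_fun [set: S] r :=
  fun A : set S => (\int[mu]_(s in A) r s)%E.

Let m := density r0 mr.

Let m_set0 : m set0 = 0%E. Proof. exact: integral_set0. Qed.

Let m_ge0 A : (0 <= m A)%E. Proof. by apply: integral_ge0 => s _; exact: r0. Qed.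

Let m_sigma_additive : semi_sigma_additive m.
Proof.
move=> F mF tF mUF; rewrite /m /density ge0_integral_bigcup//; last exact: measurable_funTS.
by apply: is_cvg_ereal_nneg_natsum_cond => n _ _; exact: m_ge0.
Qed.

HB.instance Definition _ := isMeasure.Build _ _ _ (density r0 mr) m_set0 m_ge0 m_sigma_additive.

End density.

Section density_integral.
Context d (S : measurableType d) (R : realType).
Variables (mu nu : {measure set S -> \bar R}) (r : S -> \bar R).
Hypothesis r0 : forall s, (0 <= r s)%E.
Hypothesis mr : measurable_fun [set: S] r.
Hypothesis nuE : forall A, measurable A -> nu A = (\int[mu]_(s in A) r s)%E.

Import HBNNSimple.

Let integral_density_simple (h : {nnsfun S >-> R}) :
  (\int[nu]_s (h s)%:E = \int[mu]_s ((h s)%:E * r s))%E.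
Proof.
pose A y := h @^-1` [set y].
have mA y : measurable (A y) by exact: measurable_sfunP.
have h0 y s : (0 <= (y * \1_(A y) s)%:E)%E by exact: nnfun_muleindic_ge0.
have hE s : (h s)%:E = (\sum_(y \in range h) (y * \1_(A y) s)%:E)%E.
  by rewrite fimfunE fsumEFin.
have mh y : measurable_fun [set: S] (fun s => (y * \1_(A y) s)%:E).
  exact/measurable_EFinP/measurable_funM.
transitivity (\int[nu]_s (\sum_(y \in range h) (y * \1_(A y) s)%:E))%E.
  by apply: eq_integral => s _; rewrite hE.
transitivity (\int[mu]_s (\sum_(y \in range h) (y * \1_(A y) s)%:E * r s))%E; last first.
  apply: eq_integral => s _; rewrite hE ge0_mule_fsuml// => y; exact: h0.
rewrite !ge0_integral_fsum//; first apply: eq_fsbigr => y; last 2 first.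
- by move=> y; apply: emeasurable_funM.
- by move=> y s _; apply: mule_ge0 => //; exact: h0.
rewrite inE => -[s0 _ <-]; have hs0 : 0 <= h s0 by [].
under eq_integral do rewrite EFinM.
under [in RHS]eq_integral do rewrite EFinM -muleA.
have mI : measurable_fun [set: S] (fun s => (\1_(A (h s0)) s : R)%:E).
  exact/measurable_EFinP.
have I0 s : [set: S] s -> (0 <= (\1_(A (h s0)) s : R)%:E)%E by rewrite lee_fin indicE.
rewrite (ge0_integralZl_EFin nu measurableT I0 mI hs0).
rewrite (ge0_integralZl_EFin mu measurableT _ _ hs0); last 2 first.
- by move=> s _; apply: mule_ge0 => //; exact: I0.
- exact: emeasurable_funM.
rewrite integral_indic// setIT nuE// integral_mkcond; congr (_ * _)%E.
by apply: eq_integral => s _; rewrite epatch_indic muleC.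
Qed.

(** Monotone approximation by simple functions. The measure [nu] is only tied to [r] by [nuE], so
    that the formula applies to push-forwards as well as to [density]. *)
Lemma integral_density (G : S -> \bar R) : measurable_fun [set: S] G ->
  (forall s, 0 <= G s)%E -> (\int[nu]_s G s = \int[mu]_s (G s * r s))%E.
Proof.
move=> mG G0; pose h := nnsfun_approx measurableT mG.
have h_nd s : {homo (fun n => (h n s)%:E) : p q / (p <= q)%N >-> (p <= q)%E}.
  by move=> p q pq; rewrite lee_fin; exact/lefP/nd_nnsfun_approx.
have hG s : (h n s)%:E @[n --> \oo] --> G s by apply: cvg_nnsfun_approx.
have mh n : measurable_fun [set: S] (fun s => (h n s)%:E) by exact/measurable_EFinP.
have hr s : ((h n s)%:E * r s)%E @[n --> \oo] --> (G s * r s)%E.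
  have nd : {homo (fun n => (h n s)%:E * r s)%E : p q / (p <= q)%N >-> (p <= q)%E}.
    by move=> p q pq; apply: lee_wpmul2r => //; exact: h_nd.
  (* Where [r s] is infinite the product takes only the values 0 and [+oo]: it is 0 as long as
     [h n s] is, and [+oo] from the first positive [h n s] on. *)
  have [rfin|] := boolP (r s \is a fin_num); first exact: cvgeZr.
  rewrite fin_numE negb_and !negbK => /orP[/eqP rs|/eqP rs].
    by have := r0 s; rewrite rs.
  rewrite rs; have [Gs|Gs] := eqVneq (G s) 0%E.
    rewrite Gs mul0e; apply: cvg_near_cst; apply: nearW => n.
    have : ((h n s)%:E <= G s)%E.
      rewrite -(cvg_lim _ (hG s))//; apply: lime_ge; first by apply/cvg_ex; exists (G s).
      by exists n => // q /= nq; exact: h_nd.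
    by rewrite Gs lee_fin => hn; rewrite (_ : h n s = 0) ?mul0e//;
      apply/eqP; rewrite eq_le hn/=.
  rewrite gt0_muley; last by rewrite lt0e Gs G0.
  apply: cvg_near_cst.
  have : \forall n \near \oo, (0 < (h n s)%:E)%E.
    have [n hn] : exists n, h n s != 0.
      apply/not_existsP => h0; move/eqP : Gs; apply.
      rewrite -(cvg_lim _ (hG s))//; apply: lim_near_cst => //; apply: nearW => n.
      by have /negP := h0 n; rewrite negbK => /eqP ->.
    exists n => // q /= nq; apply: lt_le_trans (h_nd s _ _ nq).
    by rewrite lte_fin lt_neqAle eq_sym hn /=.
  by apply: filterS => n; exact: gt0_muley.
transitivity (limn (fun n => \int[nu]_s (h n s)%:E)%E).
  rewrite -monotone_convergence//.
  - by apply: eq_integral => s _; apply/esym/cvg_lim.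
  - by move=> n s _; rewrite lee_fin.
transitivity (limn (fun n => \int[mu]_s ((h n s)%:E * r s))%E).
  by congr (limn _); apply/funext => n; exact: integral_density_simple.
rewrite -monotone_convergence//.
- by apply: eq_integral => s _; apply/cvg_lim.
- by move=> n; exact: emeasurable_funM.
- by move=> n s _; apply: mule_ge0 => //; rewrite lee_fin.
- by move=> s _ p q pq; apply: lee_wpmul2r => //; exact: h_nd.
Qed.

End density_integral.

Section density_unique.
Context d (S : measurableType d) (R : realType) (mu : {sigma_finite_measure set S -> \bar R}).

(** On [D n k] the function [f] is bounded and the measure finite, so equality of integrals over
    subsets suffices there; these sets exhaust the points where [f] is finite. *)
Lemma ae_eq_density (f g : S -> \bar R) :
  measurable_fun [set: S] f -> measurable_fun [set: S] g ->
  (forall s, 0 <= f s)%E -> (forall s, 0 <= g s)%E ->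
  {ae mu, forall s, f s < +oo}%E ->
  (forall A, measurable A -> \int[mu]_(s in A) f s = \int[mu]_(s in A) g s)%E ->
  {ae mu, forall s, f s = g s}.
Proof.
move=> mf mg f0 g0 ffin fg; have [E ET Efin] := sigma_finiteT mu.
pose D n k := E n `&` [set s | f s <= k%:R%:E]%E.
have mD n k : measurable (D n k).
  apply: measurableI; first exact: (Efin n).1.
  by rewrite -[X in measurable X]setTI; exact: emeasurable_fun_infty_c.
have H n k : {ae mu, forall s, D n k s -> f s = g s}.
  apply: integral_ae_eq => //.
  - apply/integrableP; split; first exact: measurable_funTS.
    apply: (@le_lt_trans _ _ (\int[mu]_(s in D n k) (cst k%:R%:E s))%E).
      apply: ge0_le_integral => //.
      + by apply: measurableT_comp => //; exact: measurable_funTS.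
      + by move=> s [_ /=]; rewrite gee0_abs.
    rewrite integral_cst// lte_mul_pinfty ?lee_fin//.
    have [mEn fEn] := Efin n; apply: le_lt_trans fEn.
    by apply: le_measure; rewrite ?inE//; exact: subIsetl.
  - exact: measurable_funTS.
  - by move=> A _ mA; exact: fg.
have {}H : {ae mu, forall s, forall n k, D n k s -> f s = g s}.
  apply: ae_foralln => n; apply: ae_foralln => k; exact: H.
apply: filterS2 ffin H => s fs H.
have [n _ En] : (\bigcup_n E n) s by rewrite -ET.
have [k fk] : exists k : nat, (f s <= k%:R%:E)%E.
  have ff : f s \is a fin_num by rewrite ge0_fin_numE.
  exists (Num.bound (fine (f s))); rewrite -{1}(fineK ff) lee_fin ltW//.
  by rewrite archi_boundP// fine_ge0.
exact: (H n k).
Qed.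

End density_unique.

Section lebesgue.
Context {R : realType}.
Notation lambda := (@lebesgue_measure R).

Lemma lebesgue_integralN (G : measurableTypeR R -> \bar R) :
  measurable_fun [set: measurableTypeR R] G -> (forall x, 0 <= G x)%E ->
  (\int[lambda]_x G (- x)%R = \int[lambda]_x G x)%E.
Proof.
move=> mG G0.
have mo : measurable_fun [set: measurableTypeR R] (-%R : R -> measurableTypeR R) by exact: oppr_measurable.
rewrite -(ge0_integral_pushforward mo lambda (f := G) measurableT)//.
by apply: eq_measure_integral => A mA _; exact: lebesgue_measureN.
Qed.

Lemma lebesgue_integralD (a : R) (G : measurableTypeR R -> \bar R) :
  measurable_fun [set: measurableTypeR R] G -> (forall x, 0 <= G x)%E ->
  (\int[lambda]_x G (a + x)%R = \int[lambda]_x G x)%E.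
Proof.
move=> mG G0.
have mo : measurable_fun [set: measurableTypeR R] (fun x : measurableTypeR R => (a + x)%R : measurableTypeR R).
  by apply: measurable_funD => //; exact: measurable_cst.
rewrite -(ge0_integral_pushforward mo lambda (f := G) measurableT)//.
apply: eq_measure_integral => A mA _; apply/esym.
apply: lebesgue_measure_unique => // _ [[x y] _ <-].
rewrite /= /pushforward (_ : _ @^-1` _ = `](x - a), (y - a)]%classic); last first.
  by apply/seteqP; split => z /=; rewrite !in_itv/= => /andP[h1 h2]; apply/andP; split; lra.
rewrite !lebesgue_measure_itv/= !lte_fin ltrD2r; case: ifP => // _.
by rewrite -!EFinB; congr EFin; lra.
Qed.

End lebesgue.

Section integral_eq0.
Context d (S : measurableType d) (R : realType) (mu : {measure set S -> \bar R}).

Lemma ge0_integral_eq0P (f : S -> \bar R) : measurable_fun [set: S] f ->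
  (forall s, 0 <= f s)%E ->
  (\int[mu]_s f s = 0)%E <-> {ae mu, forall s, f s = 0%E}.
Proof.
move=> mf f0.
have -> : (\int[mu]_s f s = \int[mu]_s `|f s|)%E.
  by apply: eq_integral => s _; rewrite gee0_abs.
rewrite (ae_eq_integral_abs mu measurableT mf).
split; apply: filterS => s h; [exact: h|by move=> _; exact: h].
Qed.

Lemma ge0_integral_lty_ae (f : S -> \bar R) : measurable_fun [set: S] f ->
  (forall s, 0 <= f s)%E -> (\int[mu]_s f s < +oo)%E ->
  {ae mu, forall s, f s < +oo}%E.
Proof.
move=> mf f0 ffin; have fi : mu.-integrable setT f.
  apply/integrableP; split => //; under eq_integral do rewrite gee0_abs//.
  exact: ffin.
have := integrable_ae measurableT fi; apply: filterS => s /(_ I) h.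
by rewrite -ge0_fin_numE.
Qed.

End integral_eq0.

(** * Tonelli's theorem and exchange of null sets *)

Section tonelli.
Context {R : realType} d1 (X : measurableType d1) d2 (Y : measurableType d2).
Context (m1 : {sigma_finite_measure set X -> \bar R})
  (m2 : {sigma_finite_measure set Y -> \bar R}).

Lemma measurable_integral (f : X -> Y -> \bar R) :
  measurable_fun [set: X * Y] (fun p => f p.1 p.2) ->
  (forall x y, 0 <= f x y)%E ->
  measurable_fun [set: X] (fun x => \int[m2]_y f x y)%E.
Proof.
move=> mf f0.
exact: (@measurable_fun_fubini_tonelli_F _ _ X Y R m2 (fun p => f p.1 p.2) mf (fun p => f0 p.1 p.2)).
Qed.

Lemma tonelli (f : X -> Y -> \bar R) :
  measurable_fun [set: X * Y] (fun p => f p.1 p.2) ->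
  (forall x y, 0 <= f x y)%E ->
  (\int[m1]_x \int[m2]_y f x y = \int[m2]_y \int[m1]_x f x y)%E.
Proof.
move=> mf f0.
exact: (@fubini_tonelli _ _ X Y R m1 m2 (fun p => f p.1 p.2) mf (fun p => f0 p.1 p.2)).
Qed.

(** Turns a nested almost-everywhere statement into the vanishing of an iterated integral, in which
    the order of integration can be exchanged. *)
Lemma ae_ae_integral (A : X -> Y -> Prop) : measurable [set p | A p.1 p.2] ->
  {ae m1, forall x, {ae m2, forall y, ~ A x y}} <->
  (\int[m1]_x \int[m2]_y (\1_[set p : X * Y | A p.1 p.2] (x, y) : R)%:E = 0)%E.
Proof.
move=> mA; set I := fun x y => (\1_[set p : X * Y | A p.1 p.2] (x, y) : R)%:E.
have mI : measurable_fun [set: X * Y] (fun p => I p.1 p.2).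
  apply/measurable_EFinP.
  rewrite (_ : (fun p => _) = \1_[set p : X * Y | A p.1 p.2]); first exact: measurable_indic.
  by apply/funext => -[x y].
have I0 x y : (0 <= I x y)%E by rewrite lee_fin indicE.
have mIx x : measurable_fun [set: Y] (I x).
  exact: (measurableT_comp mI (measurable_fun_pair (measurable_cst x) (@measurable_id _ _ _))).
rewrite (ge0_integral_eq0P m1 (measurable_integral mI I0)); last first.
  by move=> x; apply: integral_ge0 => y _; exact: I0.
have E x y : ~ A x y <-> I x y = 0%E.
  rewrite /I indicE; split => [nA|]; first by rewrite memNset.
  by move=> h Axy; move: h; rewrite mem_set// => -[] /eqP; rewrite oner_eq0.
split; apply: filterS => x h; [apply/ge0_integral_eq0P => //|
  have := (ge0_integral_eq0P m2 (mIx x) (I0 x)).1 h];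
  by [apply: filterS h => y /E|apply: filterS => y /E].
Qed.

End tonelli.

Lemma ae_swap (R : realType) d1 (X : measurableType d1) d2 (Y : measurableType d2)
    (m1 : {sigma_finite_measure set X -> \bar R})
    (m2 : {sigma_finite_measure set Y -> \bar R}) (A : X -> Y -> Prop) :
  measurable [set p : X * Y | A p.1 p.2] ->
  {ae m1, forall x, {ae m2, forall y, A x y}} ->
  {ae m2, forall y, {ae m1, forall x, A x y}}.
Proof.
move=> mA H.
have mN : measurable [set p : X * Y | ~ A p.1 p.2] by exact: measurableC mA.
have mN' : measurable [set p : Y * X | ~ A p.2 p.1].
  have := measurable_fun_pair (@measurable_snd _ _ Y X) (@measurable_fst _ _ Y X).
  by move=> /(_ measurableT _ mN); rewrite setTI.
have {}H : {ae m1, forall x, {ae m2, forall y, ~ ~ A x y}}.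
  by apply: filterS H => x; apply: filterS => y h; exact.
have {H} H := (ae_ae_integral m1 m2 (A := fun x y => ~ A x y) mN).1 H.
have H' : {ae m2, forall y, {ae m1, forall x, ~ ~ A x y}}.
  apply/(ae_ae_integral m2 m1 (A := fun y x => ~ A x y) mN').
  pose I x y := (\1_[set p : X * Y | ~ A p.1 p.2] (x, y) : R)%:E.
  rewrite -[RHS]H [RHS](@tonelli _ _ _ _ _ m1 m2 I).
  - apply: eq_integral => y _; apply: eq_integral => x _; rewrite !indicE /=.
    by congr ((_ : bool)%:R%:E); apply/idP/idP => /set_mem h; apply/mem_set.
  - apply/measurable_EFinP.
    rewrite (_ : (fun p => _) = \1_[set p : X * Y | ~ A p.1 p.2]); first exact: measurable_indic.
    by apply/funext => -[x y].
  - by move=> x y; rewrite lee_fin indicE.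
by apply: filterS H' => y; apply: filterS => x h; exact: contrapT.
Qed.

(** * Nonsingular flows *)

Section flow.
Context {R : realType} dS (S : measurableType dS)
  (mu : {sigma_finite_measure set S -> \bar R}).
Variables (phi : R -> S -> S) (rho : R -> S -> R).
Hypothesis hphi : measurable_flow phi.
Hypothesis hrho : flow_density mu phi rho.
Notation lambda := (@lebesgue_measure R).
Notation line := (measurableTypeR R).

Lemma flowV t s : phi (- t) (phi t s) = s.
Proof. by case: hphi => _ phiD phi0; rewrite -phiD addNr phi0. Qed.

Lemma flowVK t s : phi t (phi (- t) s) = s.
Proof. by case: hphi => _ phiD phi0; rewrite -phiD subrr phi0. Qed.

Lemma measurable_flow_pair dX (X : measurableType dX) (u : X -> line) (v : X -> S) :
  measurable_fun [set: X] u -> measurable_fun [set: X] v ->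
  measurable_fun [set: X] (fun x => phi (u x) (v x)).
Proof.
case: hphi => mphi _ _ mu' mv.
exact: (measurableT_comp mphi (measurable_fun_pair mu' mv)).
Qed.

Lemma measurable_flow_map t : measurable_fun [set: S] (phi t).
Proof. exact: (measurable_flow_pair (measurable_cst (t : line)) (@measurable_id _ _ _)). Qed.

Lemma measurable_density_pair dX (X : measurableType dX) (u : X -> line) (v : X -> S) :
  measurable_fun [set: X] u -> measurable_fun [set: X] v ->
  measurable_fun [set: X] (fun x => rho (u x) (v x)).
Proof.
case: hrho => mrho _ _ mu' mv.
exact: (measurableT_comp mrho (measurable_fun_pair mu' mv)).
Qed.

Lemma flow_image t (A : set S) : phi t @` A = phi (- t) @^-1` A.
Proof.
apply/seteqP; split => s /=; first by case=> x Ax <-; rewrite flowV.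
by move=> As; exists (phi (- t) s) => //; rewrite flowVK.
Qed.

(** The image of a set under [phi t] is its preimage under [phi (- t)], so [rho t] is the density of
    the push-forward of [mu] under [phi (- t)]. *)
Lemma flow_change t (G : S -> \bar R) : measurable_fun [set: S] G ->
  (forall s, 0 <= G s)%E ->
  (\int[mu]_s (G (phi t s) * (rho t s)%:E) = \int[mu]_s G s)%E.
Proof.
move=> mG G0; case: hrho => mrho rho0 rhoE.
have mp := measurable_flow_map (- t).
have mr : measurable_fun [set: S] (fun s => (rho t s)%:E).
  apply/measurable_EFinP.
  exact: (measurable_density_pair (measurable_cst (t : line)) (@measurable_id _ _ _)).
pose nu : {measure set S -> \bar R} :=
  measure_function_pushforward__canonical__measure_function_Measure mu mp.
rewrite -(@integral_density _ S R mu nu (fun s => (rho t s)%:E)) //.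
- rewrite (ge0_integral_pushforward mp mu measurableT)//.
  + by apply: eq_integral => s _ /=; rewrite flowVK.
  + exact: (measurableT_comp mG (measurable_flow_map t)).
- by move=> s; rewrite lee_fin.
- by move=> A mA; rewrite -rhoE//= /pushforward flow_image.
- exact: (measurableT_comp mG (measurable_flow_map t)).
Qed.

Hypothesis hns : nonsingular mu phi.

Lemma ae_flow t (Q : S -> Prop) : {ae mu, forall s, Q s} ->
  {ae mu, forall s, Q (phi t s)}.
Proof.
move=> [A [mA A0 QA]]; exists (phi t @^-1` A); split.
- by rewrite -[X in measurable X]setTI; exact: measurable_flow_map.
- by apply/(hns t mA).
- by move=> s nQ; apply: QA.
Qed.

(** The set where [rho t] vanishes has a null image under [phi t]; nonsingularity of [phi (- t)]
    makes the set itself null. *)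
Lemma ae_density_gt0 t : {ae mu, forall s, 0 < rho t s}.
Proof.
case: hrho => _ rho0 rhoE; pose A := [set s | rho t s <= 0].
have mr : measurable_fun [set: S] (rho t).
  exact: (measurable_density_pair (measurable_cst (t : line)) (@measurable_id _ _ _)).
have mA : measurable A.
  rewrite (_ : A = rho t @^-1` `]-oo, 0]).
    by rewrite -[X in measurable X]setTI; exact: mr.
  by apply/seteqP; split => s; rewrite /A /= in_itv.
exists A; split => //; last by move=> s /negP; rewrite -leNgt.
apply/(hns (- t) mA); rewrite -flow_image rhoE// integral0_eq// => s As.
by congr EFin; apply/eqP; rewrite eq_le rho0 andbT.
Qed.

Lemma ae_flow_ae (Q : S -> Prop) : {ae mu, forall s, Q s} ->
  {ae mu, forall s, {ae lambda, forall t : line, Q (phi t s)}}.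
Proof.
move=> [A [mA A0 QA]].
have H : {ae lambda, forall t : line, {ae mu, forall s, ~ A (phi t s)}}.
  apply: aeW => t; apply: (ae_flow t (Q := fun s => ~ A s)).
  exists A; split => // s /= h; exact: contrapT.
have mN : measurable [set p : line * S | ~ A (phi p.1 p.2)].
  apply: measurableC; have [mphi _ _] := hphi.
  by rewrite -[X in measurable X]setTI; exact: mphi.
apply: filterS (ae_swap mN H) => s; apply: filterS => t nA.
by apply: contrapT => nQ; apply: nA; exact: QA.
Qed.

Variable f0 : S -> R.
Hypothesis f00 : forall s, 0 <= f0 s.
Hypothesis mf0 : measurable_fun [set: S] f0.

Definition flow_mass s : \bar R := (\int[lambda]_t (f0 (phi t s) * rho t s)%:E)%E.

Let measurable_integrand : measurable_fun [set: S * line]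
  (fun p => (f0 (phi p.2 p.1) * rho p.2 p.1)%:E).
Proof.
apply/measurable_EFinP; apply: measurable_funM.
  exact: (measurableT_comp mf0 (measurable_flow_pair measurable_snd measurable_fst)).
exact: (measurable_density_pair measurable_snd measurable_fst).
Qed.

Let integrand_ge0 s (t : line) : (0 <= (f0 (phi t s) * rho t s)%:E)%E.
Proof. by case: hrho => _ rho0 _; rewrite lee_fin mulr_ge0. Qed.

Lemma measurable_flow_mass : measurable_fun [set: S] flow_mass.
Proof.
exact: (@measurable_integral R _ S _ line lambda (fun s (t : line) => (f0 (phi t s) * rho t s)%:E)
  measurable_integrand integrand_ge0).
Qed.

Lemma flow_mass_ge0 s : (0 <= flow_mass s)%E.
Proof. by apply: integral_ge0 => t _; exact: integrand_ge0. Qed.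

Definition orbit_integral (H : S -> \bar R) s : \bar R := (\int[lambda]_v H (phi v s))%E.

Lemma measurable_orbit (H : S -> \bar R) s : measurable_fun [set: S] H ->
  measurable_fun [set: line] (fun v : line => H (phi v s)).
Proof.
move=> mH; apply: (measurableT_comp mH).
exact: (measurable_flow_pair (@measurable_id _ _ _) (measurable_cst s)).
Qed.

Lemma measurable_orbit_integral (H : S -> \bar R) : measurable_fun [set: S] H ->
  (forall s, 0 <= H s)%E -> measurable_fun [set: S] (orbit_integral H).
Proof.
move=> mH H0; apply: (@measurable_integral R _ S _ line lambda (fun s (v : line) => H (phi v s))) => //.
exact: (measurableT_comp mH (measurable_flow_pair measurable_snd measurable_fst)).
Qed.

Lemma orbit_integral_ge0 (H : S -> \bar R) s : (forall s, 0 <= H s)%E ->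
  (0 <= orbit_integral H s)%E.
Proof. by move=> H0; apply: integral_ge0. Qed.

Lemma orbit_integral_flow (H : S -> \bar R) u s : measurable_fun [set: S] H ->
  (forall s, 0 <= H s)%E -> orbit_integral H (phi u s) = orbit_integral H s.
Proof.
move=> mH H0; rewrite /orbit_integral.
rewrite -[RHS](lebesgue_integralD u (measurable_orbit s mH))//.
by apply: eq_integral => v _; case: hphi => _ phiD _; rewrite -phiD addrC.
Qed.

(* The right-hand side does not change when [H] is replaced by [H \o phi u], so
   that the measure [flow_mass * mu] is invariant under the flow. *)
Lemma integral_flow_mass (H : S -> \bar R) : measurable_fun [set: S] H ->
  (forall s, 0 <= H s)%E ->
  (\int[mu]_s (H s * flow_mass s) =
   \int[mu]_s ((f0 s)%:E * orbit_integral H s))%E.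
Proof.
move=> mH H0; have mf : measurable_fun [set: S] (fun s => (f0 s)%:E).
  exact/measurable_EFinP.
have f0e s : (0 <= (f0 s)%:E)%E by rewrite lee_fin.
transitivity (\int[mu]_s \int[lambda]_t (H s * (f0 (phi t s) * rho t s)%:E))%E.
  apply: eq_integral => s _; rewrite -ge0_integralZl//.
  exact: (measurableT_comp measurable_integrand
    (measurable_fun_pair (measurable_cst s) (@measurable_id _ line _))).
rewrite (@tonelli _ _ _ _ _ mu lambda
  (fun s (t : line) => H s * (f0 (phi t s) * rho t s)%:E)%E); last 2 first.
- apply: emeasurable_funM; first exact: (measurableT_comp mH measurable_fst).
  exact: measurable_integrand.
- by move=> s t; exact: mule_ge0.
(* For fixed [t] the substitution [phi t] in [s] removes the density from [f0] and moves [H] back by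
   [- t]; the sign is then absorbed by the reflection of the line. *)
transitivity (\int[lambda]_t \int[mu]_s ((f0 s)%:E * H (phi (- t)%R s)))%E.
  apply: eq_integral => t _.
  rewrite -(flow_change t (G := fun s => ((f0 s)%:E * H (phi (- t)%R s))%E)).
  - by apply: eq_integral => s _; rewrite flowV EFinM muleCA muleA.
  - apply: emeasurable_funM => //.
    exact: (measurableT_comp mH (measurable_flow_map _)).
  - by move=> s; exact: mule_ge0.
rewrite -(@tonelli _ _ _ _ _ mu lambda
  (fun s (t : line) => (f0 s)%:E * H (phi (- t)%R s))%E); last 2 first.
- apply: emeasurable_funM; first exact: (measurableT_comp mf measurable_fst).
  apply: (measurableT_comp mH).
  apply: (measurable_flow_pair (u := fun p : S * line => (- p.2)%R)) => //.
  exact: (measurableT_comp (@oppr_measurable R setT) measurable_snd).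
- by move=> s t; exact: mule_ge0.
apply: eq_integral => s _.
have mo := measurable_orbit s mH.
rewrite /orbit_integral -(lebesgue_integralN mo)//.
rewrite ge0_integralZl//.
exact: (measurableT_comp mo (@oppr_measurable R setT)).
Qed.

Hypothesis mass_fin : {ae mu, forall s, (flow_mass s < +oo)%E}.

(** Invariance of the measure [flow_mass * mu], tested on [\1_A] and on its translate, combined with
    the change of variables by [phi u], shows that both sides are densities of the same measure. *)
Lemma flow_mass_flow u : {ae mu, forall s,
  flow_mass s = (flow_mass (phi u s) * (rho u s)%:E)%E}.
Proof.
have rho0 : forall s, (0 <= (rho u s)%:E)%E by case: hrho => _ r0 _ s; rewrite lee_fin.
have mr : measurable_fun [set: S] (fun s => (rho u s)%:E).
  apply/measurable_EFinP.
  exact: (measurable_density_pair (measurable_cst (u : line)) (@measurable_id _ _ _)).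
have mI := measurable_flow_mass; have I0 := flow_mass_ge0.
apply: ae_eq_density => //.
- apply: emeasurable_funM => //; exact: (measurableT_comp mI (measurable_flow_map u)).
- by move=> s; exact: mule_ge0.
move=> A mA; rewrite [LHS]integral_mkcond [RHS]integral_mkcond.
have mA1 : measurable_fun [set: S] (fun s => (\1_A s : R)%:E).
  exact/measurable_EFinP/measurable_indic.
have A10 s : (0 <= (\1_A s : R)%:E)%E by rewrite lee_fin indicE.
have mAu : measurable_fun [set: S] (fun s => (\1_A (phi (- u) s) : R)%:E).
  exact: (measurableT_comp mA1 (measurable_flow_map (- u))).
transitivity (\int[mu]_s ((\1_A s : R)%:E * flow_mass s))%E.
  by apply: eq_integral => s _; rewrite epatch_indic muleC.
transitivity (\int[mu]_s ((\1_A (phi (- u) s) : R)%:E * flow_mass s))%E; last first.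
  rewrite -(flow_change u (G := fun s => ((\1_A (phi (- u)%R s) : R)%:E * flow_mass s)%E)).
  - by apply: eq_integral => s _; rewrite flowV epatch_indic -muleA muleC.
  - exact: emeasurable_funM.
  - by move=> s; exact: mule_ge0.
rewrite (integral_flow_mass mA1 A10) (integral_flow_mass mAu (fun s => A10 _)); apply: eq_integral => s _; congr (_ * _)%E.
rewrite -(orbit_integral_flow (- u) s mA1 A10); apply: eq_integral => v _.
by case: hphi => _ phiD _; rewrite -!phiD addrC.
Qed.

(** The set [Z] of zero mass is invariant up to null sets, so almost every orbit starting in it
    stays in it for almost all times and spends infinite time there. By [integral_flow_mass] for the
    indicator of [Z], [f0] times the time spent in [Z] has integral 0, which forces [f0] to vanish
    on [Z]. *)
Lemma base_eq0 : {ae mu, forall s, flow_mass s = 0%E -> f0 s = 0}.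
Proof.
pose Z := [set s | flow_mass s = 0%E].
have mZ : measurable Z.
  by rewrite -[X in measurable X]setTI; exact: (measurable_flow_mass measurableT (emeasurable_set1 0%E)).
have mZ1 : measurable_fun [set: S] (fun s => (\1_Z s : R)%:E).
  exact/measurable_EFinP/measurable_indic.
have Z10 s : (0 <= (\1_Z s : R)%:E)%E by rewrite lee_fin indicE.
have mO := measurable_orbit_integral mZ1 Z10.
have : (\int[mu]_s ((f0 s)%:E * orbit_integral (fun s => (\1_Z s : R)%:E) s) = 0)%E.
  rewrite -integral_flow_mass//; apply: integral0_eq => s _; rewrite indicE.
  by have [/set_mem ->|] := boolP (s \in Z); rewrite ?mule0 ?mul0e.
have mf : measurable_fun [set: S] (fun s => (f0 s)%:E) by exact/measurable_EFinP.
move/(ge0_integral_eq0P mu); move=> /(_ (emeasurable_funM mf mO)) H.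
have {}H := H (fun s => mule_ge0 _ (orbit_integral_ge0 _ _)).
have {}H : {ae mu, forall s, ((f0 s)%:E * orbit_integral (fun s => (\1_Z s : R)%:E) s = 0)%E}.
  by apply: H => // s; rewrite ?lee_fin.
pose B (s : S) (v : line) := flow_mass s = (flow_mass (phi v s) * (rho v s)%:E)%E /\ 0 < rho v s.
have mB : measurable [set p : line * S | B p.2 p.1].
  have mphi := measurable_flow_pair (@measurable_fst _ _ line S) (@measurable_snd _ _ line S).
  have mrho := measurable_density_pair (@measurable_fst _ _ line S) (@measurable_snd _ _ line S).
  apply: measurableI.
    rewrite -[X in measurable X]setTI; apply: measurable_eqe => //.
      exact: (measurableT_comp measurable_flow_mass measurable_snd).
    apply: emeasurable_funM; first exact: (measurableT_comp measurable_flow_mass mphi).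
    exact/measurable_EFinP.
  pose C := (fun p : line * S => rho p.1 p.2) @^-1` `]0, +oo[.
  have mC : measurable C by rewrite -[X in measurable X]setTI; exact: mrho.
  rewrite (_ : (fun _ => _) = C)//.
  by apply/funext => p; rewrite /C /= in_itv/= andbT.
have BB : {ae lambda, forall v : line, {ae mu, forall s, B s v}}.
  by apply: aeW => v; apply: filterS2 (flow_mass_flow v) (ae_density_gt0 v) => s.
apply: filterS2 H (ae_swap mB BB) => s Hs Bs Zs.
(* For almost every [v] the mass at [phi v s] is 0 as well, the density being positive, so the orbit
   integral is the length of the line. *)
have orb : (orbit_integral (fun s => (\1_Z s : R)%:E) s != 0)%E.
  rewrite /orbit_integral (_ : (\int[lambda]_v (\1_Z (phi v s))%:E = lambda [set: line])%E).
    rewrite gt_eqF// (@lt_le_trans _ _ (lambda `]0, 1]%classic))//.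
      by rewrite lebesgue_measure_itv/= lte_fin ltr01 -EFinB subr0 lte_fin.
    by apply: le_measure; rewrite ?inE.
  rewrite -[RHS]mul1e -integral_cst//; apply: ae_eq_integral => //.
    exact: (measurable_orbit s mZ1).
  apply: filterS Bs => v [Iv rv] _; congr EFin; rewrite indicE mem_set// /Z /=.
  move: Iv; rewrite Zs => /esym/eqP; rewrite mule_eq0 => /orP[/eqP//|].
  by rewrite eqe gt_eqF.
by move: Hs => /eqP; rewrite mule_eq0 (negPf orb) orbF => /eqP[].
Qed.

End flow.

(** * Cross-sections of the orbits *)

Section median.
Context {R : realType}.
Notation lambda := (@lebesgue_measure R).
Notation line := (measurableTypeR R).
Implicit Types h : line -> \bar R.

Definition head_integral h (t : R) : \bar R := (\int[lambda]_(u in `]-oo, t]) h u)%E.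

Definition upper_half h : set R :=
  [set t | (2^-1%:E * \int[lambda]_u h u <= head_integral h t)%E].

(** The median exists for every finite nonzero measure without any moment condition, is equivariant
    under translations, and depends measurably on the density through countably many conditions. *)
Definition median h : R := inf (upper_half h).

Lemma head_integral_shift h v t : measurable_fun [set: line] h ->
  (forall u, 0 <= h u)%E ->
  head_integral (fun u => h (v + u)%R) t = head_integral h (v + t).
Proof.
move=> mh h0; rewrite /head_integral integral_mkcond [RHS]integral_mkcond.
rewrite -[RHS](lebesgue_integralD v).
- apply: eq_integral => u _; rewrite !patchE; congr (if _ then _ else _).
  by apply/idP/idP; rewrite !inE /= !in_itv/= lerD2l.
- exact/(measurable_restrictT h)/measurable_funTS.
- by move=> u; apply: erestrict_ge0.
Qed.

Section proper.
Variable h : line -> \bar R.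
Hypothesis mh : measurable_fun [set: line] h.
Hypothesis h0 : forall u, (0 <= h u)%E.
Hypothesis h_gt0 : (0 < \int[lambda]_u h u)%E.
Hypothesis h_fin : (\int[lambda]_u h u < +oo)%E.

Let W_fin : (\int[lambda]_u h u)%E \is a fin_num.
Proof. by rewrite ge0_fin_numE// ltW. Qed.

Let half_lt : (2^-1%:E * \int[lambda]_u h u < \int[lambda]_u h u)%E.
Proof.
rewrite -(fineK W_fin) -EFinM lte_fin.
have : 0 < fine (\int[lambda]_u h u)%E by apply: fine_gt0; rewrite h_gt0.
by set x := fine _; lra.
Qed.

Let exhaust (F : nat -> set line) : nondecreasing_seq F ->
  (forall n, measurable (F n)) -> \bigcup_n F n = setT ->
  exists n, (2^-1%:E * \int[lambda]_u h u < \int[lambda]_(u in F n) h u)%E.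
Proof.
move=> ndF mF UF.
have := ge0_nondecreasing_set_cvg_integral ndF mF
  (fun n => measurable_funTS mh) (fun n u _ => h0 u) (mu := lambda).
rewrite UF => cF; apply: contrapT => /forallNP nF.
have : (\int[lambda]_u h u <= 2^-1%:E * \int[lambda]_u h u)%E.
  rewrite -{1}(cvg_lim _ cF)//; apply: lime_le.
    by apply/cvg_ex; eexists; exact: cF.
  by apply: nearW => n; rewrite leNgt; apply/negP; exact: nF.
by rewrite leNgt half_lt.
Qed.

Lemma head_integral_le x y : x <= y -> (head_integral h x <= head_integral h y)%E.
Proof.
move=> xy; apply: ge0_subset_integral => //; first exact: measurable_funTS.
by move=> u /=; rewrite !in_itv/= => /le_trans; apply.
Qed.

Lemma upper_half_le x y : x <= y -> upper_half h x -> upper_half h y.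
Proof. by move=> xy hx; apply: le_trans hx _; exact: head_integral_le. Qed.

Lemma has_inf_upper_half : has_inf (upper_half h).
Proof.
split.
  have [|||n hn] := @exhaust (fun n => `]-oo, n%:R]%classic).
  - move=> p q pq; apply/subsetPset => u /=; rewrite !in_itv/= => /le_trans; apply.
    by rewrite ler_nat.
  - by move=> n; exact: measurable_itv.
  - apply/seteqP; split => // u _; exists (Num.bound `|u|) => //=.
    by rewrite in_itv/= ltW// (le_lt_trans (ler_norm _))// archi_boundP.
  by exists n%:R; exact: ltW.
have [|||n hn] := @exhaust (fun n => `]- n%:R, +oo[%classic).
- move=> p q pq; apply/subsetPset => u /=; rewrite !in_itv/= !andbT; apply: le_lt_trans.
  by rewrite lerN2 ler_nat.
- by move=> n; exact: measurable_itv.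
- apply/seteqP; split => // u _; exists (Num.bound `|u|) => //=.
  rewrite in_itv/= andbT ltrNl (le_lt_trans (ler_norm _))// normrN.
  by rewrite archi_boundP.
(* More than half of the total lies to the right of [-n]. At least half to the left of some [t < -n]
   would make the total exceed itself. *)
exists (- n%:R) => t; rewrite /upper_half /= => ht; rewrite leNgt; apply/negP => tn.
have := head_integral_le (ltW tn) => /(le_trans ht) hn'.
have : (\int[lambda]_u h u = head_integral h (- n%:R) + \int[lambda]_(u in `](- n%:R)%R, +oo[) h u)%E.
  rewrite /head_integral -ge0_integral_setU//.
  - congr (integral _ _ _); apply/seteqP; split => // u _ /=.
    by rewrite !in_itv/= andbT; case: (leP u (- n%:R)); [left|right].
  - exact: measurable_funTS.
  - rewrite disj_set2E; apply/eqP/seteqP; split => // u [] /=.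
    by rewrite !in_itv/= andbT leNgt => /negP.
apply/eqP; rewrite lt_eqF//.
rewrite [ltLHS](_ : _ = (2^-1%:E * \int[lambda]_u h u + 2^-1%:E * \int[lambda]_u h u)%E); last first.
  by rewrite -(fineK W_fin) -!EFinM -EFinD; congr EFin; set x := fine _; lra.
apply: lee_ltD => //.
by rewrite fin_numM.
Qed.

(** Rational thresholds make the event [median < x] a countable union of measurable conditions on
    [h], from which the measurability of [tau] follows. *)
Lemma median_ltP x : median h < x <->
  exists2 q : rat, ratr q < x & upper_half h (ratr q).
Proof.
split.
  move=> /(inf_lt has_inf_upper_half.1)[t ht tx].
  have [q] := rat_in_itvoo tx; rewrite in_itv/= => /andP[tq qx].
  by exists q => //; exact: upper_half_le (ltW tq) ht.
move=> [q qx hq]; apply: le_lt_trans qx.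
by apply: ge_inf => //; exact: has_inf_upper_half.2.
Qed.

End proper.

Lemma median_shift h v : measurable_fun [set: line] h -> (forall u, 0 <= h u)%E ->
  (0 < \int[lambda]_u h u)%E -> (\int[lambda]_u h u < +oo)%E ->
  median (fun u => h (v + u)%R) = median h - v.
Proof.
move=> mh h0 h1 h2; have hI := has_inf_upper_half mh h0 h1 h2.
have E t : upper_half (fun u => h (v + u)%R) t <-> upper_half h (v + t).
  by rewrite /upper_half /= head_integral_shift// lebesgue_integralD.
have hI' : has_inf (upper_half (fun u => h (v + u)%R)).
  split; first by case: hI => -[t ht] _; exists (t - v); apply/E; rewrite subrKC.
  case: hI => _ [m hm]; exists (m - v) => t /E /hm.
  by rewrite lerBlDl.
apply/eqP; rewrite eq_le; apply/andP; split.
  rewrite lerBrDr; apply: lb_le_inf hI.1 _ => t ht; rewrite -lerBrDr.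
  by apply: (ge_inf hI'.2); apply/E; rewrite subrKC.
apply: lb_le_inf hI'.1 _ => t /E ht; rewrite lerBlDl.
exact: (ge_inf hI.2).
Qed.

End median.

Lemma finite_image_density (R : realType) d (S : measurableType d)
    (mu : {measure set S -> \bar R}) dW (W : measurableType dW) (p : S -> W) (r : S -> R) :
  measurable_fun [set: S] p -> measurable_fun [set: S] r -> (forall s, 0 <= r s) ->
  (\int[mu]_s (r s)%:E < +oo)%E ->
  exists Q : {sigma_finite_measure set W -> \bar R},
    forall G : W -> \bar R, measurable_fun [set: W] G -> (forall x, 0 <= G x)%E ->
      (\int[Q]_x G x = \int[mu]_s (G (p s) * (r s)%:E))%E.
Proof.
move=> mp mr r0 rfin.
have mre : measurable_fun [set: S] (fun s => (r s)%:E) by exact/measurable_EFinP.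
have r0e s : (0 <= (r s)%:E)%E by rewrite lee_fin.
pose q : {measure set W -> \bar R} :=
  measure_function_pushforward__canonical__measure_function_Measure (density mu r0e mre) mp.
have qfin : (q setT < +oo)%E by rewrite /q /= /pushforward /density preimage_setT.
(* Restriction to the whole space leaves the values unchanged and carries the structure of a finite
   measure. *)
pose Q : {finite_measure set W -> \bar R} := mfrestr measurableT qfin.
exists Q => G mG G0.
rewrite (_ : (\int[Q]_x G x = \int[q]_x G x)%E); last first.
  by apply: eq_measure_integral => A mA _; rewrite /Q /= /mfrestr /mrestr setIT.
rewrite (ge0_integral_pushforward mp (density mu r0e mre) measurableT)//.
rewrite preimage_setT (integral_density (mu := mu) (r := fun s => (r s)%:E))//.
- exact: (measurableT_comp mG mp).
- by move=> s; exact: G0.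
Qed.

Section cross_section.
Context {R : realType} dS (S : measurableType dS)
  (mu : {sigma_finite_measure set S -> \bar R}).
Variables (phi : R -> S -> S) (rho : R -> S -> R).
Hypothesis hphi : measurable_flow phi.
Hypothesis hrho : flow_density mu phi rho.
Hypothesis hns : nonsingular mu phi.
Variable f0 : S -> R.
Hypothesis f00 : forall s, 0 <= f0 s.
Hypothesis mf0 : measurable_fun [set: S] f0.
Notation lambda := (@lebesgue_measure R).
Notation line := (measurableTypeR R).
Notation mass := (flow_mass phi rho f0).
Hypothesis mass_fin : {ae mu, forall s, (mass s < +oo)%E}.
Hypothesis mass_gt0 : {ae mu, forall s, (0 < mass s)%E}.
Hypothesis f0_fin : (\int[mu]_s (f0 s)%:E < +oo)%E.

(* The junk value [1] is taken on a null set, so that [weight] is positive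
   everywhere. *)
Definition weight s : R := if (0 < mass s < +oo)%E then fine (mass s) else 1.

Lemma weight_gt0 s : 0 < weight s.
Proof. by rewrite /weight; case: ifP => // h; exact: fine_gt0. Qed.

Lemma measurable_weight : measurable_fun [set: S] weight.
Proof.
have mm := measurable_flow_mass hphi hrho f00 mf0.
apply: measurable_fun_ifT.
- apply: measurable_and; apply: measurable_fun_lte => //; exact: measurable_cst.
- exact: (measurableT_comp (fine_measurable measurableT) mm).
- exact: measurable_cst.
Qed.

Lemma weight_ae : {ae mu, forall s, (weight s)%:E = mass s}.
Proof.
apply: filterS2 mass_fin mass_gt0 => s h1 h2.
by rewrite /weight h1 h2 /= fineK// ge0_fin_numE// ltW.
Qed.

Lemma weight_flow u : {ae mu, forall s, weight s = weight (phi u s) * rho u s}.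
Proof.
have h1 := flow_mass_flow hphi hrho f00 mf0 mass_fin u.
have h2 := ae_flow hphi hns u weight_ae.
apply: filterS3 h1 h2 weight_ae => s h1 h2 h3.
by apply: EFin_inj; rewrite h3 h1 -h2 -EFinM.
Qed.

Lemma integral_weight (H : S -> \bar R) : measurable_fun [set: S] H ->
  (forall s, 0 <= H s)%E ->
  (\int[mu]_s (H s * (weight s)%:E) =
   \int[mu]_s ((f0 s)%:E * orbit_integral phi H s))%E.
Proof.
move=> mH H0; have mm := measurable_flow_mass hphi hrho f00 mf0.
have mw : measurable_fun [set: S] (fun s => (weight s)%:E).
  exact/measurable_EFinP/measurable_weight.
rewrite -(integral_flow_mass hphi hrho f00 mf0 mH H0).
apply: (ge0_ae_eq_integral measurableT).
- exact: emeasurable_funM.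
- exact: emeasurable_funM.
- by move=> s _; rewrite mule_ge0// lee_fin ltW// weight_gt0.
- by move=> s _; rewrite mule_ge0// (flow_mass_ge0 hrho f00).
- by apply: filterS weight_ae => s -> _.
Qed.

(** For each [u], the mass transforms under [phi u] only almost everywhere. The orbit integral of
    [share] contains no density, so translation invariance of Lebesgue measure makes it exactly
    invariant, at every point and for every time. *)
Definition share s : R := f0 s / weight s.

Lemma share_ge0 s : 0 <= share s.
Proof. by rewrite divr_ge0// ltW// weight_gt0. Qed.

Lemma measurable_share : measurable_fun [set: S] share.
Proof.
apply: measurable_funM => //.
rewrite (_ : (fun s => _) = fun s => weight s `^ (-1)).
  exact: (measurableT_comp (measurable_powR (-1)) measurable_weight).
by apply/funext => s; rewrite powR_inv1// ltW// weight_gt0.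
Qed.

Definition orbit_share := orbit_integral phi (fun s => (share s)%:E).

Definition proper_orbit : set S := [set s | (0 < orbit_share s < +oo)%E].

Let mse : measurable_fun [set: S] (fun s => (share s)%:E).
Proof. exact/measurable_EFinP/measurable_share. Qed.

Let se0 s : (0 <= (share s)%:E)%E. Proof. by rewrite lee_fin share_ge0. Qed.

Let measurable_orbit_share : measurable_fun [set: S] orbit_share.
Proof. exact: measurable_orbit_integral. Qed.

Lemma proper_orbit_flow v s : proper_orbit (phi v s) <-> proper_orbit s.
Proof. by rewrite /proper_orbit /= /orbit_share orbit_integral_flow. Qed.

Lemma measurable_proper_orbit : measurable proper_orbit.
Proof.
rewrite (_ : proper_orbit = (fun s => (0 < orbit_share s < +oo)%E) @^-1` [set true])//.
rewrite -[X in measurable X]setTI.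
suff : measurable_fun setT (fun s => (0 < orbit_share s < +oo)%E) by apply.
by apply: measurable_and; apply: measurable_fun_lte => //; exact: measurable_cst.
Qed.

Let orbit_null s : {ae lambda, forall t : line, f0 (phi t s) = 0} -> mass s = 0%E.
Proof.
move=> h; rewrite /flow_mass; transitivity (\int[lambda]_(t in [set: line]) (cst 0%E t))%E.
  apply: ge0_ae_eq_integral => //.
  - apply/measurable_EFinP; apply: measurable_funM.
      apply: (measurableT_comp mf0).
      exact: (measurable_flow_pair hphi (@measurable_id _ line _) (measurable_cst s)).
    exact: (measurable_density_pair hrho (@measurable_id _ line _) (measurable_cst s)).
  - by move=> t _; case: hrho => _ r0 _; rewrite lee_fin mulr_ge0.
  - by apply: filterS h => t -> _; rewrite mul0r.
exact: integral0.
Qed.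

(** The integral of [f0 * orbit_share] equals that of [share * weight = f0], which is finite; so
    [orbit_share] is finite wherever [f0] is nonzero. Since the mass is positive, almost every orbit
    meets such points, and [orbit_share] is constant along it. Were it zero, [f0] would vanish
    almost everywhere on the orbit and the mass with it. *)
Lemma ae_proper_orbit : {ae mu, forall s, proper_orbit s}.
Proof.
have f0e s : (0 <= (f0 s)%:E)%E by rewrite lee_fin.
have mfe : measurable_fun [set: S] (fun s => (f0 s)%:E) by exact/measurable_EFinP.
have fin1 : (\int[mu]_s ((f0 s)%:E * orbit_share s) < +oo)%E.
  rewrite -(integral_weight mse se0); apply: le_lt_trans f0_fin.
  rewrite le_eqVlt; apply/orP; left; apply/eqP; apply: eq_integral => s _.
  by rewrite -EFinM divfK// gt_eqF// weight_gt0.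
have O0 s : (0 <= orbit_share s)%E by exact: orbit_integral_ge0.
have h1 := ge0_integral_lty_ae (emeasurable_funM mfe measurable_orbit_share)
  (fun s => mule_ge0 (f0e s) (O0 s)) fin1.
have h2 : {ae mu, forall s, orbit_share s = +oo%E -> f0 s = 0}.
  apply: filterS h1 => s + os; rewrite os; have [//|f0s] := eqVneq (f0 s) 0.
  by rewrite gt0_muley// lte_fin lt_neqAle eq_sym f0s f00.
have h3 := ae_flow_ae hphi hns h2.
apply: filterS2 mass_gt0 h3 => s mgt h.
rewrite /proper_orbit /= lt0e O0 andbT; apply/andP; split.
  apply/eqP => os; move: mgt; rewrite orbit_null ?ltxx//.
  have mo : measurable_fun [set: line] (fun t : line => (share (phi t s))%:E).
    exact: (measurable_orbit hphi s mse).
  have := (ge0_integral_eq0P lambda mo (fun t => se0 _)).1 os.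
  apply: filterS => t [] /eqP; rewrite mulf_eq0 invr_eq0 [X in _ || X]gt_eqF ?weight_gt0//.
  by rewrite orbF => /eqP.
rewrite ltey; apply/eqP => os; move: mgt; rewrite orbit_null ?ltxx//.
by apply: filterS h => t; apply; rewrite /orbit_share orbit_integral_flow.
Qed.

(* The sign makes [tau] increase along the flow; off the proper orbits, which are
   conull, [0] is a junk value. *)
Definition tau s : R :=
  if (0 < orbit_share s < +oo)%E then - median (fun u => (share (phi u s))%:E) else 0.

Lemma tauE s : proper_orbit s -> tau s = - median (fun u => (share (phi u s))%:E).
Proof. by move=> ps; rewrite /tau ifT. Qed.

Lemma tau_flow v s : proper_orbit s -> tau (phi v s) = tau s + v.
Proof.
move=> ps; have pv := (proper_orbit_flow v s).2 ps.
rewrite (tauE pv) (tauE ps).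
rewrite (_ : (fun u => _) = fun u => (share (phi (v + u) s))%:E); last first.
  by apply/funext => u; case: hphi => _ phiD _; rewrite -phiD addrC.
move/andP : ps => [p1 p2].
rewrite (median_shift (h := fun u => (share (phi u s))%:E))//.
  by rewrite opprB addrC.
exact: (measurable_orbit hphi s mse).
Qed.

Lemma measurable_tau : measurable_fun [set: S] (tau : S -> line).
Proof.
pose tau' s := if (0 < orbit_share s < +oo)%E
  then median (fun u => (share (phi u s))%:E) else 0.
suff m : measurable_fun [set: S] tau'.
  rewrite (_ : tau = fun s => - tau' s); first exact: (measurableT_comp (@oppr_measurable R setT) m).
  by apply/funext => s; rewrite /tau /tau'; case: ifP; rewrite ?oppr0.
apply: (measurability _ (RGenInftyO.measurableE R)) => _ [_ [x ->] <-]; rewrite setTI.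
have mP := measurable_proper_orbit.
pose A q := [set s | (2^-1%:E * orbit_share s <=
    head_integral (fun u => (share (phi u s))%:E) (ratr q))%E].
have mA q : measurable (A q).
  rewrite -[A q]setTI.
  suff : measurable_fun setT (fun s => 2^-1%:E * orbit_share s <=
    head_integral (fun u => (share (phi u s))%:E) (ratr q))%E by move=> /(_ measurableT [set true]); apply.
  apply: measurable_fun_lee; first by apply: emeasurable_funM.
  rewrite (_ : (fun s => _) = fun s =>
    (\int[lambda]_u ((share (phi u s))%:E * (\1_`]-oo, (ratr q)] u)%:E))%E); last first.
    apply/funext => s; rewrite /head_integral integral_mkcond.
    by apply: eq_integral => u _; rewrite epatch_indic.
  apply: (@measurable_integral R _ S _ line lambda
    (fun s (u : line) => ((share (phi u s))%:E * (\1_`]-oo, (ratr q)] u)%:E)%E)).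
    apply: emeasurable_funM.
      exact: (measurableT_comp mse (measurable_flow_pair hphi measurable_snd measurable_fst)).
    apply/measurable_EFinP; apply: (measurableT_comp _ measurable_snd).
    by apply: measurable_indic; exact: measurable_itv.
  by move=> s u; rewrite mule_ge0// lee_fin indicE.
rewrite (_ : tau' @^-1` `]-oo, x[ =
  (proper_orbit `&` \bigcup_(q in [set q : rat | ratr q < x]) A q) `|`
  (~` proper_orbit `&` [set s | 0 < x])); last first.
  apply/seteqP; split => s; rewrite /preimage /= in_itv/= /tau'.
    case: ifP => ps; last by move=> ?; right; split => //; rewrite /proper_orbit /= ps.
    have [p1 p2] := andP ps.
    move/(median_ltP (measurable_orbit hphi s mse) (fun u => se0 _) p1 p2) => [q qx hq].
    by left; split => //; exists q.
  case=> -[ps h]; last by rewrite ifF//; apply/negP.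
  rewrite /proper_orbit /= in ps; rewrite ps; have [p1 p2] := andP ps.
  apply/(median_ltP (measurable_orbit hphi s mse) (fun u => se0 _) p1 p2).
  by case: h => q /= qx hq; exists q.
apply: measurableU; apply: measurableI => //.
- rewrite bigcup_mkcond; apply: bigcupT_measurable_rat => q; by case: ifP.
- exact: measurableC.
- have [x0|x0] := pselect (0 < x).
    by rewrite (_ : [set s | 0 < x] = setT)//; apply/seteqP; split.
  by rewrite (_ : [set s | 0 < x] = set0)//; apply/seteqP; split.
Qed.

(** The point of the orbit of [s] at which [tau] vanishes. *)
Definition base s : S := phi (- tau s) s.

Lemma flow_base s : phi (tau s) (base s) = s.
Proof. exact: flowVK. Qed.

Lemma base_flow v s : proper_orbit s -> base (phi v s) = base s.
Proof.
move=> ps; rewrite /base tau_flow//; case: hphi => _ phiD _.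
by rewrite -phiD opprD -addrA addNr addr0.
Qed.

Lemma measurable_base : measurable_fun [set: S] base.
Proof.
apply: (measurable_flow_pair hphi (u := fun s => - tau s : line)) => //.
exact: (measurableT_comp (@oppr_measurable R setT) measurable_tau).
Qed.

Definition cross s : S * line := (base s, tau s).

Lemma measurable_cross : measurable_fun [set: S] cross.
Proof. exact: (measurable_fun_pair measurable_base measurable_tau). Qed.

(** [Q] is the image of the finite measure [f0 * mu] under [base]. By [integral_weight] the
    right-hand side is the integral of [f0 s] times that of [G (base s, tau s + v)] over [v], and
    the translation by [tau s] disappears. *)
Lemma cross_measure_exists : exists Q : {sigma_finite_measure set S -> \bar R},
  forall G : S * line -> \bar R, measurable_fun [set: S * line] G ->
    (forall x, 0 <= G x)%E ->
    (\int[(Q \x lambda)%E]_x G x = \int[mu]_s (G (cross s) * (weight s)%:E))%E.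
Proof.
have [Q QE] := finite_image_density measurable_base mf0 f00 f0_fin.
exists Q => G mG G0.
have mc : measurable_fun [set: S] (fun s => G (cross s)).
  exact: (measurableT_comp mG measurable_cross).
rewrite (fubini_tonelli1 _ mG G0) (integral_weight mc (fun s => G0 _)).
have mF := measurable_fun_fubini_tonelli_F (m2 := lambda) _ mG G0.
rewrite QE//; last by move=> x; exact: integral_ge0.
have mO : measurable_fun [set: S] (orbit_integral phi (fun s => G (cross s))).
  exact: measurable_orbit_integral.
have mfe : measurable_fun [set: S] (fun s => (f0 s)%:E) by exact/measurable_EFinP.
apply: (ge0_ae_eq_integral measurableT).
- by apply: emeasurable_funM => //; exact: (measurableT_comp mF measurable_base).
- exact: emeasurable_funM.
- by move=> s _; rewrite mule_ge0 ?lee_fin//; exact: integral_ge0.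
- by move=> s _; rewrite mule_ge0 ?lee_fin//; exact: integral_ge0.
apply: filterS ae_proper_orbit => s ps _; rewrite muleC; congr (_ * _)%E.
rewrite /fubini_F /orbit_integral -[LHS](lebesgue_integralD (tau s)).
- by apply: eq_integral => v _; rewrite /cross base_flow// tau_flow.
- exact: (measurableT_comp mG (measurable_fun_pair (measurable_cst (base s)) (@measurable_id _ line _))).
- by move=> u; exact: G0.
Qed.

End cross_section.

(** * Cocycles along the cross-section *)

Section lebesgue_ae.
Context {R : realType}.
Notation lambda := (@lebesgue_measure R).
Notation line := (measurableTypeR R).

Lemma ae_lebesgueD (a : R) (Q : line -> Prop) : {ae lambda, forall x, Q x} ->
  {ae lambda, forall x : line, Q (a + x)}.
Proof.
move=> [A [mA A0 QA]].
have mo : measurable_fun [set: line] (fun x : line => (a + x)%R : line).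
  by apply: measurable_funD => //; exact: measurable_cst.
have mA' : measurable [set x : line | A (a + x)].
  by rewrite -[X in measurable X]setTI; exact: mo.
exists [set x : line | A (a + x)]; split => //; last by move=> x; exact: QA.
rewrite -[RHS]A0 -[in RHS](setIT A) -[RHS](integral_indic lambda measurableT mA).
rewrite -[RHS](lebesgue_integralD a (G := fun x => (\1_A x : R)%:E)).
- by rewrite -(setIT [set x | _]) -(integral_indic lambda measurableT mA').
- exact/measurable_EFinP/measurable_indic.
- by move=> x; rewrite lee_fin indicE.
Qed.

Lemma ae_lebesgue_ex (Q : line -> Prop) : {ae lambda, forall x, Q x} -> exists x, Q x.
Proof.
move=> [A [mA A0 QA]]; apply: contrapT => /forallNP nQ.
have : (lambda `]0%R, 1%R]%classic <= lambda A)%E.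
  by apply: le_measure; rewrite ?inE//; move=> x _; apply: QA; exact: nQ.
rewrite lebesgue_measure_itv/= lte_fin ltr01 -EFinB subr0.
rewrite [X in (_ <= X)%E -> _](_ : _ = 0%E)//.
by rewrite lee_fin ler10.
Qed.

End lebesgue_ae.

Lemma measurable_scalar_eq (R : realType) (k : scalar_kind) d (T : measurableType d)
    (f g : T -> scalarType R k) : scalar_measurable f -> scalar_measurable g ->
  measurable [set x | f x = g x].
Proof.
move=> mf mg; have m := modulus_measurable (scalar_measurableB mf mg).
rewrite (_ : [set x | _] = (fun x => modulus (f x - g x)) @^-1` [set 0]).
  by rewrite -[X in measurable X]setTI; exact: m.
apply/seteqP; split => x /=; first by move=> ->; rewrite subrr modulus0.
by move=> /eqP; rewrite modulus_eq0 subr_eq0 => /eqP.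
Qed.

Section cocycle_trivialization.
Context {R : realType} {k : scalar_kind} dS (S : measurableType dS)
  (mu : {sigma_finite_measure set S -> \bar R}).
Variables (phi : R -> S -> S).
Hypothesis hphi : measurable_flow phi.
Hypothesis hns : nonsingular mu phi.
Notation K := (scalarType R k).
Variable a : R -> S -> K.
Hypothesis ha : cocycle mu phi a.
Notation lambda := (@lebesgue_measure R).
Notation line := (measurableTypeR R).
Variable tau : S -> R.
Hypothesis mtau : measurable_fun [set: S] (tau : S -> line).
Hypothesis tau_flow : {ae mu, forall s, forall v, tau (phi v s) = tau s + v}.

Let b (r : R) s : K := a (r - tau s) s.

(* For each [t], [trivializes r t s] holds for almost all [(r, s)]; by Fubini one
   [r] works for almost every [t], and the good [t] form a group, so it works for
   every [t]. *)
Let trivializes r t s := b r s = a t s * b r (phi t s).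

Let measurable_cocycle_pair dX (X : measurableType dX) (u : X -> line) (v : X -> S) :
  measurable_fun [set: X] u -> measurable_fun [set: X] v ->
  scalar_measurable (fun x => a (u x) (v x)).
Proof.
case: ha => ma _ _ mu' mv.
exact: (scalar_measurable_comp ma (measurable_fun_pair mu' mv)).
Qed.

Let measurable_b dX (X : measurableType dX) (u : X -> line) (v : X -> S) :
  measurable_fun [set: X] u -> measurable_fun [set: X] v ->
  scalar_measurable (fun x => b (u x) (v x)).
Proof.
move=> mu' mv; apply: measurable_cocycle_pair => //.
by apply: measurable_funB => //; exact: (measurableT_comp mtau mv).
Qed.

Let measurable_trivializes dX (X : measurableType dX) (u w : X -> line) (v : X -> S) :
  measurable_fun [set: X] u -> measurable_fun [set: X] w ->
  measurable_fun [set: X] v -> measurable [set x | trivializes (u x) (w x) (v x)].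
Proof.
move=> mu' mw mv; apply: measurable_scalar_eq; first exact: measurable_b.
apply: scalar_measurableM; first exact: measurable_cocycle_pair.
by apply: measurable_b => //; exact: (measurable_flow_pair hphi).
Qed.

(** This is the cocycle relation at [t1 = r - tau s - t], read with [tau (phi t s) = tau s + t]. As
    this [t1] depends on [s], the relation is first converted by Fubini into one valid for almost
    every [s] and almost every [t1]. *)
Let ae_trivializes t : {ae lambda, forall r : line, {ae mu, forall s, trivializes r t s}}.
Proof.
apply: (@ae_swap _ _ _ _ _ mu lambda (fun s r => trivializes r t s)).
  by apply: measurable_trivializes => //; exact: measurable_cst.
pose C s (t1 : line) := a (t1 + t) s = a t s * a t1 (phi t s).
have mC : measurable [set p : line * S | C p.2 p.1].
  apply: measurable_scalar_eq.
    apply: measurable_cocycle_pair => //.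
    by apply: measurable_funD => //; exact: measurable_cst.
  apply: scalar_measurableM; apply: measurable_cocycle_pair => //.
  by apply: (measurable_flow_pair hphi) => //; exact: measurable_cst.
have CC : {ae lambda, forall t1 : line, {ae mu, forall s, C s t1}}.
  by apply: aeW => t1; case: ha => _ _ /(_ t1 t).
apply: filterS2 tau_flow (ae_swap mC CC) => s ts Cs.
apply: filterS (ae_lebesgueD (- tau s - t) Cs) => r.
rewrite /C /trivializes /b ts (_ : - tau s - t + r + t = r - tau s); last by ring.
by rewrite (_ : - tau s - t + r = r - (tau s + t)); last by ring.
Qed.

Lemma cocycle_trivial : exists2 b : S -> K, scalar_measurable b &
  (forall s, modulus (b s) = 1) /\
  (forall t, {ae mu, forall s, b s = a t s * b (phi t s)}).
Proof.
(* [I t r] vanishes exactly when [r] works for [t], which makes this a measurable condition on the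
   pair. *)
pose I (t r : line) : \bar R :=
  (\int[mu]_s (\1_[set x : line * line * S | ~ trivializes x.1.2 x.1.1 x.2] (t, r, s) : R)%:E)%E.
have mN : measurable [set x : line * line * S | ~ trivializes x.1.2 x.1.1 x.2].
  apply: measurableC; apply: measurable_trivializes.
  - exact: (measurableT_comp measurable_snd measurable_fst).
  - exact: (measurableT_comp measurable_fst measurable_fst).
  - exact: measurable_snd.
have mI : measurable_fun [set: line * line] (fun p => I p.1 p.2).
  apply: (@measurable_integral R _ _ _ S mu (fun (p : line * line) s =>
    (\1_[set x : line * line * S | ~ trivializes x.1.2 x.1.1 x.2] (p.1, p.2, s) : R)%:E)).
    apply/measurable_EFinP.
    rewrite (_ : (fun p => _) = \1_[set x : line * line * S | ~ trivializes x.1.2 x.1.1 x.2]).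
      exact: measurable_indic.
    by apply/funext => -[[p1 p2] s].
  by move=> p s; rewrite lee_fin indicE.
have IP t r : {ae mu, forall s, trivializes r t s} <-> I t r = 0%E.
  have := @ge0_integral_eq0P _ S R mu (fun s =>
    (\1_[set x : line * line * S | ~ trivializes x.1.2 x.1.1 x.2] (t, r, s) : R)%:E).
  have m : measurable_fun [set: S] (fun s =>
    (\1_[set x : line * line * S | ~ trivializes x.1.2 x.1.1 x.2] (t, r, s) : R)%:E).
    apply/measurable_EFinP; apply: (measurableT_comp (measurable_indic mN)).
    by apply: measurable_fun_pair => //; exact: measurable_cst.
  move=> /(_ m) H; rewrite /I H; last by move=> s; rewrite lee_fin indicE.
  split; apply: filterS => s h.
    by rewrite indicE memNset//= => n; exact: n.
  apply: contrapT => n; move: h; rewrite indicE mem_set//= => -[] /eqP.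
  by rewrite oner_eq0.
have mA : measurable [set p : line * line | I p.1 p.2 = 0%E].
  rewrite -[X in measurable X]setTI.
  exact: (mI measurableT _ (emeasurable_set1 0%E)).
have HA : {ae lambda, forall t : line, {ae lambda, forall r : line, I t r = 0%E}}.
  by apply: aeW => t; apply: filterS (ae_trivializes t) => r /IP.
have [r Hr] := ae_lebesgue_ex (ae_swap mA HA).
have {}Hr : {ae lambda, forall t : line, {ae mu, forall s, trivializes r t s}}.
  by apply: filterS Hr => t /IP.
exists (b r).
  by apply: (measurable_b (u := fun=> r)) => //; exact: measurable_cst.
split => [s|t]; first by case: ha => _ -> .
(* Both [t1] and [t - t1] are good for almost every [t1], so any [t] is a sum of two good times. *)
have [t1 [h1 h2]] : exists t1 : line, {ae mu, forall s, trivializes r t1 s} /\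
    {ae mu, forall s, trivializes r (t - t1) s}.
  apply: (ae_lebesgue_ex (Q := fun t1 => _ /\ _)).
  have HN : {ae lambda, forall t1 : line, {ae mu, forall s, trivializes r (- t1) s}}.
    move: Hr => [A [mA' A0 QA]]; exists (-%R @^-1` A); split.
    - by rewrite -[X in measurable X]setTI; exact: (@oppr_measurable R setT).
    - by rewrite -[RHS]A0; exact: lebesgue_measureN.
    - by move=> x; exact: QA.
  have := ae_lebesgueD (- t) HN.
  apply: filterS2 Hr => t1 h1; rewrite (_ : - (- t + t1) = t - t1)//; ring.
have h3 := ae_flow hphi hns t1 h2.
have h4 : {ae mu, forall s, a (t - t1 + t1) s = a t1 s * a (t - t1) (phi t1 s)}.
  by case: ha => _ _; exact.
apply: filterS3 h1 h3 h4 => s; rewrite /trivializes subrK => -> -> ->.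
by rewrite mulrA; case: hphi => _ phiD _; rewrite -phiD subrK.
Qed.

End cocycle_trivialization.

(** * Riemann integrals of kernels *)

Lemma equal_partition (R : realType) (h : R) n (a : R) : 0 < h ->
  exists2 x, itv_partition a (a + n%:R * h) x &
    forall i, (i < size x)%N -> nth 0 x i - nth 0 (a :: x) i = h.
Proof.
move=> h0; elim: n a => [|n IHn] a.
  by exists [::] => //; split => //=; rewrite mul0r addr0.
have [x [px lx] hx] := IHn (a + h); exists ((a + h) :: x).
  split; first by rewrite /= px andbT ltrDl.
  by rewrite /= (eqP lx); apply/eqP; rewrite -natr1; ring.
case=> [_|i ix]; first by rewrite /= addrC addKr.
exact: (hx i ix).
Qed.

(** The definition of the Riemann integral constrains [J] only through partitions of small mesh;
    this supplies one, equally spaced and tagged at left endpoints, or empty when [a = b]. *)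
Lemma fine_partition (R : realType) (a b delta : R) : a <= b -> 0 < delta ->
  exists (x : seq R) (xi : nat -> R), itv_partition a b x /\
    forall i, (i < size x)%N ->
      nth 0 (a :: x) i <= xi i <= nth 0 x i /\ nth 0 x i - nth 0 (a :: x) i < delta.
Proof.
move=> ab d0; have [<-|ab'] := eqVneq a b.
  by exists [::], (fun=> 0); split => //; split.
have ba : 0 < b - a by rewrite subr_gt0 lt_neqAle ab' ab.
pose n := Num.bound ((b - a) / delta).
have nd : (b - a) / delta < n%:R by rewrite archi_boundP// divr_ge0// ltW.
have n0 : 0 < n%:R :> R by rewrite (le_lt_trans _ nd)// divr_ge0// ltW.
have h0 : 0 < (b - a) / n%:R by rewrite divr_gt0.
have [x px hx] := equal_partition n a h0.
exists x, (fun i => nth 0 (a :: x) i); split.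
  by move: px; rewrite mulrCA divff ?gt_eqF// mulr1 subrKC.
move=> i ix; have hxi := hx i ix; split.
  by rewrite lexx/= -subr_ge0 hxi ltW.
by rewrite hxi ltr_pdivrMr// mulrC -ltr_pdivrMr.
Qed.

Section riemann.
Context {R : realType} {k : scalar_kind} (alpha : R).
Hypothesis alpha_gt0 : 0 < alpha.
Context d (S : measurableType d) (mu : {measure set S -> \bar R}).
Notation K := (scalarType R k).
Implicit Types (c : R -> S -> K) (J : S -> K).

Lemma riemann_sum_measurable c a x xi : (forall t, scalar_measurable (c t)) ->
  scalar_measurable (riemann_sum c a x xi).
Proof.
by move=> mc; apply: scalar_measurable_sum => i; exact: scalar_measurableZ.
Qed.

(** On [Z] each Riemann sum vanishes almost everywhere, so there [J] is minus the error of the sum,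
    whose mass is below any [e]. *)
Lemma riemann_integral_null c a b J (Z : set S) : measurable Z -> a <= b ->
  (forall t, scalar_measurable (c t)) ->
  (forall t, {ae mu, forall s, Z s -> c t s = 0}) ->
  is_riemann_integral alpha mu a b c J -> {ae mu, forall s, Z s -> J s = 0}.
Proof.
move=> mZ ab mc cZ [Jin HJ].
have mJZ : scalar_measurable (fun s => J s * \1_Z s).
  by apply: scalar_measurableM; [exact: Jin.1|exact: scalar_measurable_indic].
have : Lalpha_mass alpha mu (fun s => J s * \1_Z s) = 0%E.
  apply/eqP; rewrite eq_le Lalpha_mass_ge0 andbT; apply/lee_addgt0Pr => e e0.
  have [delta d0 H] := HJ e e0; have [x [xi [px hx]]] := fine_partition ab d0.
  have := ltW (H x xi px hx); rewrite add0e Lalpha_distE; apply: le_trans.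
  have mr := riemann_sum_measurable a x xi mc.
  pose D s := (riemann_sum c a x xi s - J s) * \1_Z s.
  have mD : scalar_measurable D.
    apply: scalar_measurableM; last exact: scalar_measurable_indic.
    exact: scalar_measurableB mr Jin.1.
  rewrite (_ : Lalpha_mass alpha mu (fun s => J s * \1_Z s) = Lalpha_mass alpha mu D).
    apply: (Lalpha_mass_le alpha_gt0 mu mD (scalar_measurableB mr Jin.1)) => s.
    rewrite /D modulusM indicE; case: (s \in Z); rewrite ?modulus1 ?mulr1//.
    by rewrite modulus0 mulr0 modulus_ge0.
  rewrite (_ : Lalpha_mass alpha mu D = Lalpha_mass alpha mu (fun s => - D s)); last first.
    by apply: Lalpha_mass_eq => s; rewrite modulusN.
  apply: eq_Lalpha_mass => //.
    rewrite (_ : (fun s => - D s) = fun s => -1 * D s); first exact: scalar_measurableZ.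
    by apply/funext => s; rewrite mulN1r.
  have : {ae mu, forall s, forall i : 'I_(size x), Z s -> c (xi i) s = 0}.
    by apply: filter_forall => i; exact: cZ.
  apply: filterS => s cs; rewrite /D indicE; case: (boolP (s \in Z)) => [/set_mem Zs|_].
    rewrite !mulr1 /riemann_sum big1 ?sub0r ?opprK// => i _.
    by rewrite cs// mulr0.
  by rewrite !mulr0 oppr0.
move/(ge0_integral_eq0P mu (modulus_powR_emeasurable alpha mJZ)) => H.
apply: filterS (H _) => [s h Zs|s]; last by rewrite lee_fin powR_ge0.
move: h => -[] /eqP; rewrite powR_eq0 (negPf (lt0r_neq0 alpha_gt0)) andbT.
by rewrite modulus_eq0 indicE mem_set// mulr1 => /eqP.
Qed.

Section pull.
Context dW (W : measurableType dW) (nu : {measure set W -> \bar R}).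
Variables (psi : S -> W) (m : S -> K).
Hypothesis mpsi : measurable_fun [set: S] psi.
Hypothesis mm : scalar_measurable m.
Hypothesis change : forall G : W -> \bar R, measurable_fun [set: W] G ->
  (forall x, 0 <= G x)%E ->
  (\int[nu]_x G x = \int[mu]_s (G (psi s) * (modulus (m s) `^ alpha)%:E))%E.
Variables (C : R -> S -> K) (C' : R -> W -> K).
Hypothesis mC : forall t, scalar_measurable (C t).
Hypothesis mC' : forall t, scalar_measurable (C' t).
Hypothesis CC' : forall t, {ae mu, forall s, pull psi m (C' t) s = C t s}.

(** As [pull] is an isometry, only the sums have to correspond; a Riemann sum has finitely many
    tags, and the null sets attached to them have a null union. *)
Lemma riemann_integral_pull a b J (J' : W -> K) : scalar_measurable J' ->
  {ae mu, forall s, pull psi m J' s = J s} ->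
  is_riemann_integral alpha mu a b C J -> is_riemann_integral alpha nu a b C' J'.
Proof.
move=> mJ' JJ' [Jin HJ].
have mpJ := pull_measurable mpsi mm mJ'.
split.
  apply/(pull_in_Lalpha mpsi mm change mJ')/in_LalphaP; split => //.
  by rewrite (eq_Lalpha_mass alpha mpJ Jin.1 JJ'); case: Jin.
move=> e e0; have [delta d0 H] := HJ e e0; exists delta => // x xi px hx.
have mr' : scalar_measurable (riemann_sum C' a x xi).
  by apply: scalar_measurable_sum => i; exact: scalar_measurableZ.
rewrite -(pull_dist change mr' mJ').
rewrite (_ : Lalpha_dist _ _ _ _ = Lalpha_dist alpha mu (riemann_sum C a x xi) J); first exact: H.
have mr := riemann_sum_measurable a x xi mC.
rewrite !Lalpha_distE; apply: eq_Lalpha_mass.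
- by apply: scalar_measurableB => //; exact: pull_measurable.
- exact: scalar_measurableB mr Jin.1.
have : {ae mu, forall s, forall i : 'I_(size x), pull psi m (C' (xi i)) s = C (xi i) s}.
  by apply: filter_forall => i; exact: CC'.
apply: filterS2 JJ' => s -> Cs; congr (_ - _).
rewrite /pull /riemann_sum mulr_sumr; apply: eq_bigr => i _.
by rewrite -Cs /pull mulrCA.
Qed.

Lemma oriented_integral_pull t J (J' : W -> K) : scalar_measurable J' ->
  {ae mu, forall s, pull psi m J' s = J s} ->
  is_oriented_integral alpha mu t C J -> is_oriented_integral alpha nu t C' J'.
Proof.
rewrite /is_oriented_integral => mJ' JJ'; case: ifP => _; first exact: riemann_integral_pull.
apply: riemann_integral_pull.
  rewrite (_ : (fun s => - J' s) = fun s => -1 * J' s); first exact: scalar_measurableZ.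
  by apply/funext => s; rewrite mulN1r.
by apply: filterS JJ' => s; rewrite /pull mulrN => ->.
Qed.

End pull.

Lemma oriented_integral_null t c J (Z : set S) : measurable Z ->
  (forall t, scalar_measurable (c t)) ->
  (forall t, {ae mu, forall s, Z s -> c t s = 0}) ->
  is_oriented_integral alpha mu t c J -> {ae mu, forall s, Z s -> J s = 0}.
Proof.
move=> mZ mc cZ; rewrite /is_oriented_integral; case: ifPn => [t0|].
  exact: riemann_integral_null.
rewrite -ltNge => /ltW t0 /(riemann_integral_null mZ t0 mc cZ).
by apply: filterS => s h Zs; apply: oppr_inj; rewrite oppr0 h.
Qed.

End riemann.

(** The time 0 is added as coordinate 0, and the increments are the image of the enlarged vector
    under a measurable map of tuples. *)
Lemma eq_fdd_increments (R : realType) (k : scalar_kind)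
    d (T : measurableType d) (P : probability T R) (X : R -> T -> scalarType R k)
    d' (T' : measurableType d') (P' : probability T' R) (Y : R -> T' -> scalarType R k) :
  eq_fdd P X P' Y ->
  eq_fdd P (fun t w => X t w - X 0 w) P' (fun t w => Y t w - Y 0 w).
Proof.
move=> XY n t B mB.
pose t' (j : 'I_n.+1) := if unlift ord0 j is Some i then t i else 0.
pose D (z : n.+1.-tuple (plane R)) : n.-tuple (plane R) :=
  [tuple ((tnth z (lift ord0 i)).1 - (tnth z ord0).1,
          (tnth z (lift ord0 i)).2 - (tnth z ord0).2) | i < n].
have mD : measurable_fun setT D.
  apply/measurable_fun_tnthP => i.
  rewrite (_ : _ \o D = fun z =>
    ((tnth z (lift ord0 i)).1 - (tnth z ord0).1,
     (tnth z (lift ord0 i)).2 - (tnth z ord0).2)); last first.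
    by apply/funext => z; rewrite /= tnth_mktuple.
  apply: measurable_fun_pair; apply: measurable_funB.
  - exact: (measurableT_comp measurable_fst (measurable_tnth _)).
  - exact: (measurableT_comp measurable_fst (measurable_tnth _)).
  - exact: (measurableT_comp measurable_snd (measurable_tnth _)).
  - exact: (measurableT_comp measurable_snd (measurable_tnth _)).
have mDB : measurable (D @^-1` B) by rewrite -[X in measurable X]setTI; exact: mD.
have E (U : Type) (Z : R -> U -> scalarType R k) :
    [set w | B [tuple coords (Z (t i) w - Z 0 w) | i < n]] =
    [set w | (D @^-1` B) [tuple coords (Z (t' j) w) | j < n.+1]].
  apply/funext => w; rewrite /preimage /=; congr (B _).
  apply: eq_from_tnth => i; rewrite !tnth_mktuple /t' liftK unlift_none.
  by rewrite /coords /= reD imD reN imN.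
by rewrite !E; exact: XY.
Qed.

(** * Moving averages *)

Section flow_kernel.
Context {R : realType} {k : scalar_kind} (alpha : R).
Hypothesis alpha_gt0 : 0 < alpha.
Hypothesis alpha_lt2 : alpha < 2.
Context dS (S : measurableType dS) (mu : {sigma_finite_measure set S -> \bar R}).
Notation K := (scalarType R k).
Notation lambda := (@lebesgue_measure R).
Notation line := (measurableTypeR R).
Variables (phi : R -> S -> S) (rho : R -> S -> R) (a : R -> S -> K) (g0 : S -> K).
Hypothesis hphi : measurable_flow phi.
Hypothesis hns : nonsingular mu phi.
Hypothesis hrho : flow_density mu phi rho.
Hypothesis ha : cocycle mu phi a.
Hypothesis hg0 : in_Lalpha alpha mu g0.
Hypothesis hdis : dissipative alpha mu phi rho g0.
Notation h := (transported alpha phi rho a g0).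
Notation f0 := (fun s => modulus (g0 s) `^ alpha).
Notation mass := (flow_mass phi rho f0).

Let f00 s : 0 <= f0 s. Proof. exact: powR_ge0. Qed.

Let mf0 : measurable_fun [set: S] f0.
Proof. exact: modulus_powR_measurable hg0.1. Qed.

Lemma measurable_transported t : scalar_measurable (h t).
Proof.
apply: scalar_measurableM; last first.
  exact: (scalar_measurable_comp hg0.1 (measurable_flow_map hphi t)).
apply: scalar_measurableM.
  case: ha => ma _ _.
  exact: (scalar_measurable_comp ma (measurable_fun_pair (measurable_cst (t : line)) (@measurable_id _ S setT))).
apply: scalar_measurable_ofR; apply: (measurableT_comp (measurable_powR _)).
exact: (measurable_density_pair hrho (measurable_cst (t : line)) (@measurable_id _ S setT)).
Qed.

Variables (J : R -> S -> K) (f : R -> S -> K).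
Hypothesis hJ : forall t, is_oriented_integral alpha mu t h (J t).
Hypothesis hf : forall t, {ae mu, forall s, f t s - f 0 s = h t s - g0 s + J t s}.
Hypothesis hfull : full_support mu (fun t s => f t s - f 0 s).

Let ae_mass_fin : {ae mu, forall s, (mass s < +oo)%E}.
Proof. exact: hdis. Qed.

Let f0_eq0 s : f0 s = 0 -> g0 s = 0.
Proof.
by move=> /eqP; rewrite powR_eq0 (negPf (lt0r_neq0 alpha_gt0)) andbT modulus_eq0 => /eqP.
Qed.

(* On the invariant set where the mass vanishes, [g0], every transported kernel
   and every Riemann sum of them vanish, so the full support excludes it. *)
Lemma ae_mass_gt0 : {ae mu, forall s, (0 < mass s)%E}.
Proof.
have mm := measurable_flow_mass hphi hrho f00 mf0.
pose Z := [set s | mass s = 0%E].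
have mZ : measurable Z.
  by rewrite -[X in measurable X]setTI; exact: (mm measurableT _ (emeasurable_set1 0%E)).
have g0Z : {ae mu, forall s, mass s = 0%E -> g0 s = 0}.
  apply: filterS (base_eq0 hphi hrho hns f00 mf0 ae_mass_fin) => s fs ms.
  by apply: f0_eq0; exact: fs.
have hZ t : {ae mu, forall s, Z s -> h t s = 0}.
  have h1 := ae_flow hphi hns t g0Z.
  have h2 := flow_mass_flow hphi hrho f00 mf0 ae_mass_fin t.
  have h3 := ae_density_gt0 hphi hrho hns t.
  apply: filterS3 h1 h2 h3 => s h1 h2 h3 Zs.
  rewrite /transported h1 ?mulr0//; apply/eqP; move: h2; rewrite Zs => /esym/eqP.
  by rewrite mule_eq0 => /orP[//|]; rewrite eqe gt_eqF.
have JZ t := oriented_integral_null alpha_gt0 mZ measurable_transported hZ (hJ t).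
have mN : measurable (~` Z) by exact: measurableC.
(* The increments vanish on [Z], so the complement of [Z] contains their supports and, by full
   support, [Z] is null. *)
have := hfull mN; rewrite setCK => Z0.
exists Z; split => //.
  apply: Z0 => t.
  have gJ : {ae mu, forall s, Z s -> g0 s = 0 /\ J t s = 0}.
    by apply: filterS2 g0Z (JZ t) => s h1 h2 Zs; split; [exact: h1|exact: h2].
  apply: filterS3 (hf t) (hZ t) gJ => s -> h1 h2 + Zs.
  by rewrite h1//; have [-> ->] := h2 Zs; rewrite addr0 subr0 eqxx.
move=> s /=; rewrite /Z /= => ms; apply/eqP; rewrite eq_le.
by rewrite (flow_mass_ge0 hrho f00) andbT leNgt; apply/negP.
Qed.

Notation w := (weight phi rho f0).

Let f0_fin : (\int[mu]_s (f0 s)%:E < +oo)%E. Proof. exact: hg0.2. Qed.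

(** The deterministic half of the theorem: up to the isometry [pull psi c], the increments of the
    spectral kernels are moving-average kernels. The random measure enters only when it is carried
    through this isometry. *)
Lemma moving_average_representation :
  exists (Q : {sigma_finite_measure set S -> \bar R}) (psi : S -> S * line)
    (c : S -> K) (g : S * line -> K) (J' : R -> S * line -> K),
    let nu := (Q \x lambda)%E in
    [/\ measurable_fun [set: S] psi /\ scalar_measurable c,
        (forall G, measurable_fun [set: S * line] G -> (forall x, 0 <= G x)%E ->
          \int[nu]_x G x = \int[mu]_s (G (psi s) * (modulus (c s) `^ alpha)%:E))%E,
        in_Lalpha alpha nu g,
        (forall t, is_oriented_integral alpha nu t
                     (fun (s : R) (xu : S * line) => g (xu.1, s + xu.2)) (J' t))
      & (forall t : R, scalar_measurable (fun xu : S * line => g (xu.1, t + xu.2) - g xu + J' t xu)) /\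
        (forall t : R, {ae mu, forall s,
           f t s - f 0 s = pull psi c (fun xu : S * line => g (xu.1, t + xu.2) - g xu + J' t xu) s})].
Proof.
have mgt := ae_mass_gt0.
have mtau := measurable_tau hphi hrho f00 mf0.
have tauf : {ae mu, forall s, forall v, tau phi rho f0 (phi v s) = tau phi rho f0 s + v}.
  apply: filterS (ae_proper_orbit hphi hrho hns f00 mf0 ae_mass_fin mgt f0_fin) => s ps v.
  exact: (tau_flow hphi hrho f00 mf0).
have [b mb [b1 bE]] := cocycle_trivial hphi hns ha mtau tauf.
have [Q QE] := cross_measure_exists hphi hrho hns f00 mf0 ae_mass_fin mgt f0_fin.
have mpsi := measurable_cross hphi hrho f00 mf0.
set psi := cross phi rho f0 in QE mpsi.
have w0 s : 0 < w s by exact: weight_gt0.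
have mw : measurable_fun [set: S] w := measurable_weight hphi hrho f00 mf0.
pose c s : K := b s * ofR k (w s `^ alpha^-1).
have mc : scalar_measurable c.
  apply: scalar_measurableM => //; apply: scalar_measurable_ofR.
  exact: (measurableT_comp (measurable_powR _) mw).
have cE s : modulus (c s) `^ alpha = w s.
  rewrite modulusM b1 mul1r modulus_ofR ger0_norm ?powR_ge0// -powRrM.
  by rewrite mulVf ?gt_eqF// powRr1// ltW.
have c0 s : c s != 0.
  rewrite -modulus_eq0; apply/eqP => c0; move: (w0 s); rewrite -cE c0.
  by rewrite powR0 ?ltxx// gt_eqF.
have change G : measurable_fun [set: S * line] G -> (forall x, 0 <= G x)%E ->
    (\int[(Q \x lambda)%E]_x G x =
     \int[mu]_s (G (psi s) * (modulus (c s) `^ alpha)%:E))%E.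
  by move=> mG G0; rewrite QE//; apply: eq_integral => s _; rewrite cE.
have mcV : scalar_measurable (fun s => (c s)^-1) by exact: scalar_measurableV.
(* The inverse of [pull]: the pair [(x, u)] stands for the point [phi u x], and dividing by [c]
   there makes [pull psi c (trans F) = F] hold everywhere. *)
pose trans (F : S -> K) (xu : S * line) : K := F (phi xu.2 xu.1) / c (phi xu.2 xu.1).
have mtrans F : scalar_measurable F -> scalar_measurable (trans F).
  move=> mF; have mp := measurable_flow_pair hphi (@measurable_snd _ _ S line) (@measurable_fst _ _ S line).
  by apply: scalar_measurableM; [exact: (scalar_measurable_comp mF mp)|exact: (scalar_measurable_comp mcV mp)].
have transE F s : pull psi c (trans F) s = F s.
  by rewrite /pull /trans /psi /cross /= flow_base// mulrCA divff// mulr1.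
pose g := trans g0.
have mg : scalar_measurable g by exact: mtrans hg0.1.
have mgt' t : scalar_measurable (fun xu : S * line => g (xu.1, t + xu.2)).
  apply: (scalar_measurable_comp mg); apply: measurable_fun_pair => //.
  by apply: measurable_funD => //; exact: measurable_cst.
have gtE t : {ae mu, forall s, pull psi c (fun xu => g (xu.1, t + xu.2)) s = h t s}.
  have h1 := bE t; have h2 := weight_flow hphi hrho hns f00 mf0 ae_mass_fin mgt t.
  apply: filterS2 h1 h2 => s h1 h2; rewrite /pull /g /trans /psi /cross /=.
  have -> : phi (t + tau phi rho f0 s) (base phi rho f0 s) = phi t s.
    by case: (hphi) => _ phiD _; rewrite phiD flow_base.
  have rho0 : 0 <= rho t s by case: hrho.
  (* The coboundary identity of [b] and the transformation rule of the weight combine: [c] carries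
     exactly the factor by which the transported kernel differs from [g0] composed with [phi t]. *)
  have -> : c s = a t s * ofR k (rho t s `^ alpha^-1) * c (phi t s).
    rewrite {1}/c h1.
    have -> : w s `^ alpha^-1 = w (phi t s) `^ alpha^-1 * rho t s `^ alpha^-1.
      by rewrite h2 powRM// ltW.
    by rewrite ofRM /c; ring.
  by rewrite /transported -mulrA; congr (_ * _); rewrite mulrCA divff// mulr1.
have mJ t : scalar_measurable (J t).
  have := hJ t; rewrite /is_oriented_integral; case: ifP => _ [[mJ _] _] //.
  rewrite (_ : J t = fun s => -1 * - J t s); first exact: scalar_measurableZ.
  by apply/funext => s; rewrite mulN1r opprK.
have gin : in_Lalpha alpha (Q \x lambda)%E g.
  apply/(pull_in_Lalpha mpsi mc change mg).
  by rewrite (_ : pull psi c g = g0)//; apply/funext => s; exact: transE.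
exists Q, psi, c, g, (fun t => trans (J t)); split => //.
- move=> t; apply: (oriented_integral_pull mpsi mc change
    measurable_transported mgt' gtE (mtrans _ (mJ t)) _ (hJ t)).
  by apply: aeW => s; exact: transE.
- split => [t|t].
    exact: (scalar_measurableD (scalar_measurableB (mgt' t) mg) (mtrans _ (mJ t))).
  apply: filterS2 (hf t) (gtE t) => s -> <-.
  by rewrite -{1}(transE g0 s) -{1}(transE (J t) s) /pull -mulrBr -mulrDr.
Qed.

End flow_kernel.

Theorem theorem2p11 (R : realType) (k : scalar_kind) (alpha : R)
    (alpha_gt0 : 0 < alpha) (alpha_lt2 : alpha < 2)
    (d : measure_display) (T : measurableType d) (P : probability T R)
    (X : R -> T -> scalarType R k)
    (dS : measure_display) (S : measurableType dS)
    (mu : {sigma_finite_measure set S -> \bar R})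
    (phi : R -> S -> S) (rho : R -> S -> R) (g0 : S -> scalarType R k) :
  measurable_process X ->
  SaS_process alpha P X ->
  stationary_increments P X ->
  generated_by_flow alpha mu P X phi rho g0 ->
  dissipative alpha mu phi rho g0 ->
  exists (dW : measure_display) (W : measurableType dW)
    (Q : {sigma_finite_measure set W -> \bar R})
    (g : W * measurableTypeR R -> scalarType R k)
    (d' : measure_display) (T' : measurableType d') (P' : probability T' R)
    (N : set (W * measurableTypeR R) -> T' -> scalarType R k)
    (J : R -> W * measurableTypeR R -> scalarType R k)
    (Y : R -> T' -> scalarType R k),
    [/\ standard_borel R W,
        in_Lalpha alpha (Q \x @lebesgue_measure R)%E g,
        SaS_random_measure alpha (Q \x @lebesgue_measure R)%E P' N,
        (forall t, is_oriented_integral alpha (Q \x @lebesgue_measure R)%E t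
                     (fun s xu => g (xu.1, s + xu.2)) (J t))
      & (forall t, is_stochastic_integral alpha (Q \x @lebesgue_measure R)%E P' N
                     (fun xu => g (xu.1, t + xu.2) - g xu + J t xu) (Y t)) /\
        eq_fdd P (fun t w => X t w - X 0 w) P' Y].
Proof.
move=> _ _ _ [hphi hns hrho hg0 [f [a [J [[sS _ [d' [T' [P' [M [Y [hM fY XY]]]]]]] ha hJ hf hfull]]]]] hdis.
have [Q [psi [c [g [J' [[mpsi mc] change gin hJ' [mk kE]]]]]]] :=
  moving_average_representation alpha_gt0 hphi hns hrho ha hg0 hdis hJ hf hfull.
have [N hN] := pull_random_measure_exists alpha_gt0 alpha_lt2 hM mpsi mc change.
(* [W] is [S], whose Borel property comes with the spectral representation. The probability space is
   that of [M], and [Y t - Y 0], the integral of [f t - f 0] against [M], is read again as an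
   integral against [N]. *)
exists dS, S, Q, g, d', T', P', N, J', (fun t w => Y t w - Y 0 w).
split; [exact: sS|exact: gin| |exact: hJ'|split].
- exact: (pull_SaS_random_measure alpha_gt0 alpha_lt2 hM change hN).
- move=> t; apply: (pull_stochastic_integral alpha_gt0 alpha_lt2 hM mpsi mc change hN (mk t)).
  have Yt := stochastic_integralB alpha_gt0 alpha_lt2 (random_measure_measurable hM) (fY t) (fY 0).
  exact: (eq_stochastic_integral alpha_gt0 alpha_lt2 (pull_measurable mpsi mc (mk t)) (kE t) Yt).
- exact: eq_fdd_increments.
Qed.
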